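(* Let $k\ge 1$ be an integer, $\mathbf f\in[L^2(\Omega)]^d$ and $\widehat{\mathbf u}\in[L^2(\Gamma)]^d$. Then there exists one and only one $\mathbf u_h=\{\mathbf u_0,\mathbf u_b\}\in V_h$ with $\mathbf u_b=Q_b\widehat{\mathbf u}$ on $\Gamma$ such that $$a_s(\mathbf u_h,\mathbf v)=(\mathbf f,\mathbf v_0)\qquad\text{for all }\mathbf v=\{\mathbf v_0,\mathbf v_b\}\in V_h^0 .$$
   Context: Domain and partition. $\Omega\subset\mathbb R^d$, $d\in\{2,3\}$, is a bounded connected open polygonal ($d=2$) or polyhedral ($d=3$) domain with Lipschitz boundary $\Gamma=\partial\Omega$. $\mathcal T_h$ is a finite partition of $\Omega$ into polygons ($d=2$) or polyhedra ($d=3$); $h_T$ is the diameter of $T\in\mathcal T_h$ and $h=\max_T h_T$; $\mathcal E_h$ is the set of all edges ($d=2$) or flat faces ($d=3$). Each $e\in\mathcal E_h$ either lies on $\Gamma$ or is shared by two elements. $\mathbf n$ is the unit outward normal on $\partial T$. $(\cdot,\cdot)$, $(\cdot,\cdot)_T$, $\langle\cdot,\cdot\rangle_{\partial T}$ are the $L^2$ inner products on $\Omega$, $T$, $\partial T$ (scalar, vector or matrix valued). Shape regularity. $\mathcal T_h$ is shape regular: there are constants $\rho_v,\rho_e,\kappa,\sigma^*,\gamma_*>0$ and $\theta_0<\pi/2$ such that for every $T\in\mathcal T_h$ and every edge/face $e$ of $T$ with diameter $h_e$: (i) $\rho_v h_T^d\le|T|$ and $\rho_e h_e^{d-1}\le|e|$;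 (ii) $\kappa h_T\le h_e$; (iii) $T$ contains a pyramid with base $e$, apex $A_e\in T$ and height $\sigma_e h_T$ with $\sigma_e\ge\sigma^*$, such that for all $x_e\in e$ the angle between $x_e-A_e$ and the outward normal of $e$ lies in $[0,\theta_0]$; (iv) $T$ has a circumscribed shape-regular simplex $S(T)$ of diameter at most $\gamma_*h_T$, and each $S(T)$ intersects only a bounded number of the other $S(T')$. Spaces. $P_r(D)$ denotes polynomials of degree at most $r$ on $D$. $\mathsf{RM}(T)=\{\mathbf a+\eta\mathbf x:\mathbf a\in\mathbb R^d,\ \eta\in\mathbb R^{d\times d}\text{ skew-symmetric}\}$, and $P_{RM}(e)$ is the space of restrictions to $e$ of functions in $\mathsf{RM}(T)$. Put $V_{k-1}(e)=[P_{k-1}(e)]^d+P_{RM}(e)$ (so it is $[P_{k-1}(e)]^d$ for $k>1$ and $P_{RM}(e)$ for $k=1$). $V_h$ is the space of pairs $\mathbf v=\{\mathbf v_0,\mathbf v_b\}$ with $\mathbf v_0|_T\in[P_k(T)]^d$ for each $T\in\mathcal T_h$ and $\mathbf v_b|_e\in V_{k-1}(e)$ for each $e\in\mathcal E_h$ ($\mathbf v_b$ single valued on each $e$, not required to be the trace of $\mathbf v_0$). $V_h^0=\{\mathbf v\in V_h:\mathbf v_b=0\text{ on }\Gamma\}$. $Q_b$ is, on each $e$, the $L^2$ projection onto $V_{k-1}(e)$. Discrete weak operators. For $\mathbf v\in V_h$ and $T\in\mathcal T_h$, $\nabla_w\cdot\mathbf v|_T\in P_{k-1}(T)$ and $\nabla_w\mathbf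 v|_T\in[P_{k-1}(T)]^{d\times d}$ are defined by $(\nabla_w\cdot\mathbf v,\phi)_T=-(\mathbf v_0,\nabla\phi)_T+\langle\mathbf v_b\cdot\mathbf n,\phi\rangle_{\partial T}$ for all $\phi\in P_{k-1}(T)$, and $(\nabla_w\mathbf v,\varphi)_T=-(\mathbf v_0,\nabla\cdot\varphi)_T+\langle\mathbf v_b,\varphi\mathbf n\rangle_{\partial T}$ for all $\varphi\in[P_{k-1}(T)]^{d\times d}$ (divergence row-wise). $\varepsilon_w(\mathbf v)=\frac12(\nabla_w\mathbf v+(\nabla_w\mathbf v)^T)$. Bilinear forms. With Lamé constants $\mu>0$, $\lambda\ge0$, $s(\mathbf w,\mathbf v)=\sum_{T}h_T^{-1}\langle Q_b\mathbf w_0-\mathbf w_b,Q_b\mathbf v_0-\mathbf v_b\rangle_{\partial T}$ and $a_s(\mathbf w,\mathbf v)=\sum_T2\mu(\varepsilon_w(\mathbf w),\varepsilon_w(\mathbf v))_T+\sum_T\lambda(\nabla_w\cdot\mathbf w,\nabla_w\cdot\mathbf v)_T+s(\mathbf w,\mathbf v)$. *)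

(* Defs.v *)
From HB Require Import structures.
From mathcomp Require Import all_boot all_order all_algebra.
From mathcomp Require Import all_classical all_reals all_analysis.
From mathcomp Require mpoly.
(* The notations of mpoly clash with those of the analysis library. *)
Import (canonicals) mpoly.
Set Implicit Arguments.
Unset Strict Implicit.
Unset Printing Implicit Defensive.
Import Order.TTheory GRing.Theory Num.Theory.
Import numFieldNormedType.Exports.
Local Open Scope classical_set_scope.
Local Open Scope ring_scope.

(* 'rV[R]_n carries the product sigma-algebra of the Borel sets of R, i.e. the
   Borel sets of R^n. *)
Fact measure_rV_display : measure_display.
Proof. exact: default_measure_display. Qed.

Section measurable_rV.
Context {R : realType}.
Variable n : nat.

Let coord (i : 'I_n) (x : 'rV[R]_n) : measurableTypeR R := x 0 i.

Let rV_set0 : g_sigma_preimage coord set0.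
Proof. exact: sigma_algebra0. Qed.

Let rV_setC A : g_sigma_preimage coord A -> g_sigma_preimage coord (~` A).
Proof. exact: sigma_algebraC. Qed.

Let rV_bigcup (F : (set 'rV[R]_n)^nat) :
  (forall i, g_sigma_preimage coord (F i)) ->
  g_sigma_preimage coord (\bigcup_i (F i)).
Proof. exact: sigma_algebra_bigcup. Qed.

HB.instance Definition _ :=
  @isMeasurable.Build measure_rV_display
  'rV[R]_n (g_sigma_preimage coord) rV_set0 rV_setC rV_bigcup.

Lemma measurable_coord (i : 'I_n) :
  measurable_fun [set: 'rV[R]_n] (fun x => x 0 i : measurableTypeR R).
Proof.
move=> _ Y mY; rewrite setTI; apply: sub_sigma_algebra => /=.
rewrite -bigcup_seq/=; exists i => /=; first by rewrite mem_index_enum.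
by exists Y => //; rewrite setTI.
Qed.

Lemma measurable_fun_coordP d (T : measurableType d) (f : T -> 'rV[R]_n) :
  measurable_fun [set: T] f <->
  forall i, measurable_fun [set: T] (fun t => f t 0 i : measurableTypeR R).
Proof.
split=> [mf i|mf].
  exact: (measurableT_comp (measurable_coord i)).
move=> _ A mA; rewrite setTI.
suff : g_sigma_preimage coord `<=` [set B | measurable (f @^-1` B)] by apply.
apply: smallest_sub.
  split => /=.
  - by rewrite preimage_set0.
  - by move=> B mB; rewrite setTD preimage_setC; exact: measurableC.
  - by move=> F mF; rewrite preimage_bigcup; exact: bigcup_measurable.
move=> B; rewrite -bigcup_seq/= => -[i _ [C mC <-]] /=.
rewrite setTI -comp_preimage -[X in measurable X]setTI.
exact: mf.
Qed.

End measurable_rV.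

(* Lebesgue measure on 'rV[R]_n, built by iterating the product with the
   Lebesgue measure on R; consrV is the isomorphism R x R^n -> R^(n+1). *)
Section lebesgue_rV.
Context {R : realType}.

Definition consrV n (p : measurableTypeR R * 'rV[R]_n) : 'rV[R]_n.+1 :=
  \row_i if unlift ord0 i is Some j then p.2 0 j else p.1.

Lemma consrV0 n (p : measurableTypeR R * 'rV[R]_n) : consrV p 0 ord0 = p.1.
Proof. by rewrite mxE unlift_none. Qed.

Lemma consrVS n (p : measurableTypeR R * 'rV[R]_n) (i : 'I_n) :
  consrV p 0 (lift ord0 i) = p.2 0 i.
Proof. by rewrite mxE liftK. Qed.

Lemma measurable_consrV n : measurable_fun setT (@consrV n).
Proof.
apply/measurable_fun_coordP => i.
case: (unliftP ord0 i) => [j|] ->.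
  under eq_fun do rewrite consrVS.
  exact: (measurableT_comp (measurable_coord j) measurable_snd).
under eq_fun do rewrite consrV0.
exact: measurable_fst.
Qed.

Definition unconsrV n (x : 'rV[R]_n.+1) : measurableTypeR R * 'rV[R]_n :=
  (x 0 ord0, \row_i x 0 (lift ord0 i)).

Lemma measurable_unconsrV n : measurable_fun setT (@unconsrV n).
Proof.
apply/measurable_fun_pairP; split; first exact: measurable_coord.
apply/measurable_fun_coordP => i.
rewrite (_ : (fun _ => _) = fun x : 'rV[R]_n.+1 => x 0 (lift ord0 i)).
  exact: measurable_coord.
by apply/funext => x; rewrite /= mxE.
Qed.

Lemma consrVK n : cancel (@consrV n) (@unconsrV n).
Proof.
move=> [a y]; rewrite /unconsrV consrV0; congr pair.
by apply/rowP => i; rewrite mxE consrVS.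
Qed.

Lemma unconsrVK n : cancel (@unconsrV n) (@consrV n).
Proof.
move=> x; apply/rowP => i; case: (unliftP ord0 i) => [j|] ->.
  by rewrite consrVS mxE.
by rewrite consrV0.
Qed.

Section step.
Variables (n : nat) (m : {sigma_finite_measure set 'rV[R]_n -> \bar R}).

Definition lebesgue_step : set 'rV[R]_n.+1 -> \bar R :=
  pushforward (@lebesgue_measure R \x m)%E (@consrV n).

Local Open Scope ereal_scope.

Let step0 : lebesgue_step set0 = 0.
Proof. by rewrite /lebesgue_step /pushforward preimage_set0 measure0. Qed.

Let step_ge0 A : 0 <= lebesgue_step A.
Proof. by rewrite /lebesgue_step /pushforward; exact: measure_ge0. Qed.

Let mpre A : measurable A -> measurable (@consrV n @^-1` A).
Proof.
by move=> mA; rewrite -[X in measurable X]setTI; exact: measurable_consrV.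
Qed.

Let step_sigma_additive : semi_sigma_additive lebesgue_step.
Proof.
move=> F mF tF mUF; rewrite /lebesgue_step /pushforward preimage_bigcup.
apply: measure_semi_sigma_additive.
- by move=> i; exact: mpre.
- apply/trivIsetP => /= i j _ _ ij; rewrite -preimage_setI.
  by move/trivIsetP : tF => /(_ _ _ _ _ ij) ->//; rewrite preimage_set0.
- by rewrite -preimage_bigcup; exact: mpre.
Qed.

HB.instance Definition _ := isMeasure.Build _ _ _ lebesgue_step
  step0 step_ge0 step_sigma_additive.

Let step_sigma_finite : sigma_finite setT lebesgue_step.
Proof.
have /sigma_finiteP[F [TF ndF Foo]] := sigma_finiteT (@lebesgue_measure R).
have /sigma_finiteP[G [TG ndG Goo]] := sigma_finiteT m.
exists (fun i => @unconsrV n @^-1` (F i `*` G i)).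
  rewrite predeqE => x; split => // _.
  have [i _ Fi] : (\bigcup_i F i) (unconsrV x).1 by rewrite -TF.
  have [j _ Gj] : (\bigcup_i G i) (unconsrV x).2 by rewrite -TG.
  exists (maxn i j) => //; split.
  - by move: Fi; exact/subsetPset/ndF/leq_maxl.
  - by move: Gj; exact/subsetPset/ndG/leq_maxr.
move=> i; have [mF Fi] := Foo i; have [mG Gi] := Goo i; split.
  rewrite -[X in measurable X]setTI; apply: measurable_unconsrV => //.
  exact: measurableX.
rewrite /lebesgue_step /pushforward -comp_preimage.
rewrite (_ : _ \o _ = id) ?preimage_id; last first.
  by apply/funext => p /=; rewrite consrVK.
by rewrite product_measure1E// lte_mul_pinfty// ge0_fin_numE.
Qed.

HB.instance Definition _ := Measure_isSigmaFinite.Build _ _ _ lebesgue_step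
  step_sigma_finite.

End step.

Fixpoint lebesgue_rV n : {sigma_finite_measure set 'rV[R]_n -> \bar R} :=
  match n with
  | 0 => \d_(0 : 'rV[R]_0)
  | n'.+1 => lebesgue_step (lebesgue_rV n')
  end.

Lemma measurable_box n (A : 'I_n -> set (measurableTypeR R)) :
  (forall i, measurable (A i)) ->
  measurable [set x : 'rV[R]_n | forall i, A i (x 0 i)].
Proof.
move=> mA.
rewrite (_ : [set _ | _] =
    \bigcap_(i in [set: 'I_n]) ((fun x : 'rV[R]_n => x 0 i) @^-1` A i)).
  apply: fin_bigcap_measurable => // i _; rewrite -[X in measurable X]setTI.
  exact: (measurable_coord i).
by apply/seteqP; split=> x /= Ax i; [move=> _; exact: Ax|exact: Ax].
Qed.

Lemma lebesgue_rV_box n (A : 'I_n -> set (measurableTypeR R)) :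
  (forall i, measurable (A i)) ->
  lebesgue_rV n [set x : 'rV[R]_n | forall i, A i (x 0 i)] =
  (\prod_(i < n) lebesgue_measure (A i))%E.
Proof.
elim: n A => [|n ih] A mA.
  by rewrite big_ord0 /= diracE mem_set// => -[].
rewrite big_ord_recl -(ih (fun i => A (lift ord0 i)))//.
have mB : measurable [set x : 'rV[R]_n | forall i, A (lift ord0 i) (x 0 i)].
  by apply: (measurable_box (A := fun i => A (lift ord0 i))) => i; exact: mA.
rewrite -(product_measure1E (@lebesgue_measure R) (lebesgue_rV n) (mA _) mB).
rewrite /= /lebesgue_step /pushforward; congr (_ _).
apply/seteqP; split=> -[a y] /=.
  move=> Ax; split; first by have := Ax ord0; rewrite consrV0.
  by move=> i; have := Ax (lift ord0 i); rewrite consrVS.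
move=> [Aa Ay] i; case: (unliftP ord0 i) => [j|] ->; first by rewrite consrVS.
by rewrite consrV0.
Qed.

End lebesgue_rV.

Section euclidean.
Context {R : realType}.

Definition mxdot m n (A B : 'M[R]_(m, n)) : R := \tr (A *m B^T).

(* The norm `|_| of 'rV[R]_n is the sup norm; metric quantities use enorm. *)
Definition enorm n (x : 'rV[R]_n) : R := Num.sqrt (mxdot x x).

Definition angle n (x y : 'rV[R]_n) : R :=
  acos (mxdot x y / (enorm x * enorm y)).

Definition diam n (A : set 'rV[R]_n) : R :=
  sup [set enorm (p.1 - p.2) | p in A `*` A].

Definition bd n (A : set 'rV[R]_n) : set 'rV[R]_n :=
  closure A `\` interior A.

End euclidean.

Section polyhedra.
Context {R : realType} (n : nat).
Implicit Types (V : 'M[R]_(n.+1, n)) (D : set 'rV[R]_n).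

(* The n-simplex whose n+1 vertices are the rows of V. *)
Definition simplex V : set 'rV[R]_n :=
  [set t *m V | t in [set t : 'rV[R]_n.+1 |
     (forall i, 0 <= t 0 i) /\ \sum_i t 0 i = 1]].

Definition affinely_independent V : bool :=
  row_free (row_mx V (const_mx 1 : 'cV[R]_n.+1)).

(* Open polygons (n = 2) and polyhedra (n = 3): nonempty connected open sets
   whose closure is a finite union of n-simplices. They are bounded, and the
   condition interior (closure D) = D excludes slits. For n = 1 these are the
   bounded open intervals. *)
Definition polyhedral D : Prop :=
  [/\ D !=set0, open D, connected D, interior (closure D) = D &
      exists N (V : 'I_N -> 'M[R]_(n.+1, n)),
        (forall i, affinely_independent (V i)) /\
        closure D = \bigcup_i simplex (V i)].

(* Near each boundary point, after a rotation taking nu to the last coordinate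
   axis, D is the strict epigraph of a Lipschitz function g. The argument of g
   is the orthogonal projection of y onto the hyperplane orthogonal to nu. *)
Definition lipschitz_boundary D : Prop :=
  forall x, bd D x ->
    exists (nu : 'rV[R]_n) (g : 'rV[R]_n -> R) (L : R),
      [/\ enorm nu = 1, L.-lipschitz g &
          \forall y \near x,
            D y <-> g (y - mxdot y nu *: nu) < mxdot y nu].

End polyhedra.

Section meshes.
Context {R : realType} (d : nat).
Implicit Type E : set 'rV[R]_d.

(* A flat (d-1)-dimensional piece of R^d, as the image of a subset of R^(d-1)
   under the affine map y |-> base + y *m frame, isometric when the rows of the
   frame are orthonormal. The surface measure on the piece is the image of the
   Lebesgue measure of R^(d-1); it does not depend on the parametrization. *)
Record flat := Flat {
  flat_base : 'rV[R]_d;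
  flat_frame : 'M[R]_(d.-1, d);
  flat_dom : set 'rV[R]_d.-1 }.

Definition chart (e : flat) (y : 'rV[R]_d.-1) : 'rV[R]_d :=
  flat_base e + y *m flat_frame e.

(* The relatively open edge or face. *)
Definition flat_set (e : flat) : set 'rV[R]_d := chart e @` flat_dom e.

Definition flat_face (e : flat) : Prop :=
  flat_frame e *m (flat_frame e)^T = 1%:M /\ polyhedral (flat_dom e).

Definition int_flat (e : flat) (g : 'rV[R]_d -> R) : R :=
  \int[lebesgue_rV d.-1]_(y in flat_dom e) g (chart e y).

(* nu is the outward unit normal of the open set E along e: E lies on one side
   of e. In particular e is contained in the boundary of E. *)
Definition outward_normal E (e : flat) (nu : 'rV[R]_d) : Prop :=
  [/\ enorm nu = 1, flat_frame e *m nu^T = 0 &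
      forall x, flat_set e x -> \forall t \near 0^'+,
        E (x - t *: nu) /\ ~ E (x + t *: nu)].

Definition face_of E (e : flat) : Prop := exists nu, outward_normal E e nu.

Definition normal E (e : flat) : 'rV[R]_d :=
  xget 0 [set nu | outward_normal E e nu].

(* Elements are the open sets cell T; the elements of the partition are their
   closures. Faces are relatively open. *)
Record mesh := Mesh {
  elem : finType;
  face : finType;
  cell : elem -> set 'rV[R]_d;
  facet : face -> flat }.

Definition faces (M : mesh) (T : elem M) : pred (face M) :=
  fun e => `[< face_of (cell T) (facet e) >].

Definition polyhedral_partition (Omega : set 'rV[R]_d) (M : mesh) : Prop :=
  [/\ (forall T : elem M, polyhedral (cell T)),
      (forall T1 T2 : elem M, T1 != T2 -> cell T1 `&` cell T2 = set0) &
      closure Omega = \bigcup_(T : elem M) closure (cell T)] /\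
  [/\ (forall e : face M, flat_face (facet e)),
      (forall e1 e2 : face M, e1 != e2 ->
        flat_set (facet e1) `&` flat_set (facet e2) = set0),
      (forall T : elem M, bd (cell T) =
        \bigcup_(e in [set e | faces T e]) closure (flat_set (facet e))),
      (forall e : face M, exists T : elem M, faces T e) &
      (forall e : face M, flat_set (facet e) `<=` bd Omega \/
        exists T1 T2 : elem M, [/\ T1 != T2, faces T1 e & faces T2 e])].

Definition shape_regular (M : mesh) : Prop :=
  exists rho_v rho_e kappa sigma_s gamma_s theta0 : R,
  [/\ [/\ 0 < rho_v, 0 < rho_e & 0 < kappa],
      [/\ 0 < sigma_s, 0 < gamma_s & theta0 < pi / 2] &
  [/\ (forall T : elem M,
        ((rho_v * diam (cell T) ^+ d)%:E <= lebesgue_rV d (cell T))%E) /\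
      (forall (T : elem M) e, faces T e ->
        ((rho_e * diam (flat_set (facet e)) ^+ d.-1)%:E
           <= lebesgue_rV d.-1 (flat_dom (facet e)))%E),
      (forall (T : elem M) e, faces T e ->
        kappa * diam (cell T) <= diam (flat_set (facet e))),
      (forall (T : elem M) e, faces T e ->
        exists (A : 'rV[R]_d) (sigma : R),
        [/\ closure (cell T) A, sigma_s <= sigma,
            (* the height of the pyramid with base e and apex A *)
            mxdot (flat_base (facet e) - A) (normal (cell T) (facet e))
              = sigma * diam (cell T),
            (forall x t, flat_set (facet e) x -> 0 <= t <= 1 ->
              closure (cell T) (A + t *: (x - A))) &
            (forall x, flat_set (facet e) x ->
              0 <= angle (x - A) (normal (cell T) (facet e)) <= theta0)]) &
      exists (S : elem M -> 'M[R]_(d.+1, d)) (rho_s : R) (N : nat),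
        [/\ 0 < rho_s,
            (forall T, cell T `<=` simplex (S T)),
            (forall T, diam (simplex (S T)) <= gamma_s * diam (cell T)),
            (* shape regularity of S T: it contains a ball of radius
               comparable to its diameter *)
            (forall T, affinely_independent (S T) /\ exists c,
              [set x | enorm (x - c) <= rho_s * diam (simplex (S T))]
                `<=` simplex (S T)) &
            (forall T, (#|[pred T' | (T' != T) &&
              `[< simplex (S T) `&` simplex (S T') !=set0 >]]| <= N)%N)]]].

End meshes.

Section function_spaces.
Context {R : realType}.

(* The extension by 0 of f outside D is in L^2. *)
Definition L2 n (D : set 'rV[R]_n) (f : 'rV[R]_n -> R) : Prop :=
  (f \_ D) \in Lfun (lebesgue_rV n) 2%:E.

Definition L2_flat d (e : flat d) (g : 'rV[R]_d -> R) : Prop :=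
  L2 (flat_dom e) (g \o chart e).

Definition poly_on d (r : nat) (D : set 'rV[R]_d) (f : 'rV[R]_d -> R) : Prop :=
  exists p : mpoly.mpoly d R,
    (forall m : mpoly.multinom d,
      m \in mpoly.msupp p -> (mpoly.mdeg m <= r)%N) /\
    (forall x, D x -> f x = mpoly.meval (fun i => x 0 i) p).

Definition mxpoly_on d m n (r : nat) (D : set 'rV[R]_d)
    (F : 'rV[R]_d -> 'M[R]_(m, n)) : Prop :=
  forall i j, poly_on r D (fun x => F x i j).

(* a + eta x, for row vectors. *)
Definition rigid_motion d (r : 'rV[R]_d -> 'rV[R]_d) : Prop :=
  exists (a : 'rV[R]_d) (eta : 'M[R]_d),
    eta^T = - eta /\ forall x, r x = a + x *m eta^T.

Definition partial d (i : 'I_d) (f : 'rV[R]_d -> R) (x : 'rV[R]_d) : R :=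
  'D_(delta_mx 0 i) f x.

Definition grad d (f : 'rV[R]_d -> R) (x : 'rV[R]_d) : 'rV[R]_d :=
  \row_i partial i f x.

Definition row_div d (F : 'rV[R]_d -> 'M[R]_d) (x : 'rV[R]_d) : 'rV[R]_d :=
  \row_i \sum_j partial j (fun y => F y i j) x.

End function_spaces.

Section weak_galerkin.
Context {R : realType} {d : nat} {M : mesh d (R := R)} (k : nat).
Implicit Types (T : elem M) (e : face M).

Definition int_cell T (g : 'rV[R]_d -> R) : R :=
  \int[lebesgue_rV d]_(x in cell T) g x.

(* The integrand may depend on the face, since normals and the functions v_b
   do. *)
Definition int_bd T (g : face M -> 'rV[R]_d -> R) : R :=
  \sum_(e | faces T e) int_flat (facet e) (g e).

(* V_(k-1)(e) *)
Definition face_space e (q : 'rV[R]_d -> 'rV[R]_d) : Prop :=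
  exists p r : 'rV[R]_d -> 'rV[R]_d,
    [/\ mxpoly_on k.-1 (flat_set (facet e)) p, rigid_motion r &
        forall x, flat_set (facet e) x -> q x = p x + r x].

(* A pair {v_0, v_b}: wint v T is the restriction of v_0 to T and is relevant
   only on the closure of T; wbd v e is v_b on e and is relevant only on e. *)
Record wfun := WFun {
  wint : elem M -> 'rV[R]_d -> 'rV[R]_d;
  wbd : face M -> 'rV[R]_d -> 'rV[R]_d }.
Implicit Types u v w : wfun.

Definition weq u v : Prop :=
  (forall T x, closure (cell T) x -> wint u T x = wint v T x) /\
  (forall e x, flat_set (facet e) x -> wbd u e x = wbd v e x).

Definition Vh v : Prop :=
  (forall T, mxpoly_on k (closure (cell T)) (wint v T)) /\
  (forall e, face_space e (wbd v e)).

Definition on_boundary (Omega : set 'rV[R]_d) e : Prop :=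
  flat_set (facet e) `<=` bd Omega.

Definition Vh0 (Omega : set 'rV[R]_d) v : Prop :=
  Vh v /\ forall e, on_boundary Omega e ->
    forall x, flat_set (facet e) x -> wbd v e x = 0.

(* v_0 as a function on Omega, defined almost everywhere. *)
Definition broken v (x : 'rV[R]_d) : 'rV[R]_d :=
  \sum_(T : elem M) \1_(cell T) x *: wint v T x.

(* The L^2 projection of u onto V_(k-1)(e). *)
Definition Qb e (u : 'rV[R]_d -> 'rV[R]_d) : 'rV[R]_d -> 'rV[R]_d :=
  xget (fun=> 0) [set q | face_space e q /\
    forall phi, face_space e phi ->
      int_flat (facet e) (fun x => mxdot (q x) (phi x)) =
      int_flat (facet e) (fun x => mxdot (u x) (phi x))].

Definition weak_div v T : 'rV[R]_d -> R :=
  xget (fun=> 0) [set w | poly_on k.-1 (closure (cell T)) w /\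
    forall phi, poly_on k.-1 (closure (cell T)) phi ->
      int_cell T (fun x => w x * phi x) =
      - int_cell T (fun x => mxdot (wint v T x) (grad phi x))
      + int_bd T (fun e x =>
          mxdot (wbd v e x) (normal (cell T) (facet e)) * phi x)].

(* normal *m phi^T is the row vector of the column phi n. *)
Definition weak_grad v T : 'rV[R]_d -> 'M[R]_d :=
  xget (fun=> 0) [set G | mxpoly_on k.-1 (closure (cell T)) G /\
    forall phi : 'rV[R]_d -> 'M[R]_d, mxpoly_on k.-1 (closure (cell T)) phi ->
      int_cell T (fun x => mxdot (G x) (phi x)) =
      - int_cell T (fun x => mxdot (wint v T x) (row_div phi x))
      + int_bd T (fun e x =>
          mxdot (wbd v e x) (normal (cell T) (facet e) *m (phi x)^T))].

Definition weak_strain v T (x : 'rV[R]_d) : 'M[R]_d :=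
  2^-1 *: (weak_grad v T x + (weak_grad v T x)^T).

Definition stab w v : R :=
  \sum_T (diam (cell T))^-1 *
    int_bd T (fun e x =>
      mxdot (Qb e (wint w T) x - wbd w e x) (Qb e (wint v T) x - wbd v e x)).

Definition a_s (mu lambda : R) w v : R :=
  \sum_T 2 * mu *
    int_cell T (fun x => mxdot (weak_strain w T x) (weak_strain v T x))
  + \sum_T lambda *
    int_cell T (fun x => weak_div w T x * weak_div v T x)
  + stab w v.

Definition wg_solution (Omega : set 'rV[R]_d) (mu lambda : R)
    (f uhat : 'rV[R]_d -> 'rV[R]_d) u : Prop :=
  [/\ Vh u,
      (forall e, on_boundary Omega e -> forall x, flat_set (facet e) x ->
        wbd u e x = Qb e uhat x) &
      forall v, Vh0 Omega v ->
        a_s mu lambda u v =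
        \int[lebesgue_rV d]_(x in Omega) mxdot (f x) (broken v x)].

End weak_galerkin.

(* Main.v *)
(* The problem is linear and finite dimensional, so that existence follows from
   uniqueness, and uniqueness follows from the definiteness of a_s on V_h^0. If
   a_s(v, v) = 0, then eps_w(v) = 0 and Q_b v_0 = v_b on every face. Testing
   the definition of the weak gradient on T with the polynomial
   phi = 2 eps(v_0), where v_b may be replaced by Q_b v_0 and then by v_0, and
   integrating by parts gives int_T |phi|^2 = 0; hence v_0 is a rigid motion on
   each T and v_b = v_0 on the faces of T. A rigid motion vanishing on a face is
   0, so the set Z of the cells on which v_0 <> 0 contains, with a cell, its
   neighbours, and has no face on the boundary. By the divergence theorem for
   x_0, summed over Z, |Z| is a sum over faces whose two contributions have
   opposite normals; hence |Z| = 0 and Z is empty.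

   The divergence theorem on a polyhedral set, for polynomials, comes from
   Fubini on the lines of direction v = (1, v'): almost every line crosses the
   boundary only inside faces that are transversal to it, where the fundamental
   theorem of calculus applies, and the projection of a face with unit normal
   nu along v multiplies measures by |<v, nu>|. *)
Require Import Defs.
From mathcomp Require Import all_boot all_order all_algebra.
From mathcomp Require Import all_classical all_reals all_analysis.
From mathcomp Require Import measurable_realfun ring lra.
From mathcomp Require mpoly.
Import (canonicals) mpoly.
Import Order.TTheory GRing.Theory Num.Theory.
Import numFieldNormedType.Exports.
Local Open Scope classical_set_scope.
Local Open Scope ring_scope.
Set Implicit Arguments.
Unset Strict Implicit.
Unset Printing Implicit Defensive.

(** * Lebesgue measure on R^n *)

(** The faces of a cell are given only by flat charts and a one-sidedness condition. On a generic
    line this yields local information, the jump of the indicator of the cell at each crossing; a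
    connectedness argument turns it into a global formula, the indicator as a signed sum of
    half-lines. With v = (1, v') instead of a coordinate axis, every line is parametrized by the
    first coordinate and a shear of determinant 1 straightens the whole family. Both sides of the
    divergence theorem are linear in v and these directions span the space, so each partial
    derivative follows. Functions are total, but only their values on closed cells and on faces
    matter, while integrals see open cells. Hence functions are compared on a set of relevant
    points, polynomials carry identities from a cell to its closure, and the Galerkin argument is
    stated for forms blind to the irrelevant values. The weak operators and Q_b are defined by
    choice: existence and uniqueness on the relevant points come first, and linearity follows from
    uniqueness. *)

Lemma ge0_integral_comp_scale d1 d2 (T1 : measurableType d1)
    (T2 : measurableType d2) (R : realType) (phi : T1 -> T2) (k : R)
    (m1 : {measure set T1 -> \bar R}) (m2 : {measure set T2 -> \bar R})
    (f : T2 -> \bar R) :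
  measurable_fun [set: T1] phi -> 0 <= k ->
  (forall A, measurable A -> m1 (phi @^-1` A) = (k%:E * m2 A)%E) ->
  measurable_fun [set: T2] f -> (forall x, (0 <= f x)%E) ->
  (\int[m1]_x f (phi x) = k%:E * \int[m2]_x f x)%E.
Proof.
move=> mphi k0 H mf f0.
pose k' : {nonneg R} := NngNum k0.
rewrite -(ge0_integral_mscale m2 measurableT k' mf)//.
transitivity (\int[pushforward m1 phi]_x f x)%E.
  by rewrite (@ge0_integral_pushforward _ _ _ _ _ phi).
pose nu : measure T2 R := pushforward m1 phi.
rewrite (@eq_measure_integral _ _ _ setT (mscale k' m2) (nu mphi))// => A mA _.
exact: H.
Qed.

Section affine_line.
Context {R : realType}.
Local Notation mu := (@lebesgue_measure R).
Local Notation mR := (measurableTypeR R).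

Let affine (a c : R) : mR -> mR := fun x => a * x + c.

Let measurable_affine (a c : R) : measurable_fun [set: mR] (affine a c).
Proof.
apply: measurable_funD; last exact: measurable_cst.
exact: mulrl_measurable.
Qed.

(** The measure that sends A to a times the measure of its preimage agrees with [mu] on half-open
    intervals, hence is [mu]. *)
Let lebesgue_affine_gt0 (a c : R) (A : set mR) : 0 < a -> measurable A ->
  (mu (affine a c @^-1` A) = a^-1%:E * mu A)%E.
Proof.
move=> a0 mA.
have a0' : 0 <= a by exact: ltW.
pose k : {nonneg R} := NngNum a0'.
have ma := measurable_affine a c.
pose nu : measure _ R := pushforward (T2 := mR) mu (affine a c).
have /(_ (mscale k (nu ma))) H := @lebesgue_measure_unique R.
have {}H : mu A = (a%:E * nu ma A)%E.
  rewrite H// => X /ocitvP[->|]; first by rewrite !measure0.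
  move=> -[[l u]/= lu ->]; rewrite /mscale/= /nu /pushforward.
  rewrite [X in (_ * mu X)%E](_ : _ = [set` `](l - c) / a, (u - c) / a]]).
    rewrite !lebesgue_measure_itv/= !lte_fin lu ltr_pM2r ?invr_gt0// ltrD2r lu.
    rewrite -!EFinB -EFinM; congr EFin.
    rewrite -mulrBl mulrC mulfVK ?gt_eqF//; ring.
  apply/seteqP; split=> x /=; rewrite !in_itv/= /affine ltr_pdivrMr// ler_pdivlMr//.
    by move=> /andP[h1 h2]; apply/andP; split; lra.
  by move=> /andP[h1 h2]; apply/andP; split; lra.
rewrite H muleA -EFinM mulVf ?gt_eqF// mul1e.
by [].
Qed.

Lemma lebesgue_affine (a c : R) (A : set mR) : a != 0 -> measurable A ->
  (mu ((fun x => (a * x + c)%R) @^-1` A) = `|a|^-1%:E * mu A)%E.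
Proof.
move=> a0 mA; have [a_gt0|a_lt0|/eqP] := ltrgt0P a; last by rewrite (negbTE a0).
  exact: (lebesgue_affine_gt0 c a_gt0 mA).
rewrite -(@lebesgue_affine_gt0 (- a) c A) ?oppr_gt0//.
rewrite -[RHS]lebesgue_measureN; last first.
  by rewrite -[X in measurable X]setTI; exact: measurable_affine.
rewrite /pushforward -comp_preimage; congr (mu _); apply/seteqP.
by split=> x /=; rewrite /affine mulrNN.
Qed.

Lemma ge0_integral_affine (a c : R) (f : mR -> \bar R) :
  a != 0 -> measurable_fun [set: mR] f -> (forall x, (0 <= f x)%E) ->
  (\int[mu]_x f (a * x + c)%R = `|a|^-1%:E * \int[mu]_x f x)%E.
Proof.
move=> a0 mf f0.
have k0 : 0 <= `|a|^-1 by rewrite invr_ge0.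
refine (ge0_integral_comp_scale (measurable_affine a c) k0 _ mf f0) => A mA.
exact: (lebesgue_affine c a0 mA).
Qed.

End affine_line.

Section lebesgue_rV_integral.
Context {R : realType}.
Local Notation mu := (@lebesgue_measure R).
Local Notation lam := (@lebesgue_rV R).
Local Notation mR := (measurableTypeR R).

Lemma consrVE n (p : mR * 'rV[R]_n) :
  consrV p = row_mx p.1%:M p.2 :> 'rV[R]_(1 + n).
Proof.
apply/rowP => i; case: (split_ordP i) => j ->.
  rewrite row_mxEl [in RHS]mxE !ord1 eqxx mulr1n.
  by rewrite (_ : lshift n 0 = ord0) ?consrV0//; exact/val_inj.
by rewrite row_mxEr -consrVS; congr (_ 0 _); exact/val_inj.
Qed.

Lemma measurable_funV d (T : measurableType d) n (f : T -> 'rV[R]_n) :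
  (forall i, measurable_fun [set: T] (fun t => f t 0 i : mR)) ->
  measurable_fun [set: T] f.
Proof. by move=> mf; apply/measurable_fun_coordP. Qed.

Lemma measurable_addrV n (c : 'rV[R]_n) :
  measurable_fun [set: 'rV[R]_n] (fun x => x + c).
Proof.
apply: measurable_funV => i; under eq_fun do rewrite mxE.
exact: measurable_funD (measurable_coord i) (measurable_cst _).
Qed.

Lemma measurable_mulmx n m (A : 'M[R]_(n, m)) :
  measurable_fun [set: 'rV[R]_n] (fun x => x *m A).
Proof.
apply: measurable_funV => i; under eq_fun do rewrite mxE.
apply: measurable_sum => j; apply: measurable_funM.
  exact: measurable_coord.
exact: measurable_cst.
Qed.

Lemma ge0_integral_rVS1 n (f : 'rV[R]_n.+1 -> \bar R) :
  measurable_fun setT f -> (forall x, (0 <= f x)%E) ->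
  (\int[lam n.+1]_x f x = \int[mu]_s \int[lam n]_y f (consrV (s, y)))%E.
Proof.
move=> mf f0.
rewrite (@ge0_integral_pushforward _ _ _ _ _ _ (@measurable_consrV R n))//.
rewrite preimage_setT fubini_tonelli1//.
  by apply: measurableT_comp mf (@measurable_consrV R n).
by move=> x; exact: f0.
Qed.

(** Both orders of integration are kept: the inner variable has to be the one on which a given
    linear map acts simply once the other is fixed. *)
Lemma ge0_integral_rVS2 n (f : 'rV[R]_n.+1 -> \bar R) :
  measurable_fun setT f -> (forall x, (0 <= f x)%E) ->
  (\int[lam n.+1]_x f x = \int[lam n]_y \int[mu]_s f (consrV (s, y)))%E.
Proof.
move=> mf f0.
rewrite (@ge0_integral_pushforward _ _ _ _ _ _ (@measurable_consrV R n))//.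
rewrite preimage_setT fubini_tonelli2//.
  by apply: measurableT_comp mf (@measurable_consrV R n).
by move=> x; exact: f0.
Qed.

Lemma measurable_consrVl d (T : measurableType d) n (f : 'rV[R]_n.+1 -> T) (s : mR) :
  measurable_fun setT f -> measurable_fun setT (fun y : 'rV[R]_n => f (consrV (s, y))).
Proof.
move=> mf; apply: (measurableT_comp mf).
by apply: (measurableT_comp (@measurable_consrV R n)); exact: pair1_measurable.
Qed.

Lemma measurable_consrVr d (T : measurableType d) n (f : 'rV[R]_n.+1 -> T) (y : 'rV[R]_n) :
  measurable_fun setT f -> measurable_fun setT (fun s : mR => f (consrV (s, y))).
Proof.
move=> mf; apply: (measurableT_comp mf).
by apply: (measurableT_comp (@measurable_consrV R n)); exact: pair2_measurable.
Qed.

Lemma consrVD n (s t : mR) (y z : 'rV[R]_n) :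
  consrV (s, y) + consrV (t, z) = consrV (s + t, y + z).
Proof. by rewrite !consrVE/= (@add_row_mx _ _ 1) -raddfD. Qed.

Lemma ge0_integral_rVD n (c : 'rV[R]_n) (f : 'rV[R]_n -> \bar R) :
  measurable_fun setT f -> (forall x, (0 <= f x)%E) ->
  (\int[lam n]_x f (x + c)%R = \int[lam n]_x f x)%E.
Proof.
elim: n c f => [|n ih] c f mf f0.
  by apply: eq_integral => x _; congr f; rewrite [c]thinmx0 addr0.
rewrite !ge0_integral_rVS1//; last first.
  exact: measurableT_comp mf (measurable_addrV c).
have -> : c = consrV (unconsrV c) by rewrite unconsrVK.
case: (unconsrV c) => s z.
transitivity (\int[mu]_t \int[lam n]_y f (consrV ((1 * t + s)%R, y)))%E.
  apply: eq_integral => t _; rewrite mul1r.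
  rewrite -(ih z (fun y => f (consrV (t + s, y))))//; last first.
    exact: measurable_consrVl mf.
  by apply: eq_integral => y _; rewrite consrVD.
rewrite (@ge0_integral_affine R 1 s (fun t => \int[lam n]_y f (consrV (t, y)))%E)//.
- by rewrite normr1 invr1 mul1e.
- have mg := measurableT_comp mf (@measurable_consrV R n).
  by apply: (@measurable_fun_fubini_tonelli_F _ _ _ _ _ (lam n) _ mg) => x; exact: f0.
- by move=> x; exact: integral_ge0.
Qed.

(** The linear change of variables formula as a property of the matrix: it is stable under products,
    so that it only has to be checked on the factors of a decomposition. *)
Definition scales_lebesgue n (A : 'M[R]_n) := forall f : 'rV[R]_n -> \bar R,
  measurable_fun setT f -> (forall x, (0 <= f x)%E) ->
  (\int[lam n]_x f (x *m A) = `|\det A|^-1%:E * \int[lam n]_x f x)%E.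

Lemma scales_lebesgueM n (A B : 'M[R]_n) :
  scales_lebesgue A -> scales_lebesgue B -> scales_lebesgue (A *m B).
Proof.
move=> hA hB f mf f0; under eq_integral do rewrite mulmxA.
rewrite (hA (fun x => f (x *m B)))//; last first.
  exact: measurableT_comp mf (measurable_mulmx B).
by rewrite hB// det_mulmx normrM invfM EFinM muleA.
Qed.

(** The map sends (s, y) to (s + y c, y): for fixed y it is a translation of the line. *)
Lemma scales_lebesgue_shear n (c : 'cV[R]_n) :
  scales_lebesgue (block_mx 1%:M 0 c 1%:M : 'M[R]_(1 + n)).
Proof.
move=> f mf f0.
rewrite det_lblock !det1 mul1r normr1 invr1 mul1e.
rewrite !ge0_integral_rVS2//; last first.
  exact: measurableT_comp mf (measurable_mulmx (block_mx _ _ _ _ : 'M[R]_(1 + n))).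
apply: eq_integral => y _.
transitivity (\int[mu]_s f (consrV (1 * s + (y *m c) 0 0, y)%R))%E.
  apply: eq_integral => s _; congr f.
  rewrite !consrVE/= mul_row_block !mulmx1 mulmx0 add0r mul1r; congr row_mx.
  by rewrite [y *m c in LHS]mx11_scalar -raddfD.
rewrite (@ge0_integral_affine R 1 _ (fun s => f (consrV (s, y))))//.
  by rewrite normr1 invr1 mul1e.
exact: measurable_consrVr mf.
Qed.

(** The map sends (s, y) to (a s, y D + s b): for fixed s, the inner integral sees D and a
    translation, and the outer one a dilation by a. *)
Lemma scales_lebesgue_ublock n (a : R) (b : 'rV[R]_n) (D : 'M[R]_n) :
  a != 0 -> scales_lebesgue D ->
  scales_lebesgue (block_mx a%:M b 0 D : 'M[R]_(1 + n)).
Proof.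
move=> a0 hD f mf f0.
rewrite det_ublock det_scalar1 normrM invfM EFinM.
rewrite !ge0_integral_rVS1//; last first.
  exact: measurableT_comp mf (measurable_mulmx (block_mx _ _ _ _ : 'M[R]_(1 + n))).
have mg := measurableT_comp mf (@measurable_consrV R n).
pose H t := (\int[lam n]_z f (consrV (t, z)))%E.
have mH : measurable_fun setT H.
  by apply: (@measurable_fun_fubini_tonelli_F _ _ _ _ _ (lam n) _ mg) => x; exact: f0.
have H0 t : (0 <= H t)%E by exact: integral_ge0.
have k0 : (0 <= `|\det D|^-1%:E)%E by rewrite lee_fin invr_ge0.
transitivity (\int[mu]_s (`|\det D|^-1%:E * H (a * s + 0)%R))%E.
  apply: eq_integral => s _.
  transitivity (\int[lam n]_y f (consrV ((a * s + 0)%R, y *m D + s *: b)%R))%E.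
    apply: eq_integral => y _; congr f.
    rewrite !consrVE/= mul_row_block mulmx0 !addr0 -scalar_mxM mulrC.
    by rewrite mul_scalar_mx addrC.
  have mg1 : measurable_fun setT (fun z => f (consrV ((a * s + 0)%R, z))).
    exact: measurable_consrVl mf.
  rewrite (hD (fun z => f (consrV ((a * s + 0)%R, z + s *: b))))//; last first.
    exact: measurableT_comp mg1 (measurable_addrV (s *: b)).
  by rewrite (ge0_integral_rVD (s *: b) mg1).
rewrite ge0_integralZl//; last first.
  apply: measurableT_comp mH _; exact: measurable_funD.
by rewrite ge0_integral_affine// muleCA muleA.
Qed.

(** Block elimination by induction on the size: up to shears, A is block upper triangular with a
    nonzero corner and a smaller invertible block. *)
Lemma scales_lebesgue_unit n (A : 'M[R]_n) : A \in unitmx -> scales_lebesgue A.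
Proof.
elim: n A => [|n ih] A uA.
  move=> f _ _; rewrite det_mx00 normr1 invr1 mul1e.
  by apply: eq_integral => x _; congr f; rewrite [x *m A]thinmx0 [x]thinmx0.
move: A uA; rewrite -[n.+1]/(1 + n)%N => A uA.
pose L (c : 'cV[R]_n) : 'M[R]_(1 + n) := block_mx 1%:M 0 c 1%:M.
have LN c : L c *m L (- c) = 1%:M.
  rewrite /L mulmx_block !(mulmx1, mulmx0, mul1mx, mul0mx) addr0 add0r addrN.
  by rewrite add0r -scalar_mx_block.
(* Multiplication by [L c] adds a combination of the other columns to the first one. If the corner
   of A is 0, some other entry of its first row is not, A being invertible. *)
have [c c0] : exists c, ulsubmx (A *m L c) 0 0 != 0.
  have E c : ulsubmx (A *m L c) =
      ulsubmx A + ursubmx A *m c.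
    rewrite /L -[A in LHS]submxK mulmx_block block_mxKul.
    by rewrite mulmx1.
  have [A0|] := eqVneq (ulsubmx A) 0; last first.
    move=> A0; exists 0; rewrite E mulmx0 addr0; apply: contra A0 => /eqP A0.
    by rewrite [ulsubmx _]mx11_scalar A0 raddf0.
  have [j Aj|Aj] := pickP (fun j => ursubmx A 0 j != 0).
    exists (delta_mx j 0).
    by rewrite E A0 add0r -colE mxE.
  have : (delta_mx 0 0 : 'rV_(1 + n)) *m A = 0.
    rewrite -rowE -[A]submxK A0.
    apply/rowP => i; rewrite !mxE; case: split_ordP => // k _.
    rewrite mxE; case: split_ordP => l _; first by rewrite mxE.
    by rewrite [k]ord1; exact/eqP/negbFE/Aj.
  move/(congr1 (mulmx^~ (invmx A))); rewrite mulmxK// mul0mx.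
  by move/matrixP => /(_ 0 0); rewrite !mxE/= => /eqP; rewrite oner_eq0.
set A' := A *m L c in c0.
have uA' : A' \in unitmx.
  by rewrite unitmx_mul uA/= (mulmx1_unit (LN c)).1.
rewrite (_ : A = A' *m L (- c)); last by rewrite -mulmxA LN mulmx1.
apply: scales_lebesgueM; last exact: scales_lebesgue_shear.
(* Block LU decomposition with pivot a; the remaining block is the Schur complement. *)
pose a := ulsubmx A' 0 0; pose b := ursubmx A'.
pose e := dlsubmx A'; pose D := drsubmx A'.
have A'E : A' = L (a^-1 *: e) *m (block_mx a%:M b 0 (D - a^-1 *: e *m b) : 'M[R]_(1 + n)).
  rewrite mulmx_block !(mul1mx, mul0mx, mulmx0, addr0, add0r) -scalemxAl.
  rewrite addrCA subrr addr0 mul_mx_scalar scalerA divff// scale1r.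
  by rewrite -[LHS]submxK [ulsubmx A']mx11_scalar.
rewrite A'E in uA'; rewrite A'E; apply: scales_lebesgueM; first exact: scales_lebesgue_shear.
apply: scales_lebesgue_ublock => //; apply: ih.
move: uA'; rewrite unitmx_mul => /andP[_].
by rewrite unitmxE det_ublock unitrM => /andP[_]; rewrite -unitmxE.
Qed.

End lebesgue_rV_integral.

(** * Open sets, bounded sets and hyperplanes *)

Section lebesgue_rV_sets.
Context {R : realType}.
Local Notation mu := (@lebesgue_measure R).
Local Notation lam := (@lebesgue_rV R).
Local Notation mR := (measurableTypeR R).

Lemma mxdot_rVE n (x y : 'rV[R]_n) : mxdot x y = \sum_i x 0 i * y 0 i.
Proof.
rewrite /mxdot /mxtrace big_ord1 mxE; apply: eq_bigr => i _.
by rewrite !mxE.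
Qed.

Lemma ball_rVP n (x y : 'rV[R]_n) (e : R) : 0 < e ->
  ball x e y <-> forall i, `|x 0 i - y 0 i| < e.
Proof.
move=> e0; split=> [xy i|xy]; first by have := xy.2 0 i; rewrite -ball_normE.
by split=> // i j; rewrite -ball_normE/= ord1.
Qed.

(** The sigma-algebra is generated by the coordinates, not by the topology; the link is that an open
    set is the countable union of the rational boxes it contains. *)
Lemma open_measurable_rV n (U : set 'rV[R]_n) : open U -> measurable U.
Proof.
move=> oU.
(* The half-widths of the boxes. A box whose centre is within [u m] of x in each coordinate stays
   within [2 * u m] of x, whence the factor 2. *)
have [u u_gt0 u_small] : exists2 u : nat -> R, (forall m, 0 < u m) &
    (forall e, 0 < e -> exists m, 2 * u m < e).
  exists (fun m => m.+1%:R^-1) => [m|e e0]; first by rewrite invr_gt0.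
  exists (Num.truncn (2 / e)); rewrite -ltr_pdivlMl//.
  rewrite invf_plt ?posrE ?mulr_gt0 ?invr_gt0//.
  by rewrite invfM invrK; exact: truncnS_gt.
pose box (q : 'rV[rat]_n) m : set 'rV[R]_n :=
  [set x | forall i, `](ratr (q 0 i) - u m)%R, (ratr (q 0 i) + u m)%R[%classic (x 0 i)].
pose F (p : 'rV[rat]_n * nat) := if `[< box p.1 p.2 `<=` U >] then box p.1 p.2 else set0.
rewrite (_ : U = \bigcup_p F p); last first.
  apply/seteqP; split=> [x Ux|x [[q m] _]]; last first.
    by rewrite /F/=; case: asboolP => // + /[dup] => /[swap] _ /[apply].
  have /nbhs_ballP[e /= e0 xeU] : nbhs x U by exact: open_nbhs_nbhs.
  have [m me] := u_small e e0; have m0 := u_gt0 m.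
  have /choice[q qx] (i : 'I_n) : exists q : rat,
      (ratr q : R) \in `]x 0 i - u m, x 0 i + u m[.
    by apply: rat_in_itvoo; lra.
  have bU : box (\row_i q i) m `<=` U.
    move=> y /= yb; apply: xeU; apply/ball_rVP => // j.
    move: (qx j) (yb j); rewrite /= mxE !in_itv/= => /andP[h1 h2] /andP[h3 h4].
    by rewrite ltr_norml; lra.
  exists (\row_i q i, m) => //; rewrite /F/=; case: asboolP => // _ i /=.
  by rewrite mxE; move: (qx i); rewrite !in_itv/= => /andP[h1 h2]; lra.
apply: countable_bigcupT_measurable => [|[q m]]; first exact: countableP.
rewrite /F; case: asboolP => _ //=.
by apply: (measurable_box (A := fun i => `](ratr (q 0 i) - u m)%R, (ratr (q 0 i) + u m)%R[%classic)) => i; exact: measurable_itv.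
Qed.

Lemma closed_measurable_rV n (U : set 'rV[R]_n) : closed U -> measurable U.
Proof.
move=> cU; rewrite -(setCK U); apply: measurableC; apply: open_measurable_rV.
exact: closed_openC.
Qed.

Definition coord_bounded n (A : set 'rV[R]_n) :=
  exists K : R, forall x, A x -> forall i, `|x 0 i| <= K.

Lemma lebesgue_rV_bounded n (A : set 'rV[R]_n) :
  measurable A -> coord_bounded A -> (lam n A < +oo)%E.
Proof.
move=> mA [K AK].
pose I (i : 'I_n) : set mR := [set` `[- K, K]].
have mI i : measurable (I i) by exact: measurable_itv.
apply: (@le_lt_trans _ _ (lam n [set x | forall i, I i (x 0 i)])).
  apply: le_measure; rewrite ?inE//; first exact: measurable_box.
  by move=> x Ax /= i; rewrite /I /= in_itv/= -ler_norml AK.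
rewrite lebesgue_rV_box// ltey_eq; apply/orP; left; apply: prode_fin_num => i _.
rewrite /I lebesgue_measure_itv; case: ifP => // _.
Qed.

Lemma lebesgue_rV_open_gt0 n (U : set 'rV[R]_n) :
  open U -> U !=set0 -> (0 < lam n U)%E.
Proof.
move=> oU [x Ux].
have /nbhs_ballP[e /= e0 xeU] : nbhs x U by exact: open_nbhs_nbhs.
pose I (i : 'I_n) : set mR := [set` `]x 0 i - e, x 0 i + e[].
have mI i : measurable (I i) by exact: measurable_itv.
apply: (@lt_le_trans _ _ (lam n [set x | forall i, I i (x 0 i)])).
  rewrite lebesgue_rV_box//; elim/big_ind: _ => // [a b|i _]; first exact: mule_gt0.
  by rewrite /I lebesgue_measure_itv/= lte_fin ifT ?lte_fin; lra.
apply: le_measure; rewrite ?inE//; first exact: measurable_box.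
  exact: open_measurable_rV.
move=> y /= Iy; apply: xeU; apply/ball_rVP => // j.
move: (Iy j); rewrite /I/= in_itv/= => /andP[h1 h2].
by rewrite ltr_norml; lra.
Qed.

Lemma measurable_mxdot n (a : 'rV[R]_n) (c : R) (A : set mR) :
  measurable A -> measurable [set x | A (mxdot a x + c)].
Proof.
move=> mA; rewrite (_ : [set _ | _] = (fun x : 'rV[R]_n => mxdot a x + c : mR) @^-1` A)//.
rewrite -[X in measurable X]setTI.
suff : measurable_fun setT (fun x : 'rV[R]_n => mxdot a x + c : mR) by apply.
rewrite (_ : (fun x => _) = (fun x : 'rV[R]_n => \sum_i a 0 i * x 0 i + c)); last first.
  by apply/funext => x; rewrite mxdot_rVE.
apply: measurable_funD; last exact: measurable_cst.
apply: measurable_sum => j; apply: measurable_funM.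
  exact: measurable_cst.
exact: measurable_coord.
Qed.

(** If the first coordinate of a is 0, slices in the other coordinates are again of this form;
    otherwise each line along the first axis meets the set in one point. Allowing a = 0 with c <> 0,
    which gives the empty set, is what lets the induction start at n = 0. *)
Lemma lebesgue_hyperplane n (a : 'rV[R]_n) (c : R) :
  (a != 0) || (c != 0) -> lam n [set x | mxdot a x + c = 0] = 0%E.
Proof.
elim: n a c => [|n ih] a c.
  rewrite [a]thinmx0 eqxx /= => c0; rewrite (_ : [set _ | _] = set0) ?measure0//.
  apply/seteqP; split=> x //=; rewrite mxdot_rVE big_ord0 add0r => c0'.
  by rewrite c0' eqxx in c0.
have mS m (b : 'rV[R]_m) e : measurable [set x | mxdot b x + e = 0].
  exact: (measurable_mxdot b e (measurable_set1 0)).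
have mf : measurable_fun setT (fun x => (\1_[set x | mxdot a x + c = 0] x)%:E : \bar R).
  by apply/measurable_EFinP; apply: measurable_indic; exact: mS.
have f0 x : (0 <= (\1_[set x | mxdot a x + c = 0] x)%:E :> \bar R)%E.
  by rewrite lee_fin.
have aE : a = consrV (unconsrV a) by rewrite unconsrVK.
have dE s y : mxdot a (consrV (s, y)) = a 0 ord0 * s + mxdot (unconsrV a).2 y.
  rewrite !mxdot_rVE big_ord_recl consrV0; congr (_ + _); apply: eq_bigr => i _.
  by rewrite consrVS mxE.
have lamE m (S : set 'rV[R]_m) : measurable S -> lam m S = (\int[lam m]_x (\1_S x)%:E)%E.
  by move=> ?; rewrite integral_indic// setIT.
move=> ac; rewrite lamE//.
have [a0|a0] := eqVneq (a 0 ord0) 0.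
  rewrite ge0_integral_rVS1//; apply: integral0_eq => s _.
  rewrite -[RHS](ih (unconsrV a).2 c).
    rewrite lamE//.
    apply: eq_integral => y _; rewrite !indicE; congr ((nat_of_bool _)%:R%:E).
    by apply/idP/idP; rewrite !inE/= dE a0 mul0r add0r.
  move: ac; case: (c != 0); rewrite ?orbT// !orbF; apply: contra => /eqP a'0.
  apply/eqP/rowP => i; rewrite mxE; case: (unliftP ord0 i) => [j ->|->//].
  by move/rowP : a'0 => /(_ j); rewrite !mxE.
rewrite ge0_integral_rVS2//; apply: integral0_eq => y _.
rewrite -[RHS](lebesgue_measure_set1 (- (mxdot (unconsrV a).2 y + c) / a 0 ord0)).
rewrite -[X in mu X]setIT -integral_indic//.
apply: eq_integral => s _; rewrite !indicE; congr ((nat_of_bool _)%:R%:E).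
apply/idP/idP; rewrite !inE/= dE.
  by move=> h; apply: (mulIf a0); rewrite mulfVK//; lra.
by move=> ->; rewrite mulrC mulfVK//; lra.
Qed.

End lebesgue_rV_sets.

(** * Polynomial functions *)

Section polynomial_functions.
Context {R : realType}.
Local Notation poly n := (mpoly.mpoly n R).
Local Notation pX i := (mpoly.mpolyX R (mpoly.mnm1 i)).

Definition pev n (p : poly n) (x : 'rV[R]_n) : R := mpoly.meval (fun i => x 0 i) p.

Lemma pev0 n x : pev (n := n) 0 x = 0. Proof. exact: raddf0. Qed.
Lemma pevD n (p q : poly n) x : pev (p + q) x = pev p x + pev q x.
Proof. exact: raddfD. Qed.
Lemma pevM n (p q : poly n) x : pev (p * q) x = pev p x * pev q x.
Proof. exact: rmorphM. Qed.
Lemma pevZ n a (p : poly n) x : pev (a *: p) x = a * pev p x.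
Proof. exact: mpoly.mevalZ. Qed.
Lemma pev_sum n I (r : seq I) (P : pred I) (p : I -> poly n) x :
  pev (\sum_(i <- r | P i) p i) x = \sum_(i <- r | P i) pev (p i) x.
Proof. exact: raddf_sum. Qed.
Lemma pevX n (i : 'I_n) x : pev (pX i) x = x 0 i.
Proof. exact: mpoly.mevalXU. Qed.
Lemma pevC n c x : pev (mpoly.mpolyC n c) x = c.
Proof. exact: mpoly.mevalC. Qed.

(** Induction on ring generators: derivatives, continuity, measurability and boundedness are then
    checked on constants, variables, sums and products. *)
Lemma mpoly_ring_ind n (Q : poly n -> Prop) :
  (forall c, Q (mpoly.mpolyC n c)) -> (forall i, Q (pX i)) ->
  (forall p q, Q p -> Q q -> Q (p + q)) -> (forall p q, Q p -> Q q -> Q (p * q)) ->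
  forall p, Q p.
Proof.
move=> QC QX QD QM p; rewrite (mpoly.mpolyE p).
have Q0 : Q 0 by have := QC 0; rewrite mpoly.mpolyC0.
have Q1 : Q 1 by exact: QC 1.
apply: (big_ind Q) => // m _; rewrite -mpoly.mul_mpolyC; apply: (QM) => //.
rewrite mpoly.mpolyXE_id; apply: (big_ind Q) => // i _.
elim: (mpoly.fun_of_multinom m i) => [|k ih]; first by rewrite expr0.
by rewrite exprS; exact: (QM).
Qed.

(** The chain rule, general enough to give both the partial derivatives on R^n and the derivative
    along a line. *)
Lemma is_derive_meval n (V : normedModType R) (g : V -> 'I_n -> R) (dg : 'I_n -> R)
    (t w : V) (p : poly n) :
  (forall i, is_derive t w (fun u => g u i) (dg i)) ->
  is_derive t w (fun u => mpoly.meval (g u) p)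
    (\sum_i dg i * mpoly.meval (g t) (mpoly.mderiv i p)).
Proof.
move=> hg; elim/mpoly_ring_ind: p => [c|j|p q hp hq|p q hp hq].
- rewrite big1; last by move=> i _; rewrite mpoly.mderivC raddf0 mulr0.
  rewrite (_ : (fun _ => _) = cst c); first exact: is_derive_cst.
  by apply/funext => u; rewrite mpoly.mevalC.
- rewrite (bigD1 j)//= big1 => [|i ij].
    rewrite addr0 mpoly.mderivX mpoly.mnm1E eqxx scale1r mpoly.mevalX.
    rewrite big1 => [|i _]; last by rewrite mpoly.mnmBE subnn expr0.
    rewrite mulr1 (_ : (fun u => _) = fun u => g u j)//.
    by apply/funext => u; rewrite mpoly.mevalXU.
  by rewrite mpoly.mderivX mpoly.mnm1E eq_sym (negbTE ij) scale0r raddf0 mulr0.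
- rewrite (_ : (fun _ => _) = (fun u => mpoly.meval (g u) p) +
      (fun u => mpoly.meval (g u) q)); last first.
    by apply/funext => u; rewrite mpoly.mevalD.
  apply: is_derive_eq; rewrite -big_split/=; apply: eq_bigr => i _.
  by rewrite mpoly.mderivD mpoly.mevalD mulrDr.
- rewrite (_ : (fun _ => _) = (fun u => mpoly.meval (g u) p) *
      (fun u => mpoly.meval (g u) q)); last first.
    by apply/funext => u; rewrite mpoly.mevalM.
  apply: is_derive_eq.
  rewrite !scaler_sumr -big_split/=; apply: eq_bigr => i _.
  by rewrite mpoly.mderivM mpoly.mevalD !mpoly.mevalM /GRing.scale/=; ring.
Qed.

Lemma is_derive_coord n (i : 'I_n) (x v : 'rV[R]_n) :
  is_derive x v (fun y : 'rV[R]_n => y 0 i) (v 0 i).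
Proof.
have h : (fun h : R => h^-1 *: ((fun y : 'rV[R]_n => y 0 i) (h *: v + x) - x 0 i)) @ 0^' --> v 0 i.
  have : (fun=> v 0 i) @ (0 : R)^' --> v 0 i by exact: cvg_cst.
  apply: cvg_trans.
  apply: near_eq_cvg; near=> h.
  have h0 : h != 0 by near: h; exact: nbhs_dnbhs_neq.
  by rewrite !mxE addrK /GRing.scale/= mulKf.
apply: DeriveDef; first by apply/cvg_ex; exists (v 0 i).
exact/cvg_lim.
Unshelve. all: by end_near. Qed.

Lemma partial_pev n (i : 'I_n) (p : poly n) x :
  partial i (pev p) x = pev (mpoly.mderiv i p) x.
Proof.
have h := @is_derive_meval n _ (fun y : 'rV[R]_n => fun j => y 0 j) _ x (delta_mx 0 i) p
  (fun j => is_derive_coord j x (delta_mx 0 i)).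
rewrite /partial (@derive_val _ _ _ _ _ _ _ h) (bigD1 i)//= big1 => [|j ji].
  by rewrite mxE !eqxx mul1r addr0.
by rewrite mxE eqxx/= (negbTE ji) mul0r.
Qed.

Lemma is_derive_pev_line n (p : poly n) (b v : 'rV[R]_n) (s : R) :
  is_derive s 1 (fun s => pev p (b + s *: v))
    (\sum_i v 0 i * pev (mpoly.mderiv i p) (b + s *: v)).
Proof.
apply: (@is_derive_meval n _ (fun s : R => fun i => (b + s *: v) 0 i)) => i.
rewrite (_ : (fun u => _) = cst (b 0 i) + (fun u => u * v 0 i)); last first.
  by apply/funext => u; rewrite !mxE.
apply: is_derive_eq; rewrite add0r.
rewrite /GRing.scale/=; ring.
Qed.

Lemma continuous_pev n (p : poly n) : continuous (pev p).
Proof.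
elim/mpoly_ring_ind: p => [c|j|p q hp hq|p q hp hq] x.
- rewrite (_ : pev _ = cst c); first exact: cst_continuous.
  by apply/funext => u; rewrite pevC.
- rewrite (_ : pev _ = fun u : 'rV[R]_n => u 0 j); first exact: coord_continuous.
  by apply/funext => u; rewrite pevX.
- rewrite (_ : pev _ = fun u : 'rV[R]_n => pev p u + pev q u).
    by apply: continuousD; [exact: hp|exact: hq].
  by apply/funext => u; rewrite pevD.
- rewrite (_ : pev _ = fun u : 'rV[R]_n => pev p u * pev q u).
    by apply: continuousM; [exact: hp|exact: hq].
  by apply/funext => u; rewrite pevM.
Qed.

Lemma measurable_pev n (p : poly n) : measurable_fun setT (pev p : 'rV[R]_n -> measurableTypeR R).
Proof.
elim/mpoly_ring_ind: p => [c|j|p q hp hq|p q hp hq].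
- rewrite (_ : pev _ = cst c); first exact: measurable_cst.
  by apply/funext => u; rewrite pevC.
- rewrite (_ : pev _ = fun u : 'rV[R]_n => u 0 j); first exact: measurable_coord.
  by apply/funext => u; rewrite pevX.
- rewrite (_ : pev _ = fun u : 'rV[R]_n => pev p u + pev q u).
    by apply: measurable_funD; [exact: hp|exact: hq].
  by apply/funext => u; rewrite pevD.
- rewrite (_ : pev _ = fun u : 'rV[R]_n => pev p u * pev q u).
    by apply: measurable_funM; [exact: hp|exact: hq].
  by apply/funext => u; rewrite pevM.
Qed.

Lemma bounded_pev n (p : poly n) (K : R) :
  exists C : R, forall x : 'rV[R]_n, (forall i, `|x 0 i| <= K) -> `|pev p x| <= C.
Proof.
elim/mpoly_ring_ind: p => [c|j|p q [C hp] [D hq]|p q [C hp] [D hq]].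
- by exists `|c| => x _; rewrite pevC.
- by exists K => x ?; rewrite pevX.
- exists (C + D) => x xK; rewrite pevD (le_trans (ler_normD _ _))//.
  by rewrite lerD ?hp ?hq.
- exists (C * D) => x xK; rewrite pevM normrM.
  by rewrite ler_pM ?hp ?hq.
Qed.

(** Characteristic 0: if m_i > 0, the coefficient of m - e_i in the i-th derivative is m_i times the
    coefficient of m. *)
Lemma mpoly_const n (p : poly n) : (forall i, mpoly.mderiv i p = 0) ->
  p = mpoly.mpolyC n (mpoly.mcoeff mpoly.mnm0 p).
Proof.
move=> hp; apply/mpoly.mpolyP => m; rewrite mpoly.mcoeffC.
have [->|m0] := eqVneq m mpoly.mnm0; first by rewrite mulr1.
rewrite mulr0.
have [i mi] : exists i, mpoly.fun_of_multinom m i != 0%N.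
  have [i mi|mi] := pickP (fun i => mpoly.fun_of_multinom m i != 0%N); first by exists i.
  case/eqP: m0; apply/mpoly.mnmP => i; rewrite mpoly.mnm0E.
  by have /negbFE/eqP := mi i.
have := hp i => /(congr1 (mpoly.mcoeff (mpoly.mnm_sub m (mpoly.mnm1 i)))).
rewrite mpoly.mcoeff_deriv mpoly.mcoeff0 mpoly.submK.
  by move/eqP; rewrite mulrn_eq0 orFb => /eqP.
apply/mpoly.mnm_lepP => j; rewrite mpoly.mnm1E; case: eqP => // <-.
by rewrite lt0n.
Qed.

(** Induction on a degree bound: the derivatives vanish on the open set too, hence are 0, so that p
    is a constant, which vanishes at a point of the set. *)
Lemma pev_eq0 n (p : poly n) (U : set 'rV[R]_n) :
  open U -> U !=set0 -> (forall x, U x -> pev p x = 0) -> p = 0.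
Proof.
move=> oU [x0 Ux0].
have [N] : exists N, forall m, (N <= mpoly.mdeg m)%N -> mpoly.mcoeff m p = 0.
  exists (\max_(m <- mpoly.msupp p) (mpoly.mdeg m).+1)%N => m.
  move=> h; apply/eqP; apply: contraTT h.
  rewrite -ltnNge -mpoly.mcoeff_msupp => mp.
  by rewrite (big_rem m mp)/= leq_max ltnSn.
elim: N p => [|N ih] p pN pU.
  by apply/mpoly.mpolyP => m; rewrite pN// mpoly.mcoeff0.
have dp i : mpoly.mderiv i p = 0.
  apply: ih => [m Nm|x Ux].
    by rewrite mpoly.mcoeff_deriv pN ?mul0rn// mpoly.mdegD mpoly.mdeg1 addn1.
  rewrite -partial_pev /partial.
  rewrite (near_eq_derive (g := cst 0)) ?derive_cst//.
  by near=> y; rewrite pU//; near: y; exact: open_nbhs_nbhs.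
rewrite (mpoly_const dp); move: (pU _ Ux0); rewrite {1}(mpoly_const dp) pevC => ->.
by rewrite mpoly.mpolyC0.
Unshelve. all: by end_near. Qed.

End polynomial_functions.

(** * Divergence theorem on polyhedral sets *)

Section crossings.
Context {R : realType}.
Local Notation mu := (@lebesgue_measure R).

Lemma connected_dichotomy (a b : R) (Z : set R) : a <= b ->
  (forall t, Z t -> \forall u \near t, Z u) ->
  (forall t, ~ Z t -> \forall u \near t, ~ Z u) ->
  Z b -> forall t, a <= t <= b -> Z t.
Proof.
move=> ab oZ oNZ Zb t tab.
have : `[a, b]%classic `&` Z = `[a, b]%classic.
  apply: (@segment_connected R a b).
  - by exists b; split => //=; rewrite in_itv/= ab lexx.
  - by exists Z => //; rewrite openE => u /oZ.
  - exists Z => //; rewrite -[Z]setCK; apply: open_closedC.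
    by rewrite openE => u /oNZ.
by move=> E; have : `[a, b]%classic t by []; rewrite -E => -[].
Qed.

(* The points [s i] are the crossings of the boundary of [S]; [S] is on their
   left if [0 < c i], on their right if [c i < 0]. *)
Variables (I : finType) (P : pred I) (S : set R) (s c : I -> R) (K : R).
Hypotheses (oS : open S) (SK : forall t, S t -> `|t| < K)
  (sK : forall i, P i -> `|s i| < K)
  (s_inj : forall i j, P i -> P j -> s i = s j -> i = j)
  (c_neq0 : forall i, P i -> c i != 0)
  (crossing : forall i, P i ->
     \forall t \near s i, t != s i -> (S t <-> (t - s i) * c i < 0))
  (no_crossing : forall t, (forall i, P i -> t != s i) ->
     (\forall u \near t, S u) \/ (\forall u \near t, ~ S u)).

(** The defect of the signed half-line formula. At [s i] the indicator of S and the i-th half-line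
    have the same jump, so the defect is constant on a punctured neighbourhood of every point; it
    vanishes to the right of K, hence off the crossings. *)
Let D t : R := \1_S t - \sum_(i | P i) Num.sg (c i) * \1_[set u | u < s i] t.

Let near_sum t (Q : pred I) : (forall i, Q i -> s i != t) -> \forall u \near t,
    \sum_(i | Q i) Num.sg (c i) * \1_[set u | u < s i] u =
    \sum_(i | Q i) Num.sg (c i) * \1_[set u | u < s i] t :> R.
Proof.
have near_other i : s i != t -> \forall u \near t,
    \1_[set u | u < s i] u = \1_[set u | u < s i] t :> R.
  move=> sit; rewrite -subr_eq0 in sit.
  case: (ltP t (s i)) => [tsi|tsi].
    near=> u; rewrite !indicE !mem_set//=; near: u; exact: lt_nbhsl.
  have {}tsi : s i < t by rewrite lt_neqAle tsi andbT -subr_eq0.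
  near=> u; rewrite !indicE !memNset//=; first by apply/negP; rewrite -leNgt ltW.
  by apply/negP; rewrite -leNgt ltW//; near: u; exact: lt_nbhsr.
move=> Qs; near=> u; apply: eq_bigr => i Qi; congr (_ * _).
move: i Qi; near: u; apply: filter_forall => i.
case Qi : (Q i); last by near=> u.
by near=> u => _; near: u; exact/near_other/Qs.
Unshelve. all: by end_near. Qed.

Let D_near t : (forall i, P i -> t != s i) -> \forall u \near t, D u = D t.
Proof.
move=> h.
have h' : forall i, P i -> s i != t by move=> i /h; rewrite eq_sym.
case: (no_crossing h) => hS; near=> u; rewrite /D; congr (_ - _).
- rewrite !indicE !mem_set//; first exact: (nbhs_singleton hS).
  by near: u.
- by near: u; exact: near_sum.
- rewrite !indicE !memNset//; first exact: (nbhs_singleton hS).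
  by near: u.
- by near: u; exact: near_sum.
Unshelve. all: by end_near. Qed.

Let D_cst t : exists k : R, \forall u \near t^', D u = k.
Proof.
have [[i [Pi sit]]|nos] := pselect (exists i, P i /\ s i = t); last first.
  exists (D t); apply: nbhs_dnbhs; apply: D_near => i Pi.
  by apply/eqP => ts; apply: nos; exists i.
pose Q := [pred j | P j && (j != i)].
have hQ j : Q j -> s j != t.
  by move=> /andP[Pj ji]; apply: contra ji => /eqP sj; apply/eqP/s_inj; rewrite ?sj.
pose r := \sum_(j | Q j) Num.sg (c j) * \1_[set u | u < s j] t.
(* If [0 < c i], the indicator of S and that of the half-line cancel on both sides of [s i]; if
   [c i < 0], they are indicators of complementary half-lines and add up to 1. The rest r does not
   move near [s i]. *)
exists ((c i < 0)%R%:R - r).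
near=> u.
have ut : u != t by near: u; exact: nbhs_dnbhs_neq.
rewrite /D (bigD1 i)//=.
rewrite (_ : \sum_(_ | _) _ = r); last by near: u; apply: nbhs_dnbhs; exact: near_sum.
rewrite opprD addrA; congr (_ - _).
have : S u <-> (u - s i) * c i < 0.
  by move: ut; rewrite -sit; near: u; rewrite -sit; apply: nbhs_dnbhs; exact: crossing.
have [ci|ci|/eqP] := ltrgt0P (c i); last by rewrite (negbTE (c_neq0 Pi)).
- rewrite pmulr_llt0// subr_lt0 (gtr0_sg ci) mul1r => hS.
  rewrite !indicE; have [usi|usi] := boolP (u < s i).
    by rewrite !mem_set//= ?subrr//; exact/hS.
  by rewrite !memNset ?subrr//= ?hS; exact/negP.
- rewrite nmulr_llt0// subr_gt0 (ltr0_sg ci) mulN1r opprK => hS.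
  rewrite !indicE; have [usi|usi] := boolP (s i < u).
    rewrite mem_set ?memNset ?addr0//; last exact/hS.
    by apply/negP; rewrite -leNgt ltW.
  rewrite memNset ?hS; last exact/negP.
  rewrite mem_set ?add0r//=.
  by rewrite lt_neqAle leNgt usi andbT sit.
Unshelve. all: by end_near. Qed.

Let D_big t : K <= t -> D t = 0.
Proof.
move=> Kt; rewrite /D indicE memNset ?big1 ?subrr// => [i Pi|/SK].
  rewrite indicE memNset ?mulr0//=; apply/negP; rewrite -leNgt.
  by have := sK Pi; rewrite ltr_norml => /andP[_]; lra.
by rewrite ltr_norml => /andP[_]; lra.
Qed.

Let D_eq0 t : (forall i, P i -> t != s i) -> D t = 0.
Proof.
move=> nt.
(* Neighbourhoods are punctured because the value of D at a crossing itself is arbitrary. Being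
   locally constant in this sense makes Z and its complement open; Z is then propagated leftwards
   from a point beyond K. *)
pose Z t := \forall u \near t^', D u = 0.
have near_dnbhs (u w : R) (A : set R) : (\forall x \near u^', A x) ->
    exists2 e : R, 0 < e & forall x, `|u - x| < e -> x != u -> A x.
  move=> /nbhs_ballP[e /= e0 ue]; exists e => // x ux xu; apply: ue => //.
have oZ0 (k : R) u : (\forall w \near u^', D w = k) ->
    \forall w \near u, \forall x \near w^', D x = k.
  rewrite {1}/dnbhs/= {1}/within/= => /nbhs_ballP[e /= e0 ue]; near=> w.
  have [->|wu] := eqVneq w u; first by apply/nbhs_ballP; exists e.
  apply: nbhs_dnbhs; near=> x; apply: ue.
    near: x; apply: open_nbhs_nbhs; split; first exact: ball_open.
    by near: w; exact: nbhsx_ballx.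
  near: x; apply: open_nbhs_nbhs; split => //; exact: open_neq.
have Zt : Z t.
  apply: (@connected_dichotomy t (Num.max t K + 1)) => //.
  - by rewrite (@le_trans _ _ (Num.max t K))// ?le_max ?lexx// lerDl.
  - by move=> u; exact: oZ0.
  - move=> u NZu; have [k uk] := D_cst u.
    have := oZ0 _ _ uk; apply: filterS => w wk Zw.
    have [x [xk x0]] : exists x, D x = k /\ D x = 0.
      by apply: (@filter_ex _ w^'); near=> x; split; near: x.
    by apply: NZu; rewrite /Z -x0 xk.
  - apply: nbhs_dnbhs; near=> u; apply: D_big.
    have : Num.max t K < u by near: u; apply: lt_nbhsr; rewrite ltrDl.
    by rewrite gt_max => /andP[_ /ltW].
  - by rewrite lexx (@le_trans _ _ (Num.max t K))// ?le_max ?lexx// lerDl.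
have [x [<- x0]] : exists x, D x = D t /\ D x = 0; last by [].
apply: (@filter_ex _ t^'); near=> x; split; near: x => //.
exact/nbhs_dnbhs/D_near.
Unshelve. all: by end_near. Qed.

Lemma sum_sg_crossings t : (forall i, P i -> t != s i) ->
  \1_S t = \sum_(i | P i) Num.sg (c i) * \1_[set u | u < s i] t :> R.
Proof. by move=> /D_eq0 /eqP; rewrite subr_eq0 => /eqP. Qed.

(** The formula is read at -K, which lies to the left of S and of all the crossings. *)
Lemma sum_sg_crossings0 : \sum_(i | P i) Num.sg (c i) = 0.
Proof.
have KNs i : P i -> - K < s i by move=> /sK; rewrite ltr_norml => /andP[].
have := @sum_sg_crossings (- K); rewrite indicE memNset; last first.
  by move=> /SK; rewrite ltr_norml ltxx.
move=> E; apply: etrans (esym (E _)) => [|i Pi]; last by rewrite lt_eqF// KNs.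
by apply: eq_bigr => i Pi; rewrite indicE mem_set ?mulr1//=; exact: KNs.
Qed.

(** The half-lines are cut at -K so that the fundamental theorem of calculus applies on compact
    intervals; the terms [f (- K)] then cancel because the signs add up to 0. *)
Lemma integral_crossings (f g : R -> R) :
  (forall t : R, is_derive t 1 f (g t)) -> continuous g ->
  (\int[mu]_t (\1_S t * g t)%:E = (\sum_(i | P i) Num.sg (c i) * f (s i))%:E)%E.
Proof.
move=> fg cg.
have KNs i : P i -> - K < s i by move=> /sK; rewrite ltr_norml => /andP[].
pose J i : set R := [set` `[- K, s i]].
have cf : continuous f.
  by move=> x; apply/differentiable_continuous/derivable1_diffP; exact: (@ex_derive _ _ _ _ _ _ _ (fg x)).
have ig i : mu.-integrable (J i) (EFin \o g).
  apply: continuous_compact_integrable; first exact: segment_compact.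
  exact: continuous_subspaceT.
have iJ i : mu.-integrable setT (fun t => (Num.sg (c i) * (g \_ (J i)) t)%:E).
  rewrite (_ : (fun t => _) = fun t => (Num.sg (c i))%:E * ((EFin \o g) \_ (J i)) t)%E.
    apply: integrableZl => //.
    by rewrite -integrable_mkcond//; exact: measurable_itv.
  by apply/funext => t; rewrite EFinM; congr (_ * _)%E; rewrite /patch; case: ifP.
transitivity (\int[mu]_t (\sum_(i | P i) (Num.sg (c i) * (g \_ (J i)) t)%:E))%E.
  (* The signed formula can fail only at the crossings, a finite and hence null set. *)
  apply: ae_eq_integral => //.
  - apply/measurable_EFinP/measurable_funM.
      by apply: measurable_indic; exact: open_measurable.
    exact: continuous_measurable_fun.
  - rewrite (_ : (fun t => _) = fun t =>
        (\sum_(i <- [seq i <- index_enum I | P i]) (Num.sg (c i) * (g \_ (J i)) t)%:E)%E).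
      by apply: emeasurable_sum => i; exact: (measurable_int _ (iJ i)).
    by apply/funext => t; rewrite big_filter.
  exists [set s i | i in [set: I]]; split.
  - apply: countable_measurable; first by move=> t; exact: measurable_set1.
    by apply: finite_set_countable; exact: finite_image.
  - apply: countable_lebesgue_measure0; apply: finite_set_countable; exact: finite_image.
  move=> t /= tN; apply: contrapT => nt; apply: tN => _.
  have hs i : P i -> t != s i by move=> Pi; apply/eqP => ti; apply: nt; exists i.
  rewrite sumEFin; congr EFin.
  have [tK|Kt] := ltP t (- K).
    rewrite indicE memNset ?mul0r ?big1// => [i Pi|/SK].
      rewrite patchN ?mulr0//; apply/negP; rewrite inE /J/= in_itv/= => /andP[].
      by rewrite leNgt tK.
    by rewrite ltr_norml => /andP[]; lra.
  rewrite sum_sg_crossings// mulr_suml; apply: eq_bigr => i Pi; rewrite -mulrA; congr (_ * _).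
  rewrite patchE indicE; have [tsi|sit] := ltP t (s i).
    rewrite mem_set//= mul1r [t \in J i]mem_set//.
    by rewrite /J/= in_itv/= Kt ltW.
  rewrite memNset/= ?mul0r; last by apply/negP; rewrite -leNgt.
  rewrite [t \in J i]memNset// /J/= in_itv/= Kt/=; apply/negP; rewrite -ltNge.
  by rewrite lt_neqAle sit andbT eq_sym hs.
rewrite integral_sum//.
transitivity (\sum_(i | P i) (Num.sg (c i) * (f (s i) - f (- K)))%:E)%E.
  apply: eq_bigr => i Pi.
  transitivity (\int[mu]_t ((Num.sg (c i))%:E * ((EFin \o g) \_ (J i)) t))%E.
    by apply: eq_integral => t _; rewrite EFinM !patchE; case: ifP.
  rewrite integralZl//; last by rewrite -integrable_mkcond//; exact: measurable_itv.
  rewrite -integral_mkcond EFinM; congr (_ * _)%E; rewrite EFinB.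
  apply: continuous_FTC2; [exact: KNs|exact: continuous_subspaceT| |].
  - split => [x _||].
    + exact: (@ex_derive _ _ _ _ _ _ _ (fg x)).
    + by apply: cvg_at_right_filter; exact: cf.
    + by apply: cvg_at_left_filter; exact: cf.
  - by move=> x _; rewrite derive1E; exact: (@derive_val _ _ _ _ _ _ _ (fg x)).
rewrite sumEFin; congr EFin.
under eq_bigr do rewrite mulrBr.
by rewrite big_split/= sumrN -mulr_suml sum_sg_crossings0 mul0r subr0.
Qed.

End crossings.

(** * Polyhedral sets are bounded and have null boundary *)

Section polyhedral_sets.
Context {R : realType}.
Local Notation lam := (@lebesgue_rV R).

Lemma negligible_finU d (T : measurableType d) (mu : {measure set T -> \bar R})
    (I : finType) (F : I -> set T) :
  (forall i, mu.-negligible (F i)) -> mu.-negligible (\bigcup_i F i).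
Proof.
move=> hF; rewrite (_ : \bigcup_i F i = \big[setU/set0]_(i <- index_enum I) F i).
  elim/big_ind: _ => // [|A B]; first exact: negligible_set0.
  exact: negligibleU.
rewrite -bigcup_seq; apply: eq_bigcupl; split=> i //= _.
by rewrite mem_index_enum.
Qed.

Lemma mxdotC m n (A B : 'M[R]_(m, n)) : mxdot A B = mxdot B A.
Proof. by rewrite /mxdot -mxtrace_tr trmx_mul trmxK. Qed.

Lemma mxdotDl m n (A B C : 'M[R]_(m, n)) : mxdot (A + B) C = mxdot A C + mxdot B C.
Proof. by rewrite /mxdot mulmxDl mxtraceD. Qed.

Lemma mxdotZl m n (a : R) (A C : 'M[R]_(m, n)) : mxdot (a *: A) C = a * mxdot A C.
Proof. by rewrite /mxdot -scalemxAl mxtraceZ. Qed.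

Lemma mxdotDr m n (A B C : 'M[R]_(m, n)) : mxdot C (A + B) = mxdot C A + mxdot C B.
Proof. by rewrite ![mxdot C _]mxdotC mxdotDl. Qed.

Lemma mxdotZr m n (a : R) (A C : 'M[R]_(m, n)) : mxdot C (a *: A) = a * mxdot C A.
Proof. by rewrite ![mxdot C _]mxdotC mxdotZl. Qed.

Lemma mxdotNl m n (A C : 'M[R]_(m, n)) : mxdot (- A) C = - mxdot A C.
Proof. by rewrite -scaleN1r mxdotZl mulN1r. Qed.

Lemma mxdotBl m n (A B C : 'M[R]_(m, n)) : mxdot (A - B) C = mxdot A C - mxdot B C.
Proof. by rewrite mxdotDl mxdotNl. Qed.

Lemma mxdot0l m n (C : 'M[R]_(m, n)) : mxdot 0 C = 0.
Proof. by rewrite /mxdot mul0mx mxtrace0. Qed.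

Lemma mxdot0r m n (C : 'M[R]_(m, n)) : mxdot C 0 = 0.
Proof. by rewrite mxdotC mxdot0l. Qed.

Lemma mxdotE m n (A B : 'M[R]_(m, n)) : mxdot A B = \sum_i \sum_j A i j * B i j.
Proof.
rewrite /mxdot /mxtrace; apply: eq_bigr => i _; rewrite mxE; apply: eq_bigr => j _.
by rewrite mxE.
Qed.

Lemma continuous_mxdot n (a : 'rV[R]_n) : continuous (mxdot a).
Proof.
rewrite (_ : mxdot a = pev (\sum_i a 0 i *: mpoly.mpolyX R (mpoly.mnm1 i))).
  exact: continuous_pev.
apply/funext => x; rewrite mxdot_rVE pev_sum; apply: eq_bigr => i _.
by rewrite pevZ pevX.
Qed.

Lemma continuous_rV (T : topologicalType) n (f : T -> 'rV[R]_n) :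
  (forall i, continuous (fun t => f t 0 i)) -> continuous f.
Proof.
move=> cf t; apply/cvgrPdist_lt => e e0.
have : \forall u \near t, forall i, `|f t 0 i - f u 0 i| < e.
  by apply: filter_forall => i; have /cvgrPdist_lt := cf i t; apply.
apply: filterS => u h.
by have /ball_rVP := h; move=> /(_ e0); rewrite -ball_normE.
Qed.

Lemma continuous_affine m n (b : 'rV[R]_n) (A : 'M[R]_(m, n)) :
  continuous (fun x : 'rV[R]_m => b + x *m A).
Proof.
apply: continuous_rV => i x.
rewrite (_ : (fun _ => _) = fun x => b 0 i + mxdot (\row_j A j i) x).
  by apply: continuousD; [exact: cst_continuous|exact: continuous_mxdot].
apply/funext => y; rewrite !mxE mxdot_rVE; congr (_ + _); apply: eq_bigr => j _.
by rewrite mxE mulrC.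
Qed.

Lemma continuous_line n (b v : 'rV[R]_n) : continuous (fun t : R => b + t *: v).
Proof.
apply: continuous_rV => i t.
rewrite (_ : (fun _ => _) = fun t : R => b 0 i + t * v 0 i).
  apply: cvgD; first exact: cvg_cst.
  by apply: cvgM; [exact: cvg_id|exact: cvg_cst].
by apply/funext => u; rewrite !mxE.
Qed.

Lemma simplex_bounded n (V : 'M[R]_(n.+1, n)) : coord_bounded (simplex V).
Proof.
exists (\sum_i \sum_j `|V i j|) => _ [t [t0 t1] <-] j.
rewrite mxE (le_trans (ler_norm_sum _ _ _))//; apply: ler_sum => i _.
rewrite normrM ger0_norm ?t0// (bigD1 j)//= -[leLHS]addr0; apply: lerD.
  rewrite ler_piMl//; rewrite -t1 (bigD1 i)//= lerDl; exact: sumr_ge0.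
exact: sumr_ge0.
Qed.

Lemma polyhedral_bounded n (D : set 'rV[R]_n) : polyhedral D -> coord_bounded (closure D).
Proof.
move=> [_ _ _ _ [N [V [_ ->]]]].
have /choice[K hK] i : exists K, forall x, simplex (V i) x -> forall j, `|x 0 j| <= K.
  exact: simplex_bounded.
exists (\sum_i `|K i|) => x [i _ Vx] j; apply: le_trans (hK i x Vx j) _.
rewrite (bigD1 i)//= (le_trans (ler_norm _))// lerDl; exact: sumr_ge0.
Qed.

Lemma polyhedral_coord_bounded n (D : set 'rV[R]_n) : polyhedral D -> coord_bounded D.
Proof.
by move=> /polyhedral_bounded[K DK]; exists K => x Dx; apply: DK; exact: subset_closure.
Qed.

(** The affine forms are the barycentric coordinates, read off the inverse of the matrix (V 1).
    Where all of them are positive they stay so nearby, and the point is interior. *)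
Lemma simplex_boundary n (V : 'M[R]_(n.+1, n)) : affinely_independent V ->
  exists (a : 'I_n.+1 -> 'rV[R]_n) (c : 'I_n.+1 -> R),
    (forall i, (a i != 0) || (c i != 0)) /\
    forall x, simplex V x -> ~ interior (simplex V) x -> exists i, mxdot (a i) x + c i = 0.
Proof.
rewrite /affinely_independent; set W := row_mx _ _ => fW.
have /row_freeP[B WB] := fW.
(* W is square only up to [n + 1 = n.+1], so the left inverse is obtained separately and then shown
   to be B. *)
have /row_fullP[C CW] : row_full W.
  by move: fW; rewrite /row_free /row_full => /eqP ->; rewrite addn1.
have BW : B *m W = 1%:M.
  by rewrite -[B]mul1mx -CW -(mulmxA C) WB mulmx1.
pose a i : 'rV[R]_n := \row_j B (lshift 1 j) i.
pose c i : R := B (rshift n ord0) i.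
have baryE x i : (row_mx x (1%:M : 'M[R]_1) *m B) 0 i = mxdot (a i) x + c i.
  rewrite -[B in LHS]vsubmxK mul_row_col mul1mx mxE; congr (_ + _).
    rewrite mxdot_rVE mxE; apply: eq_bigr => j _; rewrite !mxE mulrC; congr (_ * _).
  by rewrite /c mxE.
have WE (t : 'rV[R]_n.+1) : t *m W = row_mx (t *m V) (\sum_i t 0 i)%:M.
  rewrite mul_mx_row; congr row_mx; apply/rowP => i; rewrite !mxE !ord1 eqxx mulr1n.
  by apply: eq_bigr => j _; rewrite mxE mulr1.
exists a, c; split=> [i|x [t [t0 t1] tx] nx].
  rewrite -negb_and; apply/negP => /andP[/eqP ai /eqP ci].
  have := congr1 (fun A : 'M[R]_n.+1 => A i i) WB.
  rewrite !mxE eqxx/= => /esym/eqP; apply/negP; rewrite big1 ?oner_eq0// => j _.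
  case: (split_ordP j) => k ->; last by rewrite [k]ord1 -/(c i) ci mulr0.
  by move/rowP: ai => /(_ k); rewrite !mxE => ->; rewrite mulr0.
apply: contrapT => /forallNP h; apply: nx.
have tE i : t 0 i = mxdot (a i) x + c i.
  by rewrite -baryE -tx -t1 -WE -mulmxA WB mulmx1.
have tp i : 0 < mxdot (a i) x + c i.
  by rewrite lt_neqAle -{2}tE t0 andbT eq_sym; apply/eqP/h.
have : \forall y \near x, forall i, 0 < mxdot (a i) y + c i.
  apply: (filter_forall (nbhs_filter x)) => i.
  have cx : {for x, continuous (fun y => mxdot (a i) y + c i)}.
    by apply: continuousD; [exact: continuous_mxdot|exact: cst_continuous].
  exact: (cvgr_gt _ cx _ (tp i)).
apply: filterS => y yp.
exists (row_mx y 1%:M *m B).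
  split=> [i|]; first by rewrite baryE ltW.
  have := WE (row_mx y 1%:M *m B); rewrite -mulmxA BW mulmx1.
  by move=> /eq_row_mx[_] /matrixP /(_ 0 0); rewrite [LHS]mxE [RHS]mxE => /esym.
have := WE (row_mx y 1%:M *m B); rewrite -mulmxA BW mulmx1.
by move=> /eq_row_mx[].
Qed.

Lemma closed_bd n (D : set 'rV[R]_n) : closed (bd D).
Proof.
rewrite /bd setDE; apply: closedI; first exact: closed_closure.
by apply: open_closedC; exact: open_interior.
Qed.

Lemma bd_open n (D : set 'rV[R]_n) : open D -> bd D = closure D `\` D.
Proof. by move=> oD; rewrite /bd; move/interior_id: oD => ->. Qed.

(** A boundary point interior to one of the simplices would be interior to the closure of D, which
    is D again. So the boundary lies in the finitely many hyperplanes that bound the simplices. *)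
Lemma polyhedral_bd0 n (D : set 'rV[R]_n) : polyhedral D -> lam n (bd D) = 0%E.
Proof.
move=> [D0 oD cD iD [N [V [aV VD]]]].
have /choice[a /choice[c ac]] := fun i => simplex_boundary (aV i).
apply/negligibleP; first by apply: closed_measurable_rV; exact: closed_bd.
apply: (@negligibleS _ _ _ _
    (\bigcup_(p : 'I_N * 'I_n.+1) [set x | mxdot (a p.1 p.2) x + c p.1 p.2 = 0])).
  move=> x [+ nx]; rewrite VD => -[i _ Vx].
  have [j hj] : exists j, mxdot (a i j) x + c i j = 0.
    apply: (ac i).2 => // ix; apply: nx; move/interior_id : oD => ->; rewrite -iD.
    by apply: interiorS ix => y Vy; rewrite VD; exists i.
  by exists (i, j).
apply: negligible_finU => -[i j] /=.
apply/negligibleP; first exact: (measurable_mxdot _ _ (measurable_set1 0)).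
by apply: lebesgue_hyperplane; exact: (ac i).1.
Qed.

End polyhedral_sets.

(** * An open set near its flat faces *)

Section faces_of_open_sets.
Context {R : realType}.

Lemma segment_in_open n (T : set 'rV[R]_n) (y w : 'rV[R]_n) : open T -> T y ->
  (forall t : R, 0 <= t <= 1 -> ~ bd T (w + t *: (y - w))) -> T w.
Proof.
move=> oT Ty nbd; pose g (t : R) := w + t *: (y - w).
have cg : continuous g by exact: continuous_line.
have : `[0, 1]%classic `&` g @^-1` T = `[0 : R, 1]%classic.
  apply: (@segment_connected R 0 1).
  - by exists 1; split; rewrite /= ?in_itv/= ?ler01 ?lexx// /g scale1r addrC subrK.
  - by exists (g @^-1` T) => //; apply: open_comp => // t _; exact: cg.
  - exists (g @^-1` closure T); first by move/continuous_closedP : cg; apply; exact: closed_closure.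
    apply/seteqP; split=> t [t01 /= Tt]; split => //.
      exact: subset_closure.
    apply: contrapT => nT; apply: (nbd t); first by move: t01; rewrite /= in_itv.
    by rewrite (bd_open oT).
move=> E; have : `[0 : R, 1]%classic 0 by rewrite /= in_itv/= lexx ler01.
by rewrite -E => -[_]; rewrite /= /g scale0r addr0.
Qed.

Lemma ball_segment n (x y w : 'rV[R]_n) (e t : R) : ball x e y -> ball x e w ->
  0 <= t <= 1 -> ball x e (w + t *: (y - w)).
Proof.
rewrite -ball_normE/= => xy xw /andP[t0 t1].
rewrite (_ : x - _ = (1 - t) *: (x - w) + t *: (x - y)); last first.
  by apply/rowP => i; rewrite !mxE; ring.
have t1' : 0 <= 1 - t by rewrite subr_ge0.
apply: (le_lt_trans (ler_normD _ _)); rewrite !normrZ !ger0_norm//.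
have [->|t_neq0] := eqVneq t 0; first by rewrite mul0r addr0 subr0 mul1r.
have {}t0 : 0 < t by rewrite lt_neqAle eq_sym t_neq0.
rewrite (_ : e = (1 - t) * e + t * e); last by ring.
by rewrite ler_ltD// ?ler_wpM2l// ?ltW// ltr_pM2l.
Qed.

(** In a ball around x that avoids C, the boundary of T lies in the hyperplane through x. Each open
    half ball is convex and misses the boundary, so it is inside T or disjoint from T; the points
    [x - t *: nu] and [x + t *: nu] for one small t decide which. *)
Lemma half_space_near n (T C : set 'rV[R]_n) (x nu : 'rV[R]_n) :
  open T -> closed C -> ~ C x -> mxdot nu nu = 1 ->
  (forall y, bd T y -> C y \/ mxdot (y - x) nu = 0) ->
  (\forall t \near 0^'+, T (x - t *: nu) /\ ~ T (x + t *: nu)) ->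
  \forall y \near x, (mxdot (y - x) nu < 0 -> T y) /\ (0 < mxdot (y - x) nu -> ~ T y).
Proof.
move=> oT cC nCx nu1 bdT side.
have : nbhs x (~` C) by apply: open_nbhs_nbhs; split => //; exact: closed_openC.
move=> /nbhs_ballP[e /= e0 xeC].
have [t [t0 te [Tt nTt]]] : exists t : R,
    [/\ 0 < t, t * `|nu| < e & T (x - t *: nu) /\ ~ T (x + t *: nu)].
  have : \forall t \near (0 : R)^'+, 0 < t /\ t * `|nu| < e.
    near=> t; split; first by near: t; exact: nbhs_right_gt.
    have t0 : 0 < t by near: t; exact: nbhs_right_gt.
    rewrite (@le_lt_trans _ _ (t * (`|nu| + 1)))//.
      by rewrite ler_pM2l// lerDl.
    rewrite -ltr_pdivlMr ?ltr_wpDl//; near: t; apply: nbhs_right_lt.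
    by rewrite divr_gt0// ltr_wpDl.
  move=> h; have [t [[t0 te] Tt]] := filter_ex (filterI h side).
  by exists t.
have xb (s : R) : `|s| = t -> ball x e (x + s *: nu).
  by move=> st; rewrite -ball_normE/= opprD addrA subrr sub0r normrN normrZ st.
have bm : ball x e (x - t *: nu).
  by rewrite -scaleNr; apply: xb; rewrite normrN gtr0_norm.
have bp : ball x e (x + t *: nu) by apply: xb; rewrite gtr0_norm.
have dot_seg (y w : 'rV[R]_n) (s : R) : mxdot (w + s *: (y - w) - x) nu =
    (1 - s) * mxdot (w - x) nu + s * mxdot (y - x) nu.
  rewrite (_ : w + s *: (y - w) - x = (1 - s) *: (w - x) + s *: (y - x)).
    by rewrite (mxdotDl ((1 - s) *: (w - x))) (mxdotZl (1 - s)) (mxdotZl s).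
  by apply/rowP => i; rewrite !mxE; ring.
have nbd y w (s : R) : ball x e y -> ball x e w -> 0 <= s <= 1 ->
    mxdot (w + s *: (y - w) - x) nu != 0 -> ~ bd T (w + s *: (y - w)).
  move=> xy xw s01 dot0 /bdT[|/eqP]; last by rewrite (negbTE dot0).
  exact/xeC/ball_segment.
have dm : mxdot (x - t *: nu - x) nu = - t.
  by rewrite addrAC subrr add0r mxdotNl mxdotZl nu1 mulr1.
have dp : mxdot (x + t *: nu - x) nu = t.
  by rewrite addrAC subrr add0r mxdotZl nu1 mulr1.
apply/nbhs_ballP; exists e => // y xy; split=> [yneg|ypos Ty].
  apply: (segment_in_open oT Tt) => s s01; apply: nbd => //.
  rewrite dot_seg dm lt_eqF//; move: s01 => /andP[s0 s1].
  have [->|s_neq0] := eqVneq s 0; first by rewrite subr0 mul1r mul0r addr0.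
  by rewrite -oppr_gt0; nra.
apply: nTt; apply: (segment_in_open oT Ty) => s s01; apply: nbd => //.
rewrite dot_seg dp gt_eqF//; move: s01 => /andP[s0 s1].
by nra.
Unshelve. all: by end_near. Qed.

(** The transposed frame gives a continuous left inverse [rho] of the chart. The plane of e is the
    closed set of fixed points of [chart e \o rho], so a limit point of the face is the image of a
    limit point of its domain. *)
Lemma closure_flat_set d (e : flat d (R := R)) : flat_face e ->
  closure (flat_set e) `<=` flat_set e `|` chart e @` bd (flat_dom e).
Proof.
move=> [FF [_ oD _ _ _]] x xe.
pose rho (x : 'rV[R]_d) := - (flat_base e *m (flat_frame e)^T) + x *m (flat_frame e)^T.
have rhoK y : rho (chart e y) = y.
  rewrite /rho /chart mulmxDl -mulmxA FF mulmx1 addrA addrC.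
  by rewrite [- _ + _]addrC subrr addr0.
have crho : continuous rho by exact: continuous_affine.
have cchart : continuous (chart e) by exact: continuous_affine.
have xE : x = chart e (rho x).
  have : closed [set x | x = chart e (rho x)].
    pose G (x : 'rV[R]_d) := (flat_base e - flat_base e *m (flat_frame e)^T *m flat_frame e) +
      x *m ((flat_frame e)^T *m flat_frame e - 1%:M).
    rewrite (_ : [set x | _] = G @^-1` [set 0]).
      move/continuous_closedP : (@continuous_affine R d d _ _ : continuous G); apply.
      exact: (accessible_closed_set1 (hausdorff_accessible (@norm_hausdorff _ _))).
    have GE z : G z = chart e (rho z) - z.
      by rewrite /G /chart /rho mulmxDl mulNmx mulmxBr mulmx1 mulmxA !addrA.
    apply/seteqP; split=> z /=; rewrite GE; first by move=> <-; rewrite subrr.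
    by move/eqP; rewrite subr_eq0 => /eqP.
  apply; apply: closureS xe => _ [y _ <-] /=.
  by rewrite rhoK.
have rx : closure (flat_dom e) (rho x).
  move=> B /crho /xe[_ [[y Dy <-]]]; rewrite /= rhoK => By.
  by exists y.
have [Drx|nDrx] := pselect (flat_dom e (rho x)).
  by left; exists (rho x).
by right; exists (rho x) => //; rewrite (bd_open oD).
Qed.

Lemma face_bd d (E : set 'rV[R]_d) (e : flat d (R := R)) nu :
  open E -> outward_normal E e nu -> flat_set e `<=` bd E.
Proof.
move=> oE [_ _ side] x /side h; rewrite (bd_open oE); split.
  move=> B xB.
  have : \forall t \near (0 : R)^'+, B (x - t *: nu).
    have c : (fun t : R => x + t *: (- nu)) @ (0 : R)^'+ --> x.
      apply: cvg_at_right_filter.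
      have := @continuous_line R d x (- nu) 0.
      by rewrite /continuous_at scale0r addr0.
    have := c B xB; rewrite /nbhs/=; apply: filterS => t /=.
    by rewrite scalerN.
  move=> h'; have [t [[Et _] Bt]] := filter_ex (filterI h h').
  by exists (x - t *: nu).
move=> Ex.
have : \forall t \near (0 : R)^'+, E (x + t *: nu).
  have c : (fun t : R => x + t *: nu) @ (0 : R)^'+ --> x.
    apply: cvg_at_right_filter.
    have := @continuous_line R d x nu 0.
    by rewrite /continuous_at scale0r addr0.
  by apply: c; exact: open_nbhs_nbhs.
by move=> h'; have [t [[_ nE] E']] := filter_ex (filterI h h').
Qed.

Lemma enorm1 n (nu : 'rV[R]_n) : enorm nu = 1 -> mxdot nu nu = 1.
Proof.
rewrite /enorm => h; have : 0 <= mxdot nu nu.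
  by rewrite mxdot_rVE; apply: sumr_ge0 => i _; rewrite -expr2 sqr_ge0.
by move/sqr_sqrtr => <-; rewrite h expr1n.
Qed.

(** The left side is the volume factor of the projection of the plane of F along (1, v) onto the
    last n coordinates. It equals the determinant of W, the frame completed by (1, v), by
    elimination; multiplied by the transpose of the orthogonal matrix Q, W becomes block triangular
    with corner <(1, v), nu>. *)
Lemma det_frame n (F : 'M[R]_(n, 1 + n)) (nu : 'rV[R]_(1 + n)) (v : 'rV[R]_n) :
  F *m F^T = 1%:M -> F *m nu^T = 0 -> mxdot nu nu = 1 ->
  `|\det (rsubmx F - lsubmx F *m v)| = `|mxdot (row_mx 1%:M v) nu|.
Proof.
move=> FF Fn nn.
pose Q : 'M[R]_(1 + n) := col_mx nu F; pose W : 'M[R]_(1 + n) := col_mx (row_mx 1%:M v) F.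
have nF : nu *m F^T = 0 by rewrite -[LHS]trmxK trmx_mul trmxK Fn trmx0.
have nn' : nu *m nu^T = 1%:M by rewrite [LHS]mx11_scalar -nn /mxdot /mxtrace big_ord1.
have QQ : Q *m Q^T = 1%:M.
  by rewrite tr_col_mx mul_col_row nn' nF Fn FF -scalar_mx_block.
have detQ : `|\det Q^T| = 1.
  have := congr1 determinant QQ; rewrite det_mulmx det1 det_tr.
  move/(congr1 Num.norm); rewrite normrM normr1 -expr2 => /eqP.
  by rewrite sqrp_eq1// => /eqP.
have -> : \det (rsubmx F - lsubmx F *m v) = \det W.
  have -> : W = block_mx 1%:M 0 (lsubmx F) 1%:M *m
      block_mx 1%:M v 0 (rsubmx F - lsubmx F *m v).
    rewrite mulmx_block !(mul1mx, mulmx1, mulmx0, mul0mx, addr0, add0r).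
    by rewrite addrC subrK /W -[in LHS](hsubmxK F).
  by rewrite det_mulmx det_lblock det_ublock !det1 !mul1r.
rewrite -[LHS]mulr1 -[X in _ * X = _]detQ -normrM -det_mulmx.
have -> : W *m Q^T = block_mx (mxdot (row_mx 1%:M v) nu)%:M ((row_mx 1%:M v) *m F^T) 0 1%:M.
  rewrite tr_col_mx mul_col_row Fn FF [X in block_mx X]mx11_scalar.
  by rewrite /mxdot /mxtrace big_ord1.
by rewrite det_ublock det1 mulr1 det_scalar1.
Qed.

End faces_of_open_sets.

(** * Change of variables for integrable functions, and integration along parallel lines *)

Section signed_integrals.
Context {R : realType}.
Local Notation mu := (@lebesgue_measure R).
Local Notation lam := (@lebesgue_rV R).
Local Notation mR := (measurableTypeR R).

(** The nonnegative case is applied to the absolute value for integrability, then to the positive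
    and negative parts. *)
Lemma integral_comp_scale d1 d2 (T1 : measurableType d1) (T2 : measurableType d2)
    (phi : T1 -> T2) (k : R) (m1 : {measure set T1 -> \bar R})
    (m2 : {measure set T2 -> \bar R}) :
  measurable_fun [set: T1] phi -> 0 <= k ->
  (forall f, measurable_fun [set: T2] f -> (forall x, (0 <= f x)%E) ->
    (\int[m1]_x f (phi x) = k%:E * \int[m2]_x f x)%E) ->
  forall h, m2.-integrable setT h -> m1.-integrable setT (h \o phi) /\
    (\int[m1]_x h (phi x) = k%:E * \int[m2]_x h x)%E.
Proof.
move=> mphi k0 H h ih; have /integrableP[mh h_fin] := ih.
have mabs : measurable_fun setT (fun x => `|h x|%E) by exact: measurableT_comp.
split.
  apply/integrableP; split; first exact: measurableT_comp mh mphi.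
  rewrite (H (fun x => `|h x|%E))//.
  by apply: lte_mul_pinfty => //; rewrite lee_fin.
have Hp : (\int[m1]_x (fun x => h (phi x))^\+ x = k%:E * \int[m2]_x h^\+ x)%E.
  rewrite -(H (h^\+)%E)//; last exact: measurable_funepos.
  by rewrite -[X in X^\+%E]/(h \o phi) funepos_comp.
have Hn : (\int[m1]_x (fun x => h (phi x))^\- x = k%:E * \int[m2]_x h^\- x)%E.
  rewrite -(H (h^\-)%E)//; last exact: measurable_funeneg.
  by rewrite -[X in X^\-%E]/(h \o phi) funeneg_comp.
rewrite [LHS]integralE Hp Hn [X in (_ = _ * X)%E]integralE [RHS]muleBr//.
apply: fin_num_adde_defl; rewrite fin_numN.
by apply: integrable_fin_num => //; exact: integrable_funeneg.
Qed.

Lemma integral_rV_affine n (A : 'M[R]_n) (c : 'rV[R]_n) (h : 'rV[R]_n -> \bar R) :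
  A \in unitmx -> (lam n).-integrable setT h ->
  (lam n).-integrable setT (fun x => h (x *m A + c)) /\
  (\int[lam n]_x h (x *m A + c)%R = `|\det A|^-1%:E * \int[lam n]_x h x)%E.
Proof.
move=> uA; have k0 : 0 <= `|\det A|^-1 by rewrite invr_ge0.
have mphi : measurable_fun setT (fun x : 'rV[R]_n => x *m A + c).
  exact: (measurableT_comp (measurable_addrV c) (measurable_mulmx A)).
apply: (@integral_comp_scale _ _ _ _ _ `|\det A|^-1 (lam n) (lam n) mphi k0) => f mf f0.
rewrite (@scales_lebesgue_unit R n A uA (fun x => f (x + c)))//.
  by rewrite ge0_integral_rVD.
exact: (measurableT_comp mf (measurable_addrV c)).
Qed.

Lemma integral_consrV n (h : 'rV[R]_n.+1 -> \bar R) :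
  (lam n.+1).-integrable setT h ->
  measurable_fun setT (fun z => \int[mu]_s h (consrV (s, z)))%E /\
  (\int[lam n.+1]_x h x = \int[lam n]_z \int[mu]_s h (consrV (s, z)))%E.
Proof.
move=> ih.
have H f : measurable_fun setT f -> (forall x, (0 <= f x)%E) ->
    (\int[mu \x lam n]_p f (consrV p) = 1%:E * \int[lam n.+1]_x f x)%E.
  move=> mf f0; rewrite mul1e.
  by rewrite (@ge0_integral_pushforward _ _ _ _ _ _ (@measurable_consrV R n)).
have [ih' E] := integral_comp_scale (@measurable_consrV R n) ler01 H ih.
split; first exact: measurable_fubini_G ih'.
by rewrite -[LHS]mul1e -E -(integral21_prod_meas1 ih').
Qed.

Lemma shear_det n (v : 'rV[R]_n) : \det (block_mx 1%:M v 0 1%:M : 'M[R]_(1 + n)) = 1.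
Proof. by rewrite det_ublock !det1 mulr1. Qed.

(** Fubini after the shear (s, z) |-> (s, z + s v), which has determinant 1: the inner integrals run
    over the lines of direction (1, v). *)
Lemma integral_lines n (v : 'rV[R]_n) (h : 'rV[R]_(1 + n) -> \bar R) :
  (lam (1 + n)).-integrable setT h ->
  measurable_fun setT (fun z : 'rV[R]_n => \int[mu]_s h (row_mx s%:M (z + s *: v)%R))%E /\
  (\int[lam (1 + n)]_x h x = \int[lam n]_z \int[mu]_s h (row_mx s%:M (z + s *: v)%R))%E.
Proof.
move=> ih; pose L : 'M[R]_(1 + n) := block_mx 1%:M v 0 1%:M.
have uL : L \in unitmx by rewrite unitmxE shear_det unitr1.
have [ih' E] := integral_rV_affine 0 uL ih.
have [mh' E'] := integral_consrV ih'.
have eq s z : h (consrV (s, z) *m L + 0) = h (row_mx s%:M (z + s *: v)).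
  congr h; rewrite addr0 consrVE -[LHS]/(row_mx s%:M z *m L) mul_row_block !mulmx1 mulmx0 addr0.
  by rewrite mul_scalar_mx addrC.
have eqz z : (\int[mu]_s h (consrV (s, z) *m L + 0)%R =
    \int[mu]_s h (row_mx s%:M (z + s *: v)%R))%E.
  by apply: eq_integral => s _; rewrite eq.
split.
  by rewrite (_ : (fun z => _) = fun z => \int[mu]_s h (consrV (s, z) *m L + 0)%R)%E//; apply/funext.
under [RHS]eq_integral do rewrite -eqz.
by rewrite -E' E shear_det normr1 invr1 mul1e.
Qed.

Lemma integrable_bounded n (D : set 'rV[R]_n) (f : 'rV[R]_n -> R) (C : R) :
  measurable D -> coord_bounded D -> measurable_fun setT (f : _ -> mR) ->
  (forall x, D x -> `|f x| <= C) -> (lam n).-integrable D (EFin \o f).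
Proof.
move=> mD bD mf fC; apply: measurable_bounded_integrable => //.
- exact: lebesgue_rV_bounded.
- exact: measurable_funTS.
- by exists C; split; [exact: num_real|move=> r Cr x /= Dx; rewrite (le_trans (fC x Dx))// ltW].
Qed.

Lemma integrable_pev n (D : set 'rV[R]_n) (p : mpoly.mpoly n R) :
  measurable D -> coord_bounded D -> (lam n).-integrable D (EFin \o pev p).
Proof.
move=> mD [K DK]; have [C pC] := bounded_pev p K.
apply: (@integrable_bounded _ _ _ C) => //; first by exists K.
  exact: measurable_pev.
by move=> x /DK; exact: pC.
Qed.

Lemma EFin_Rintegral d (T : measurableType d) (m : {measure set T -> \bar R}) (D : set T) (f : T -> R) :
  measurable D -> m.-integrable D (EFin \o f) ->
  (\int[m]_(x in D) f x)%:E = (\int[m]_(x in D) (f x)%:E)%E.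
Proof. by move=> mD fi; rewrite /Rintegral fineK//; exact: integrable_fin_num. Qed.

Lemma integral_indicM d (T : measurableType d) (m : {measure set T -> \bar R}) (D : set T) (f : T -> R) :
  (\int[m]_(x in D) (f x)%:E = \int[m]_x (\1_D x * f x)%:E)%E.
Proof.
rewrite integral_mkcond; apply: eq_integral => x _.
by rewrite patchE indicE; case: ifP => _; rewrite ?mul1r ?mul0r.
Qed.

Lemma integrable_indicM d (T : measurableType d) (m : {measure set T -> \bar R}) (D : set T) (f : T -> R) :
  measurable D -> m.-integrable D (EFin \o f) ->
  m.-integrable setT (fun x => (\1_D x * f x)%:E).
Proof.
move=> mD; rewrite integrable_mkcond//; congr (_.-integrable _ _); apply/funext => x.
by rewrite patchE indicE; case: ifP => _; rewrite ?mul1r ?mul0r.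
Qed.

End signed_integrals.

Section sums_over_predicates.
Context d (T : measurableType d) {R : realType}.

Lemma emeasurable_sum_pred (I : finType) (P : pred I) (D : set T) (f : I -> T -> \bar R) :
  (forall i, P i -> measurable_fun D (f i)) ->
  measurable_fun D (fun x => \sum_(i | P i) f i x)%E.
Proof.
move=> mf; rewrite (_ : (fun x => _) = fun x => (\sum_i (if P i then f i x else 0))%E).
  apply: emeasurable_sum => i; case Pi : (P i); first exact: mf.
  exact: measurable_cst.
by apply/funext => x; rewrite big_mkcond.
Qed.

Lemma integral_sum_pred (m : {measure set T -> \bar R}) (I : finType) (P : pred I) (D : set T)
    (f : I -> T -> \bar R) : measurable D ->
  (forall i, P i -> m.-integrable D (f i)) ->
  (\int[m]_(x in D) (\sum_(i | P i) f i x) = \sum_(i | P i) \int[m]_(x in D) f i x)%E.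
Proof.
move=> mD fi; pose g i x := (if P i then f i x else 0)%E.
transitivity (\int[m]_(x in D) (\sum_(i | P i) g i x))%E.
  by apply: eq_integral => x _; apply: eq_bigr => i Pi; rewrite /g Pi.
rewrite integral_sum// => [|i].
  by apply: eq_bigr => i Pi; apply: eq_integral => x _; rewrite /g Pi.
by rewrite /g; case Pi : (P i); [exact: fi|exact: integrable0].
Qed.

End sums_over_predicates.

Section affine_null_sets.
Context {R : realType}.
Local Notation lam := (@lebesgue_rV R).

Lemma negligible_affine n (A : 'M[R]_n) (c : 'rV[R]_n) (B : set 'rV[R]_n) :
  A \in unitmx -> measurable B -> lam n B = 0%E ->
  (lam n).-negligible [set z | B (z *m A + c)].
Proof.
move=> uA mB B0.
have mphi : measurable_fun setT (fun x : 'rV[R]_n => x *m A + c).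
  exact: (measurableT_comp (measurable_addrV c) (measurable_mulmx A)).
have mN : measurable [set z | B (z *m A + c)].
  by rewrite -[X in measurable X]setTI; exact: mphi.
have lamE S : measurable S -> lam n S = (\int[lam n]_x (\1_S x)%:E)%E.
  by move=> mS; rewrite integral_indic// setIT.
have iB : (lam n).-integrable setT (fun x => (\1_B x)%:E).
  apply/integrableP; split; first by apply/measurable_EFinP; exact: measurable_indic.
  under eq_integral do rewrite gee0_abs ?lee_fin//.
  by rewrite -lamE// B0 ltry.
have [_ E] := integral_rV_affine c uA iB.
rewrite -(lamE B mB) B0 mule0 in E.
apply/negligibleP => //; apply: (eq_trans (lamE _ mN)).
by rewrite -[RHS]E; apply: eq_integral => z _; rewrite !indicE.
Qed.

End affine_null_sets.

Section flat_integrals.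
Context {R : realType} (d : nat).
Local Notation lam := (@lebesgue_rV R).

Lemma measurable_chart (e : flat (R := R) d) : measurable_fun setT (chart e).
Proof.
rewrite (_ : chart e = fun y => y *m flat_frame e + flat_base e).
  exact: (measurableT_comp (measurable_addrV _) (measurable_mulmx _)).
by apply/funext => y; rewrite /chart addrC.
Qed.

Lemma bounded_pev_chart (e : flat (R := R) d) (p : mpoly.mpoly d R) :
  coord_bounded (flat_dom e) ->
  exists C : R, forall y, flat_dom e y -> `|pev p (chart e y)| <= C.
Proof.
move=> [K DK].
have [C pC] := bounded_pev p (\sum_i `|flat_base e 0 i| + \sum_i \sum_j `|K| * `|flat_frame e j i|).
exists C => y Dy; apply: pC => i; rewrite mxE (le_trans (ler_normD _ _))// lerD//.
  by rewrite (bigD1 i)//= lerDl sumr_ge0.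
rewrite (bigD1 i)//= -[leLHS]addr0 lerD//; last first.
  by apply: sumr_ge0 => k _; apply: sumr_ge0 => j _; rewrite mulr_ge0.
rewrite mxE (le_trans (ler_norm_sum _ _ _))//; apply: ler_sum => j _.
by rewrite normrM ler_wpM2r// (le_trans _ (ler_norm K))// DK.
Qed.

Lemma integrable_chart (e : flat (R := R) d) (p : mpoly.mpoly d R) : flat_face e ->
  (lam d.-1).-integrable (flat_dom e) (EFin \o (pev p \o chart e)).
Proof.
move=> [FF pD]; have bD := polyhedral_coord_bounded pD.
have [C pC] := bounded_pev_chart p bD.
apply: (@integrable_bounded _ _ _ _ C) => //.
- by apply: open_measurable_rV; case: pD.
- exact: (measurableT_comp (measurable_pev p) (measurable_chart e)).
Qed.

End flat_integrals.

Section polynomial_integrals.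
Context {R : realType}.
Local Notation lam := (@lebesgue_rV R).

Lemma Rintegral_pev_sum d (D : set 'rV[R]_d) (I : finType) (a : I -> R)
    (p : I -> mpoly.mpoly d R) : measurable D -> coord_bounded D ->
  \int[lam d]_(x in D) pev (\sum_i a i *: p i) x =
  \sum_i a i * \int[lam d]_(x in D) pev (p i) x.
Proof.
move=> mD bD; have ip q := integrable_pev q mD bD.
apply: EFin_inj; rewrite EFin_Rintegral// -sumEFin.
transitivity (\sum_i \int[lam d]_(x in D) ((a i)%:E * (pev (p i) x)%:E))%E; last first.
  apply: eq_bigr => i _; rewrite EFinM EFin_Rintegral//.
  by rewrite integralZl//; exact: ip.
rewrite -integral_sum//; last by move=> i; apply: integrableZl => //; exact: ip.
apply: eq_integral => x _; rewrite pev_sum -sumEFin.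
by apply: eq_bigr => i _; rewrite pevZ.
Qed.

Lemma int_flat_sum d (e : flat d) (I : finType) (a : I -> R)
    (p : I -> mpoly.mpoly d R) : flat_face e ->
  int_flat e (pev (\sum_i a i *: p i)) = \sum_i a i * int_flat e (pev (p i)).
Proof.
move=> fe; have ip q := integrable_chart q fe.
have mD : measurable (flat_dom e) by apply: open_measurable_rV; case: fe.2.
apply: EFin_inj; rewrite /int_flat EFin_Rintegral//; last exact: ip.
rewrite -sumEFin.
transitivity (\sum_i \int[lam d.-1]_(x in flat_dom e)
    ((a i)%:E * (pev (p i) (chart e x))%:E))%E; last first.
  apply: eq_bigr => i _; rewrite EFinM /int_flat EFin_Rintegral//; last exact: ip.
  by rewrite integralZl//; exact: ip.
rewrite -integral_sum//; last by move=> i; apply: integrableZl => //; exact: ip.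
apply: eq_integral => x _; rewrite pev_sum -sumEFin.
by apply: eq_bigr => i _; rewrite pevZ.
Qed.

End polynomial_integrals.

(** * Slicing a polyhedral set by the lines of a direction *)

Section divergence.
Context {R : realType} (n : nat).
Local Notation mu := (@lebesgue_measure R).
Local Notation lam := (@lebesgue_rV R).
Local Notation rV := 'rV[R]_(1 + n).
Local Notation poly := (mpoly.mpoly (1 + n) R).

Variables (T : set rV) (I : finType) (facet : I -> flat (R := R) (1 + n))
  (F : pred I) (nu : I -> rV).
Hypotheses (pT : polyhedral T)
  (flatF : forall e, F e -> flat_face (facet e))
  (disjF : forall e e', F e -> F e' -> e != e' ->
     flat_set (facet e) `&` flat_set (facet e') = set0)
  (bdT : bd T = \bigcup_(e in [set e | F e]) closure (flat_set (facet e)))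
  (nuF : forall e, F e -> outward_normal T (facet e) (nu e)).

Section direction.
Variable v' : 'rV[R]_n.
(** [line z] is the line of direction v through (0, z), parametrized by the first coordinate, and
    [Pi] is the projection along v, which sends it to z. Seen through [Pi], the plane of a face e is
    the affine map y |-> b e + y A e. When [vn e] is nonzero this map is invertible with inverse
    [pre e], and [lift e z] is the point where [line z] meets the plane, at parameter
    [height e z]. *)
Let v : rV := row_mx 1%:M v'.
Let Pi : 'M[R]_(1 + n, n) := col_mx (- v') 1%:M.
Let line (z : 'rV[R]_n) (s : R) : rV := row_mx s%:M (z + s *: v').
Let A e : 'M[R]_n := flat_frame (facet e) *m Pi.
Let b e : 'rV[R]_n := flat_base (facet e) *m Pi.
Let vn e : R := mxdot v (nu e).
Let pre e (z : 'rV[R]_n) : 'rV[R]_n := (z - b e) *m invmx (A e).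
Let lift e z := chart (facet e) (pre e z).
Let crossed z : pred I := fun e => [&& F e, vn e != 0 & `[< flat_dom (facet e) (pre e z) >]].
Let height e z : R := lift e z 0 0.

Let lineE z s : line z s = row_mx 0 z + s *: v.
Proof.
rewrite /line /v scale_row_mx add_row_mx add0r; congr row_mx.
by rewrite scale_scalar_mx mulr1.
Qed.

Let line_Pi z s : line z s *m Pi = z.
Proof. by rewrite mul_row_col mulmx1 mulmxN mul_scalar_mx addrC addrK. Qed.

Let line00 z s : line z s 0 0 = s.
Proof.
rewrite /line (_ : 0 = lshift n 0 :> 'I_(1 + n)); last exact/val_inj.
by rewrite row_mxEl mxE eqxx.
Qed.

Let linePi (x : rV) : line (x *m Pi) (x 0 0) = x.
Proof.
rewrite -[x in RHS]hsubmxK /line -[x in x *m _]hsubmxK mul_row_col mulmx1.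
have x0 : x 0 0 = lsubmx x 0 0.
  by rewrite mxE; congr (x 0 _); exact/val_inj.
rewrite mulmxN [lsubmx x in RHS]mx11_scalar -x0; congr row_mx.
by rewrite [lsubmx x]mx11_scalar -x0 mul_scalar_mx addrAC addNr add0r.
Qed.

Let chart_Pi e y : chart (facet e) y *m Pi = b e + y *m A e.
Proof. by rewrite /chart mulmxDl -mulmxA. Qed.

Let detA e : F e -> `|\det (A e)| = `|vn e|.
Proof.
move=> Fe; have [FF _] := flatF Fe; have [/enorm1 nn Fn _] := nuF Fe.
rewrite /vn -(det_frame v' FF Fn nn) /A; congr (`|\det _|).
by rewrite -[X in X *m _]hsubmxK mul_row_col mulmx1 mulmxN addrC.
Qed.

Let unitA e : F e -> vn e != 0 -> A e \in unitmx.
Proof. by move=> Fe ve; rewrite unitmxE unitfE -normr_gt0 detA// normr_gt0. Qed.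

Let pre_chart e y : F e -> vn e != 0 -> pre e (b e + y *m A e) = y.
Proof. by move=> Fe ve; rewrite /pre addrAC subrr add0r mulmxK ?unitA. Qed.

Let lift_Pi e z : F e -> vn e != 0 -> lift e z *m Pi = z.
Proof.
by move=> Fe ve; rewrite /lift chart_Pi /pre mulmxKV ?unitA// addrC subrK.
Qed.

Let lift_line e z : F e -> vn e != 0 -> line z (height e z) = lift e z.
Proof. by move=> Fe ve; rewrite -{1}(lift_Pi z Fe ve) linePi. Qed.

(* [z] is good if the line over [z] meets no face parallel to [v], and no
   relative boundary of another face. *)
Let good z := forall e, F e ->
  (vn e = 0 -> forall y, b e + y *m A e != z) /\
  (vn e != 0 -> ~ bd (flat_dom (facet e)) (pre e z)).

Let oT : open T. Proof. by case: pT. Qed.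

(** The closure of a face adds to it only images of boundary points of its domain. A good line
    avoids these, and avoids the planes parallel to v. *)
Let closed_face e x : F e -> closure (flat_set (facet e)) x -> good (x *m Pi) ->
  [/\ vn e != 0, flat_dom (facet e) (pre e (x *m Pi)), x = lift e (x *m Pi) & flat_set (facet e) x].
Proof.
move=> Fe xe gx; have [g1 g2] := gx _ Fe.
have [y xE yD] : exists2 y, chart (facet e) y = x &
    flat_dom (facet e) y \/ bd (flat_dom (facet e)) y.
  by have [[y Dy yx]|[y Dy yx]] := closure_flat_set (flatF Fe) xe; exists y; tauto.
have zE : x *m Pi = b e + y *m A e by rewrite -xE chart_Pi.
have ve : vn e != 0.
  by apply/eqP => /g1 /(_ y); rewrite zE eqxx.
have yE : y = pre e (x *m Pi) by rewrite zE pre_chart.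
have Dy : flat_dom (facet e) y.
  by case: yD => //; rewrite yE => /(g2 ve).
split => //; first by rewrite -yE.
  by rewrite /lift -yE.
by exists y.
Qed.

Let crossing z e : good z -> crossed z e ->
  \forall t \near height e z, t != height e z ->
    (T (line z t) <-> (t - height e z) * vn e < 0).
Proof.
move=> gz /and3P[Fe ve /asboolP Dz]; have [nu1 Fn side] := nuF Fe.
have nn := enorm1 nu1.
set x := lift e z.
have xz : x *m Pi = z by exact: lift_Pi.
have xe : flat_set (facet e) x by exists (pre e z).
(* On a good line a point in the closure of another face would lie in that face, against
   disjointness. So x has positive distance to the rest of the boundary, and near x the boundary of
   T is in the plane of e. *)
pose C : set rV := \bigcup_(e' in [set e' | F e' && (e' != e)]) closure (flat_set (facet e')).
have cC : closed C.
  by apply: closed_bigcup => [|e' _]; [exact: finite_finset|exact: closed_closure].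
have nCx : ~ C x.
  move=> [e' /= /andP[Fe' e'e] xe'].
  have [_ _ _ xe''] : [/\ vn e' != 0, flat_dom (facet e') (pre e' (x *m Pi)),
      x = lift e' (x *m Pi) & flat_set (facet e') x].
    by apply: (closed_face Fe' xe'); rewrite xz.
  have : (flat_set (facet e') `&` flat_set (facet e)) x by [].
  by rewrite disjF.
have plane y : flat_set (facet e) y -> mxdot (y - x) (nu e) = 0.
  move=> [y' _ <-]; rewrite /x /lift /chart opprD addrACA subrr add0r -mulmxBl.
  by rewrite /mxdot -mulmxA Fn mulmx0 mxtrace0.
have bdC y : bd T y -> C y \/ mxdot (y - x) (nu e) = 0.
  rewrite bdT => -[e' /= Fe' ye']; have [e'e|e'e] := eqVneq e' e; last first.
    by left; exists e' => //=; rewrite Fe'.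
  right; move: ye'; rewrite e'e => ye.
  have cl : closed [set y | mxdot (y - x) (nu e) = 0].
    rewrite (_ : [set _ | _] = (fun y => mxdot (nu e) y - mxdot (nu e) x) @^-1` [set 0]).
      have c : continuous (fun y => mxdot (nu e) y - mxdot (nu e) x).
        by move=> w; apply: continuousB; [exact: continuous_mxdot|exact: cst_continuous].
      by move/continuous_closedP : c; apply; exact: closed_eq.
    by apply/seteqP; split => w /=; rewrite mxdotBl ![mxdot _ (nu e)]mxdotC.
  by apply: cl; apply: closureS ye => w /plane.
have h := half_space_near oT cC nCx nn bdC (side x xe).
have cl : line z @ height e z --> x.
  rewrite -[x](lift_line z Fe ve) (_ : line z = fun s => row_mx 0 z + s *: v).
    exact: continuous_line.
  by apply/funext => s; rewrite lineE.
have : \forall t \near height e z, (mxdot (line z t - x) (nu e) < 0 -> T (line z t)) /\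
    (0 < mxdot (line z t - x) (nu e) -> ~ T (line z t)) := cl _ h.
apply: filterS => t /= [tneg tpos] ts.
have dotE : mxdot (line z t - x) (nu e) = (t - height e z) * vn e.
  by rewrite /x -(lift_line z Fe ve) !lineE opprD addrACA subrr add0r -scalerBl mxdotZl.
rewrite dotE in tneg tpos; split=> [Tt|]; last exact: tneg.
rewrite ltNge; apply/negP; rewrite le_eqVlt => /predU1P[/esym/eqP|/tpos//].
by rewrite mulf_eq0 subr_eq0 (negbTE ts) (negbTE ve).
Qed.

Let no_crossing z t : good z -> (forall e, crossed z e -> t != height e z) ->
  (\forall u \near t, T (line z u)) \/ (\forall u \near t, ~ T (line z u)).
Proof.
move=> gz nt.
have cl : line z @ t --> line z t.
  rewrite (_ : line z = fun s => row_mx 0 z + s *: v).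
    exact: continuous_line.
  by apply/funext => s; rewrite lineE.
have [Tt|nTt] := pselect (T (line z t)).
  by left; apply: cl; exact: open_nbhs_nbhs.
right.
have nclT : ~ closure T (line z t).
  move=> clT; have : bd T (line z t) by rewrite bd_open.
  rewrite bdT => -[e /= Fe te].
  have [ve De lE _] : [/\ vn e != 0, flat_dom (facet e) (pre e (line z t *m Pi)),
      line z t = lift e (line z t *m Pi) & flat_set (facet e) (line z t)].
    by apply: (closed_face Fe te); rewrite line_Pi.
  rewrite line_Pi in De lE.
  have : crossed z e by rewrite /crossed Fe ve/=; exact/asboolP.
  by move/nt; rewrite /height -lE line00 eqxx.
have : nbhs (line z t) (~` closure T).
  by apply: open_nbhs_nbhs; split => //; apply: closed_openC; exact: closed_closure.
move/cl => h; have : \forall u \near t, ~ closure T (line z u) := h.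
apply: filterS => u /= nu' Tu; apply: nu'.
exact: subset_closure.
Qed.

Let dir_deriv (p : poly) : poly := \sum_i v 0 i *: mpoly.mderiv i p.

Let integral_slice (p : poly) z : good z ->
  (\int[mu]_s (\1_T (line z s) * pev (dir_deriv p) (line z s))%:E =
   (\sum_(e | crossed z e) Num.sg (vn e) * pev p (lift e z))%:E)%E.
Proof.
move=> gz; have [K TK] := polyhedral_bounded pT.
have eq1 e : crossed z e -> line z (height e z) = lift e z.
  by move=> /and3P[Fe ve _]; rewrite lift_line.
have eface e : crossed z e -> flat_set (facet e) (lift e z).
  by move=> /and3P[Fe ve /asboolP De]; exists (pre e z).
have -> : \sum_(e | crossed z e) Num.sg (vn e) * pev p (lift e z) =
    \sum_(e | crossed z e) Num.sg (vn e) * (fun s => pev p (line z s)) (height e z).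
  by apply: eq_bigr => e ce; rewrite eq1.
pose S s := T (line z s).
transitivity (\int[mu]_s (\1_S s * pev (dir_deriv p) (line z s))%:E)%E.
  by apply: eq_integral => s _; rewrite !indicE.
(* The parameter on the line is the first coordinate, so the bound K on the closure of T bounds both
   the slice and the crossings; adding 1 makes it strict. *)
apply: (@integral_crossings R I (crossed z) S (height^~ z) vn (K + 1) _ _ _ _ _ _ _
  (fun s => pev p (line z s))).
- rewrite (_ : S = (fun s => row_mx 0 z + s *: v) @^-1` T).
    by apply: open_comp => // s _; exact: continuous_line.
  by apply/funext => s; rewrite /S lineE.
- move=> s Ss; have /TK/(_ 0) : closure T (line z s) by exact: subset_closure.
  by rewrite line00; lra.
- move=> e ce; have [Fe ve _] := and3P ce.
  have /TK/(_ 0) : closure T (lift e z).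
    by have [] := face_bd oT (nuF Fe) (eface e ce).
  by rewrite -/(height e z); lra.
- move=> e e' ce ce' hh; apply/eqP; apply/negPn/negP => ee'.
  have : (flat_set (facet e) `&` flat_set (facet e')) (lift e z).
    by split; [exact: eface|rewrite -(eq1 _ ce) hh eq1//; exact: eface].
  by have [Fe _ _] := and3P ce; have [Fe' _ _] := and3P ce'; rewrite disjF.
- by move=> e /and3P[].
- by move=> e ce; exact: crossing.
- by move=> t; exact: no_crossing.
- move=> s.
  rewrite (_ : (fun s => pev p (line z s)) = fun s => pev p (row_mx 0 z + s *: v)).
    rewrite lineE /dir_deriv pev_sum.
    have := is_derive_pev_line p (row_mx 0 z) v s.
    by under eq_bigr do rewrite -pevZ.
  by apply/funext => t; rewrite lineE.
- rewrite (_ : (fun s => _) = pev (dir_deriv p) \o (fun s => row_mx 0 z + s *: v)).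
    move=> s; apply: continuous_comp; first exact: continuous_line.
    exact: continuous_pev.
  by apply/funext => s; rewrite /= lineE.
Qed.

(** For a face parallel to v, [A e] is singular and its plane projects into a hyperplane. For any
    other face, the bad z form the image, under an invertible affine map, of the boundary of the
    domain, which is null because the domain is itself polyhedral. *)
Let bad_negligible : (lam n).-negligible (~` [set z | good z]).
Proof.
pose N e : set 'rV[R]_n := [set z | F e /\
  ((vn e = 0 /\ exists y, b e + y *m A e = z) \/
   (vn e != 0 /\ bd (flat_dom (facet e)) (pre e z)))].
apply: (@negligibleS _ _ _ _ (\bigcup_e N e)).
  move=> z /existsNP[e /not_implyP[Fe /not_andP gz]]; exists e => //; split=> //.
  case: gz => /not_implyP[ve h]; [left|right]; split => //; last exact: contrapT.
  by move/existsNP : h => [y /negP/negPn/eqP yz]; exists y.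
apply: negligible_finU => e.
have [Fe|nFe] := boolP (F e); last first.
  rewrite (_ : N e = set0); first exact: negligible_set0.
  by apply/seteqP; split=> z //= []; rewrite (negbTE nFe).
have [ve|ve] := eqVneq (vn e) 0.
  have := detA Fe; rewrite ve normr0 => /normr0_eq0; rewrite -det_tr => /eqP/det0P[w w0 wA].
  apply: (@negligibleS _ _ _ _ [set z | mxdot w z + - mxdot w (b e) = 0]).
    move=> z [_ [[_ [y <-]]|[]]]; last by rewrite ve eqxx.
    rewrite /= mxdotDr addrAC subrr add0r /mxdot trmx_mul mulmxA wA mul0mx.
    exact: mxtrace0.
  apply/negligibleP; first exact: (measurable_mxdot _ _ (measurable_set1 0)).
  by apply: lebesgue_hyperplane; rewrite w0.
have uA' : invmx (A e) \in unitmx by rewrite unitmx_inv unitA.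
have [_ pD] := flatF Fe.
have preE z : pre e z = z *m invmx (A e) + - (b e *m invmx (A e)).
  by rewrite /pre mulmxBl.
have mbd : measurable (bd (flat_dom (facet e))) by apply: closed_measurable_rV; exact: closed_bd.
apply: negligibleS (negligible_affine (- (b e *m invmx (A e))) uA' mbd (polyhedral_bd0 pD)).
move=> z [_ [[ve0 _]|[_]]]; last by rewrite preE.
by rewrite ve0 eqxx in ve.
Qed.

(** The substitution y = [pre e z], whose volume factor is |det (A e)| = |vn e|. *)
Let integral_face (p : poly) e : F e -> vn e != 0 ->
  (lam n).-integrable setT
     (fun z => (\1_(flat_dom (facet e)) (pre e z) * pev p (lift e z))%:E) /\
  (\int[lam n]_z (\1_(flat_dom (facet e)) (pre e z) * pev p (lift e z))%:E =
   (`|vn e| * int_flat (facet e) (pev p))%:E)%E.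
Proof.
move=> Fe ve; have uA' : invmx (A e) \in unitmx by rewrite unitmx_inv unitA.
have [_ pD] := flatF Fe.
have preE z : pre e z = z *m invmx (A e) + - (b e *m invmx (A e)).
  by rewrite /pre mulmxBl.
have iD := integrable_chart p (flatF Fe).
have mD : measurable (flat_dom (facet e)).
  by apply: open_measurable_rV; case: pD.
have [ih E] := integral_rV_affine (- (b e *m invmx (A e))) uA' (integrable_indicM mD iD).
have eq z : (\1_(flat_dom (facet e)) (pre e z) * pev p (lift e z))%:E =
  (\1_(flat_dom (facet e)) (z *m invmx (A e) + - (b e *m invmx (A e))) *
   (pev p \o chart (facet e)) (z *m invmx (A e) + - (b e *m invmx (A e))))%:E.
  by rewrite /= /lift preE.
split; first by apply: eq_integrable ih => // z _; rewrite eq.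
under eq_integral do rewrite eq.
rewrite E -integral_indicM -EFin_Rintegral// -EFinM; congr (_ * _)%:E.
rewrite det_inv normrV ?invrK ?detA//.
by rewrite -unitmxE unitA.
Qed.

(** The sign of [vn e] comes from the orientation of the crossing and its absolute value from the
    projection of the face; their product is [vn e], which also gives the value 0 for the faces
    parallel to v. *)
Lemma divergence_direction (p : poly) :
  \int[lam (1 + n)]_(x in T) pev (dir_deriv p) x =
  \sum_(e | F e) vn e * int_flat (facet e) (pev p).
Proof.
have mT : measurable T by exact: open_measurable_rV.
have bT : coord_bounded T.
  exact: polyhedral_coord_bounded.
have iT := integrable_pev (dir_deriv p) mT bT.
apply/EFin_inj; rewrite EFin_Rintegral// integral_indicM.
have [mh ->] := integral_lines v' (integrable_indicM mT iT).
transitivity (\int[lam n]_z (\sum_(e | F e && (vn e != 0)%R)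
    ((Num.sg (vn e))%:E * (\1_(flat_dom (facet e)) (pre e z) * pev p (lift e z))%:E)))%E.
  apply: ae_eq_integral => //.
    apply: emeasurable_sum_pred => e /andP[Fe ve].
    apply: measurable_funeM; exact: measurable_int (integral_face p Fe ve).1.
  apply: negligibleS bad_negligible => z /= nz gz; apply: nz => _.
  rewrite (integral_slice p gz).
  under [RHS]eq_bigr do rewrite -EFinM.
  rewrite sumEFin; congr EFin; rewrite big_mkcond [RHS]big_mkcond/=.
  apply: eq_bigr => e _; rewrite /crossed; case: (F e) => //=; case: (vn e != 0) => //=.
  case: asboolP => h; rewrite indicE; first by rewrite mem_set// mul1r.
  by rewrite memNset// mul0r mulr0.
rewrite (integral_sum_pred (P := fun e => F e && (vn e != 0)))//; last first.
  by move=> e /andP[Fe ve]; apply: integrableZl => //; exact: (integral_face p Fe ve).1.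
transitivity (\sum_(e | F e && (vn e != 0)%R) (vn e * int_flat (facet e) (pev p))%:E)%E.
  apply: eq_bigr => e /andP[Fe ve]; have [ie E] := integral_face p Fe ve.
  by rewrite integralZl// E -EFinM mulrA -numEsg.
rewrite sumEFin; congr EFin; rewrite big_mkcondr/=; apply: eq_bigr => e Fe.
by case: eqVneq => // ->; rewrite mul0r.
Qed.

End direction.

Theorem divergence_polyhedral (p : poly) i :
  \int[lam (1 + n)]_(x in T) pev (mpoly.mderiv i p) x =
  \sum_(e | F e) nu e 0 i * int_flat (facet e) (pev p).
Proof.
have mT : measurable T by apply: open_measurable_rV; case: pT.
have bT : coord_bounded T.
  by have [K TK] := polyhedral_bounded pT; exists K => x Tx; apply: TK; exact: subset_closure.
pose W : rV := \row_i (\int[lam (1 + n)]_(x in T) pev (mpoly.mderiv i p) x -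
  \sum_(e | F e) nu e 0 i * int_flat (facet e) (pev p)).
(* The directions [(1, v')] span R^(1+n). *)
suff : W = 0 by move/rowP/(_ i); rewrite !mxE => /eqP; rewrite subr_eq0 => /eqP.
have WE v' : mxdot (row_mx 1%:M v') W = 0.
  have := divergence_direction v' p; rewrite Rintegral_pev_sum// => /eqP.
  rewrite -subr_eq0 => /eqP E; rewrite -[RHS]E mxdot_rVE.
  under eq_bigr do rewrite [W _ _]mxE mulrBr.
  rewrite sumrB; congr (_ - _).
  under eq_bigr do rewrite mulr_sumr.
  rewrite exchange_big/=; apply: eq_bigr => e Fe.
  by rewrite mxdot_rVE mulr_suml; apply: eq_bigr => j _; rewrite mulrA.
have W0 : lsubmx W = 0.
  have := WE 0; rewrite -[W in LHS]hsubmxK /mxdot tr_row_mx mul_row_col mul1mx mul0mx addr0.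
  rewrite [lsubmx W]mx11_scalar tr_scalar_mx mxtrace_scalar mulr1n => ->.
  by rewrite raddf0.
have W1 : rsubmx W = 0.
  apply/rowP => j; have := WE (delta_mx 0 j).
  rewrite -[W in LHS]hsubmxK /mxdot tr_row_mx mul_row_col W0 trmx0 mulmx0 add0r.
  by rewrite -rowE /mxtrace big_ord1 !mxE.
by rewrite -[W]hsubmxK W0 W1 row_mx0.
Qed.

End divergence.

(** * Galerkin problems and rigid motions *)

Section galerkin.
Context {R : realType}.

(** K has maximal rank among the matrices with rows in C; an element of C outside its row space
    would increase the rank. *)
Lemma subspace_row_span N (C : set 'rV[R]_N) : C 0 ->
  (forall a c c', C c -> C c' -> C (a *: c + c')) ->
  exists K : 'M[R]_N, (forall i, C (row i K)) /\ forall c, C c -> (c <= K)%MS.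
Proof.
move=> C0 CL.
have Csum m (K : 'M[R]_(m, N)) (y : 'rV[R]_m) : (forall i, C (row i K)) -> C (y *m K).
  move=> CK; rewrite mulmx_sum_row; elim/big_ind : _ => // [u w Cu Cw|i _].
    by rewrite -[u]scale1r; exact: CL.
  by rewrite -[X in C X]addr0; exact: CL.
pose Q r := `[< exists K : 'M[R]_N, (forall i, C (row i K)) /\ \rank K = r >].
have Q0 : exists r, Q r.
  by exists 0%N; apply/asboolP; exists 0; rewrite mxrank0; split => // i; rewrite row0.
have QN r : Q r -> (r <= N)%N by move=> /asboolP[K [_ <-]]; exact: rank_leq_row.
case: (ex_maxnP Q0 QN) => r /asboolP[K [CK rK]] rmax.
exists K; split=> // c Cc; apply/negPn/negP => ncK.
have : Q (\rank (K + c)%MS).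
  apply/asboolP; exists (K + c)%MS; split => // i.
  have /sub_addsmxP[u ->] := row_sub i (K + c)%MS.
  rewrite -[u.1 *m K]scale1r; apply: CL; first exact: Csum.
  by apply: Csum => j; rewrite row_id.
move/rmax; rewrite -rK leqNgt => /negP; apply; apply: rank_ltmx.
rewrite ltmxE addsmxSl/=; apply: contra ncK; apply: submx_trans.
exact: addsmxSr.
Qed.

(** P is a space of functions whose values count only on E: definiteness of B is stated on E, and
    [B0] and [L0] make the forms blind to what happens elsewhere. [Pspan] expresses finite dimension
    on E by a finite family b that may lie outside P. *)
Variables (A : Type) (W : lmodType R) (E : set A) (I : finType) (b : I -> A -> W).
Variables (P : set (A -> W)) (B : (A -> W) -> (A -> W) -> R) (L : (A -> W) -> R).
Let lin a (f g : A -> W) : A -> W := fun x => a *: f x + g x.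
Hypotheses (P0 : P (fun=> 0)) (PL : forall a f g, P f -> P g -> P (lin a f g))
  (Pspan : forall f, P f -> exists c : I -> R, forall x, E x -> f x = \sum_i c i *: b i x)
  (Bl : forall a f g h, P f -> P g -> P h -> B (lin a f g) h = a * B f h + B g h)
  (Br : forall a f g h, P f -> P g -> P h -> B h (lin a f g) = a * B h f + B h g)
  (Ll : forall a f g, P f -> P g -> L (lin a f g) = a * L f + L g)
  (Bpos : forall f, P f -> B f f = 0 -> forall x, E x -> f x = 0)
  (B0 : forall f g, P f -> P g -> (forall x, E x -> g x = 0) -> B f g = 0)
  (L0 : forall f, P f -> (forall x, E x -> f x = 0) -> L f = 0).

Lemma galerkin_unique u u' : P u -> P u' ->
  (forall v, P v -> B u v = L v) -> (forall v, P v -> B u' v = L v) ->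
  forall x, E x -> u x = u' x.
Proof.
move=> Pu Pu' uL u'L x Ex.
have Pd : P (lin (-1) u' u) by exact: PL.
have := Bpos Pd; rewrite Bl// uL// u'L// mulN1r addNr => /(_ erefl x Ex).
by rewrite /lin scaleN1r addrC => /eqP; rewrite subr_eq0 => /eqP.
Qed.

Let comb N (phi : 'I_N -> A -> W) (y : 'I_N -> R) r : A -> W :=
  fun x => \sum_(i <- r) y i *: phi i x.

Let comb_cons N (phi : 'I_N -> A -> W) y i r :
  comb phi y (i :: r) = lin (y i) (phi i) (comb phi y r).
Proof. by apply/funext => x; rewrite /comb big_cons. Qed.

Let comb_nil N (phi : 'I_N -> A -> W) y : comb phi y [::] = (fun=> 0).
Proof. by apply/funext => x; rewrite /comb big_nil. Qed.

Let P_comb N (phi : 'I_N -> A -> W) y r : (forall i, P (phi i)) -> P (comb phi y r).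
Proof.
move=> Pphi; elim: r => [|i r ih]; first by rewrite comb_nil.
by rewrite comb_cons; exact: PL.
Qed.

Let L_comb N (phi : 'I_N -> A -> W) y r : (forall i, P (phi i)) ->
  L (comb phi y r) = \sum_(i <- r) y i * L (phi i).
Proof.
move=> Pphi; elim: r => [|i r ih]; first by rewrite comb_nil big_nil L0.
by rewrite comb_cons big_cons Ll ?ih//; exact: P_comb.
Qed.

Let Br_comb N (phi : 'I_N -> A -> W) y r h : P h -> (forall i, P (phi i)) ->
  B h (comb phi y r) = \sum_(i <- r) y i * B h (phi i).
Proof.
move=> Ph Pphi; elim: r => [|i r ih]; first by rewrite comb_nil big_nil B0.
by rewrite comb_cons big_cons Br ?ih//; exact: P_comb.
Qed.

Let Bl_comb N (phi : 'I_N -> A -> W) y r h : P h -> (forall i, P (phi i)) ->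
  B (comb phi y r) h = \sum_(i <- r) y i * B (phi i) h.
Proof.
move=> Ph Pphi; elim: r => [|i r ih].
  have := @Bl (-1) (fun=> 0) (fun=> 0) h P0 P0 Ph.
  rewrite (_ : lin _ _ _ = fun=> 0); last first.
    by apply/funext => x; rewrite /lin scaler0 addr0.
  by rewrite mulN1r addNr comb_nil big_nil.
by rewrite comb_cons big_cons Bl ?ih//; exact: P_comb.
Qed.

(** The family [phi] spans P on E but need not be free, so its Gram matrix G need not be invertible.
    It is enough that the vector l of the values of L lies in the row space of G. *)
Lemma galerkin_exists : exists u, P u /\ forall v, P v -> B u v = L v.
Proof.
pose N := #|I|.
pose C : set 'rV[R]_N := [set c | exists f, P f /\
  forall x, E x -> f x = \sum_j c 0 j *: b (enum_val j) x].
have [K [CK KC]] : exists K : 'M[R]_N, (forall i, C (row i K)) /\ forall c, C c -> (c <= K)%MS.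
  apply: subspace_row_span.
    by exists (fun=> 0); split => // x _; rewrite big1// => j _; rewrite mxE scale0r.
  move=> a c c' [f [Pf fc]] [g [Pg gc]]; exists (lin a f g); split; first exact: PL.
  move=> x Ex; rewrite /lin fc// gc// scaler_sumr -big_split/=; apply: eq_bigr => j _.
  by rewrite !mxE scalerA -scalerDl.
have /choice[phi phiP] := CK.
have Pphi i : P (phi i) by have [] := phiP i.
have phiE i x : E x -> phi i x = \sum_j K i j *: b (enum_val j) x.
  by move=> Ex; rewrite (phiP i).2//; apply: eq_bigr => j _; rewrite mxE.
have Pcomb v : P v -> exists y : 'I_N -> R, forall x, E x -> v x = \sum_i y i *: phi i x.
  move=> Pv; have [c vc] := Pspan Pv.
  have : C (\row_j c (enum_val j)).
    exists v; split => // x Ex; rewrite vc// (reindex _ (onW_bij _ (enum_val_bij I))).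
    by apply: eq_bigr => j _; rewrite mxE.
  move=> /KC/submxP[y yE]; exists (fun i => y 0 i) => x Ex; rewrite vc//.
  rewrite (reindex _ (onW_bij _ (enum_val_bij I)))/=.
  under [RHS]eq_bigr do rewrite phiE// scaler_sumr.
  rewrite exchange_big/=; apply: eq_bigr => j _.
  have /rowP/(_ j) := yE; rewrite !mxE => ->; rewrite scaler_suml.
  by apply: eq_bigr => i _; rewrite scalerA.
pose G : 'M[R]_N := \matrix_(i, j) B (phi i) (phi j).
pose l : 'rV[R]_N := \row_j L (phi j).
pose cmb y : A -> W := comb phi y (index_enum 'I_N).
(* A column of the cokernel of G gives a combination [chi] with B(phi_i, chi) = 0 for all i. Then
   B(chi, chi) = 0, so [chi] vanishes on E and L kills it: l is orthogonal to the cokernel. *)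
have lG : (l <= G)%MS.
  rewrite submxE; apply/eqP/rowP => j; rewrite !mxE.
  pose chi := cmb (fun k => cokermx G k j).
  have Pchi : P chi by exact: P_comb.
  have Bchi i : B (phi i) chi = 0.
    have /matrixP/(_ i j) := mulmx_coker G; rewrite !mxE => E'.
    rewrite Br_comb// -[RHS]E'.
    by apply: eq_bigr => k _; rewrite [G _ _]mxE mulrC.
  have chi0 : B chi chi = 0.
    by rewrite {1}/chi Bl_comb// big1// => k _; rewrite Bchi mulr0.
  have := L0 Pchi (Bpos Pchi chi0); rewrite L_comb// => E'; rewrite -[RHS]E'.
  by apply: eq_bigr => k _; rewrite [l _ _]mxE mulrC.
have [u uG] := submxP lG.
exists (cmb (fun i => u 0 i)); split=> [|v Pv]; first exact: P_comb.
have [y vy] := Pcomb v Pv.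
have Py : P (cmb y) by exact: P_comb.
(* v equals the combination of the [phi] only on E; the difference vanishes there, hence is
   invisible to B and L. *)
have Pd : P (lin (-1) (cmb y) v) by exact: PL.
have d0 x : E x -> lin (-1) (cmb y) v x = 0.
  by move=> Ex; rewrite /lin vy// scaleN1r addNr.
have Pu : P (cmb (fun i => u 0 i)) by exact: P_comb.
have := B0 Pu Pd d0; rewrite Br// mulN1r addrC => /eqP; rewrite subr_eq0 => /eqP ->.
have := L0 Pd d0; rewrite Ll// mulN1r addrC => /eqP; rewrite subr_eq0 => /eqP ->.
rewrite Br_comb// L_comb//; apply: eq_bigr => j _; congr (_ * _).
have /rowP/(_ j) := uG; rewrite !mxE => ->; rewrite Bl_comb//.
by apply: eq_bigr => i _; rewrite mxE.
Qed.

End galerkin.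

Section polynomial_degree.
Context {R : realType}.
Local Notation poly n := (mpoly.mpoly n R).

Definition deg_le n r (p : poly n) := forall m : mpoly.multinom n,
  m \in mpoly.msupp p -> (mpoly.mdeg m <= r)%N.

Lemma deg_leP n r (p : poly n) :
  deg_le r p <-> forall m, (r < mpoly.mdeg m)%N -> mpoly.mcoeff m p = 0.
Proof.
split=> [pr m rm|pr m].
  by apply: mpoly.memN_msupp_eq0; apply: contraL rm => /pr; rewrite -leqNgt.
rewrite mpoly.mcoeff_msupp; apply: contraR; rewrite -ltnNge => /pr ->.
by rewrite eqxx.
Qed.

Lemma deg_leD n r (p q : poly n) : deg_le r p -> deg_le r q -> deg_le r (p + q).
Proof.
by move=> /deg_leP pr /deg_leP qr; apply/deg_leP => m rm; rewrite mpoly.mcoeffD pr ?qr ?addr0.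
Qed.

Lemma deg_leZ n r a (p : poly n) : deg_le r p -> deg_le r (a *: p).
Proof.
by move=> /deg_leP pr; apply/deg_leP => m rm; rewrite mpoly.mcoeffZ pr ?mulr0.
Qed.

Lemma deg_le0 n r : deg_le r (0 : poly n).
Proof. by apply/deg_leP => m _; rewrite mpoly.mcoeff0. Qed.

Lemma deg_le_sum n r (I : Type) (s : seq I) (P : pred I) (p : I -> poly n) :
  (forall i, P i -> deg_le r (p i)) -> deg_le r (\sum_(i <- s | P i) p i).
Proof.
move=> pr; elim/big_ind : _ => //; [exact: deg_le0|exact: deg_leD].
Qed.

Lemma deg_leW n r r' (p : poly n) : (r <= r')%N -> deg_le r p -> deg_le r' p.
Proof. by move=> rr' pr m /pr /leq_trans; apply. Qed.

Lemma deg_le_mderiv n r i (p : poly n) : deg_le r p -> deg_le r.-1 (mpoly.mderiv i p).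
Proof.
move=> /deg_leP pr; apply/deg_leP => m rm.
rewrite mpoly.mcoeff_deriv pr ?mul0rn// mpoly.mdegD mpoly.mdeg1 addn1.
by case: r rm {pr}.
Qed.

Lemma deg_leC n r c : deg_le r (mpoly.mpolyC n c).
Proof.
apply/deg_leP => m rm; rewrite mpoly.mcoeffC.
have [m0|] := eqVneq m mpoly.mnm0; last by rewrite mulr0.
by rewrite m0 mpoly.mdeg0 in rm.
Qed.

Lemma deg_leX n r (i : 'I_n) : (0 < r)%N -> deg_le r (mpoly.mpolyX R (mpoly.mnm1 i)).
Proof.
move=> r0 m; rewrite mpoly.msuppX inE => /eqP ->.
by rewrite mpoly.mdeg1.
Qed.

(** [bmultinom n r.+1] is the finite type of exponents of degree strictly below r + 1, that is, at
    most r. *)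
Lemma deg_le_span n r (p : poly n) : deg_le r p ->
  p = \sum_(m : mpoly.bmultinom n r.+1) mpoly.mcoeff (mpoly.bmnm m) p *: mpoly.mpolyX R (mpoly.bmnm m).
Proof.
move=> pr; apply: mpoly.mpolywE; rewrite mpoly.mmeasureE.
by apply/bigmax_leqP_seq => m /pr.
Qed.

End polynomial_degree.

(** * Rigid motions: vanishing strain, and vanishing on a face *)

Section rigid_motions.
Context {R : realType} (n : nat).
Local Notation poly := (mpoly.mpoly (1 + n) R).
Local Notation rV := 'rV[R]_(1 + n).

Lemma mderiv_com i j (p : poly) :
  mpoly.mderiv i (mpoly.mderiv j p) = mpoly.mderiv j (mpoly.mderiv i p).
Proof.
have [->//|ij] := eqVneq i j; apply/mpoly.mpolyP => m; rewrite !mpoly.mcoeff_deriv.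
rewrite !mpoly.mnmDE !mpoly.mnm1E [j == i]eq_sym (negbTE ij) !addn0 -!mulrnA mulnC.
by rewrite -!mpoly.addmA [mpoly.mnm_add (mpoly.mnm1 i) _]mpoly.addmC.
Qed.

(** The third-order array D a b c is symmetric in its first two indices and skew in its last two;
    going round the permutations of the indices gives D = - D. *)
Lemma mderiv2_eq0 (p : 'I_(1 + n) -> poly) :
  (forall i j, mpoly.mderiv i (p j) + mpoly.mderiv j (p i) = 0) ->
  forall a b c, mpoly.mderiv a (mpoly.mderiv b (p c)) = 0.
Proof.
move=> sp a b c; pose D a b c := mpoly.mderiv a (mpoly.mderiv b (p c)).
have Dsym x y z : D x y z = D y x z by exact: mderiv_com.
have Dskew x y z : D x y z = - D x z y.
  apply/eqP; rewrite -addr_eq0 /D -mpoly.mderivD sp; apply/eqP.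
  exact: raddf0.
have DN : D a b c = - D a b c.
  by rewrite {1}Dskew Dsym Dskew Dsym opprK [in LHS]Dskew Dsym.
have : D a b c *+ 2 = 0 by rewrite mulr2n {1}DN addNr.
rewrite -scaler_nat => /eqP; rewrite scaler_eq0 pnatr_eq0 /=.
by move/eqP.
Qed.

(** The second derivatives vanish, so p is affine, and the hypothesis says that its constant
    gradient S is skew. *)
Lemma rigid_motion_strain0 (p : 'I_(1 + n) -> poly) :
  (forall i j, mpoly.mderiv i (p j) + mpoly.mderiv j (p i) = 0) ->
  rigid_motion (fun x : rV => \row_j pev (p j) x).
Proof.
move=> sp; pose S : 'M[R]_(1 + n) := \matrix_(b, c) mpoly.mcoeff mpoly.mnm0 (mpoly.mderiv b (p c)).
have dE b c : mpoly.mderiv b (p c) = mpoly.mpolyC (1 + n) (S b c).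
  rewrite [S b c]mxE; apply: mpoly_const => a; exact: mderiv2_eq0.
pose q c := p c - \sum_b S b c *: mpoly.mpolyX R (mpoly.mnm1 b).
have qC c : q c = mpoly.mpolyC (1 + n) (mpoly.mcoeff mpoly.mnm0 (q c)).
  apply: mpoly_const => a; rewrite mpoly.mderivB dE.
  rewrite (big_morph _ (mpoly.mderivD a) (mpoly.mderiv0 _ a)).
  rewrite [X in _ - X](bigD1 a)//= big1 => [|b ba].
    have U0 : mpoly.mnm_sub (mpoly.mnm1 a) (mpoly.mnm1 a) = mpoly.mnm0.
      by apply/mpoly.mnmP => k; rewrite mpoly.mnmBE subnn mpoly.mnm0E.
    rewrite addr0 mpoly.mderivZ mpoly.mderivX mpoly.mnm1E eqxx scale1r U0.
    by rewrite mpoly.mpolyX0 -mpoly.mul_mpolyC mulr1 subrr.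
  by rewrite mpoly.mderivZ mpoly.mderivX mpoly.mnm1E (negbTE ba) scale0r scaler0.
have pE c x : pev (p c) x = mpoly.mcoeff mpoly.mnm0 (q c) + \sum_b x 0 b * S b c.
  rewrite -(subrK (\sum_b S b c *: mpoly.mpolyX R (mpoly.mnm1 b)) (p c)) -/(q c) qC pevD pevC.
  rewrite -qC; congr (_ + _); rewrite pev_sum; apply: eq_bigr => b _.
  by rewrite pevZ pevX mulrC.
have skew b c : S b c = - S c b.
  have := sp b c; rewrite !dE => /(congr1 (fun r => pev r 0)).
  rewrite pevD !pevC => h; apply/eqP; rewrite -addr_eq0.
  exact/eqP.
exists (\row_c mpoly.mcoeff mpoly.mnm0 (q c)), S^T; split.
  by apply/matrixP => b c; rewrite trmxK [LHS]skew [RHS]mxE; congr (- _); rewrite [RHS]mxE.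
by move=> x; apply/rowP => c; rewrite trmxK !mxE pE.
Qed.

Lemma affine_eq0 m m' (c : 'rV[R]_m') (A : 'M[R]_(m, m')) (U : set 'rV[R]_m) :
  open U -> U !=set0 -> (forall y, U y -> c + y *m A = 0) -> A = 0.
Proof.
move=> oU [y Uy] cA; apply/row_matrixP => i; rewrite row0.
have : \forall t \near (0 : R), U (y + t *: delta_mx 0 i).
  have cl := @continuous_line R m y (delta_mx 0 i) 0.
  rewrite /continuous_at scale0r addr0 in cl.
  by apply: cl; exact: open_nbhs_nbhs.
move=> /nbhs_ballP[e /= e0 eU].
have te : ball (0 : R) e (e / 2).
  by rewrite -ball_normE/= sub0r normrN gtr0_norm ?divr_gt0// ltr_pdivrMr// ltr_pMr// ltr1n.
have := cA _ (eU _ te); rewrite mulmxDl addrA cA// add0r -scalemxAl -rowE => /eqP.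
by rewrite scaler_eq0 mulf_eq0 (gt_eqF e0) invr_eq0 pnatr_eq0/= => /eqP.
Qed.

Lemma frame_complete (F : 'M[R]_(n, 1 + n)) (nu : rV) :
  F *m F^T = 1%:M -> F *m nu^T = 0 -> mxdot nu nu = 1 ->
  nu^T *m nu + F^T *m F = 1%:M.
Proof.
move=> FF Fn nn; pose Q : 'M[R]_(1 + n) := col_mx nu F.
have nF : nu *m F^T = 0 by rewrite -[LHS]trmxK trmx_mul trmxK Fn trmx0.
have nn' : nu *m nu^T = 1%:M by rewrite [LHS]mx11_scalar -nn /mxdot /mxtrace big_ord1.
have QQ : Q *m Q^T = 1%:M.
  by rewrite tr_col_mx mul_col_row nn' nF Fn FF -scalar_mx_block.
by have := mulmx1C QQ; rewrite /Q tr_col_mx mul_row_col.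
Qed.

Lemma unit_normal_pm (F : 'M[R]_(n, 1 + n)) (nu nu' : rV) :
  F *m F^T = 1%:M -> F *m nu^T = 0 -> mxdot nu nu = 1 ->
  F *m nu'^T = 0 -> mxdot nu' nu' = 1 -> nu' = nu \/ nu' = - nu.
Proof.
move=> FF Fn nn Fn' nn'.
have nF' : nu' *m F^T = 0 by rewrite -[LHS]trmxK trmx_mul trmxK Fn' trmx0.
have nE : nu' = mxdot nu' nu *: nu.
  rewrite -[LHS]mulmx1 -(frame_complete FF Fn nn) mulmxDr !mulmxA nF' mul0mx addr0.
  by rewrite [nu' *m nu^T]mx11_scalar mul_scalar_mx /mxdot /mxtrace big_ord1.
move: nn'; rewrite nE mxdotZl mxdotZr nn mulr1 -expr2 => /eqP.
by rewrite sqrf_eq1 => /orP[] /eqP ->; [left|right]; rewrite ?scale1r ?scaleN1r.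
Qed.

(** The linear part S vanishes on the tangent directions of the face, on both sides by skewness.
    What remains is the single number nu S nu^T, which is 0 because S is skew; so r is constant. *)
Lemma rigid_motion_eq0 (e : flat (R := R) (1 + n)) (nu : rV) (r : rV -> rV) :
  flat_face e -> flat_frame e *m nu^T = 0 -> mxdot nu nu = 1 -> rigid_motion r ->
  (forall x, flat_set e x -> r x = 0) -> forall x, r x = 0.
Proof.
move=> [FF [D0 oD _ _ _]] Fn nn [a [eta [skew rE]]] r0.
set F := flat_frame e in FF Fn.
pose S := eta^T; have ST : S^T = - S by rewrite /S trmxK skew opprK.
have FS : F *m S = 0.
  apply: (@affine_eq0 _ _ (a + flat_base e *m S) _ _ oD D0) => y Dy.
  rewrite mulmxA -addrA -mulmxDl -rE; apply: r0; exact: imageP.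
have SF : S *m F^T = 0.
  by apply: (can_inj (@trmxK _ _ _)); rewrite trmx_mul trmxK ST mulmxN FS oppr0 trmx0.
have E := frame_complete FF Fn nn.
have SE1 : S = nu^T *m nu *m S.
  by rewrite -[LHS]mul1mx -E mulmxDl -[F^T *m F *m S]mulmxA FS mulmx0 addr0.
have SE2 : S = S *m nu^T *m nu.
  by rewrite -[LHS]mulmx1 -E mulmxDr !mulmxA SF mul0mx addr0.
have nSn : nu *m S *m nu^T = 0.
  set w := _ *m nu^T.
  have wN : w^T = - w by rewrite /w !trmx_mul trmxK ST mulNmx mulmxN mulmxA.
  have wT : w^T = w by rewrite [w]mx11_scalar tr_scalar_mx.
  have : 2%:R *: w = 0 by rewrite scaler_nat mulr2n -{1}wT wN addNr.
  by move=> /eqP; rewrite scaler_eq0 pnatr_eq0/= => /eqP.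
have S0 : S = 0.
  by rewrite SE1 SE2 !mulmxA -[nu^T *m nu *m S]mulmxA -[nu^T *m _ *m nu^T]mulmxA nSn mulmx0 mul0mx.
have a0 : a = 0.
  have [y Dy] := D0; have := r0 _ (imageP (chart e) Dy).
  by rewrite rE -/S S0 mulmx0 addr0.
by move=> x; rewrite rE -/S S0 mulmx0 a0 addr0.
Qed.

End rigid_motions.

Section polynomials_on_sets.
Context {R : realType} (d : nat).
Implicit Types (D : set 'rV[R]_d) (f g : 'rV[R]_d -> R).

(** No degree bound: degrees matter for membership in the discrete spaces, whereas linearity and
    positivity of integrals need only a class stable under products. *)
Definition is_pol D f := exists p : mpoly.mpoly d R, forall x, D x -> f x = pev p x.

Lemma is_pol_pev D p : is_pol D (pev p). Proof. by exists p. Qed.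

Lemma is_pol_eq D f g : (forall x, D x -> f x = g x) -> is_pol D f -> is_pol D g.
Proof. by move=> fg [p fp]; exists p => x Dx; rewrite -fg// fp. Qed.

Lemma is_polS D D' f : D' `<=` D -> is_pol D f -> is_pol D' f.
Proof. by move=> DD' [p fp]; exists p => x /DD'/fp. Qed.

Lemma is_polC D c : is_pol D (fun=> c).
Proof. by exists (mpoly.mpolyC d c) => x _; rewrite pevC. Qed.

Lemma is_polD D f g : is_pol D f -> is_pol D g -> is_pol D (fun x => f x + g x).
Proof. by move=> [p fp] [q gq]; exists (p + q) => x Dx; rewrite pevD fp ?gq. Qed.

Lemma is_polM D f g : is_pol D f -> is_pol D g -> is_pol D (fun x => f x * g x).
Proof. by move=> [p fp] [q gq]; exists (p * q) => x Dx; rewrite pevM fp ?gq. Qed.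

Lemma is_polZ D a f : is_pol D f -> is_pol D (fun x => a * f x).
Proof. by move=> fp; apply: is_polM fp; exact: is_polC. Qed.

Lemma is_pol_sum D (I : Type) (s : seq I) (P : pred I) (f : I -> 'rV[R]_d -> R) :
  (forall i, P i -> is_pol D (f i)) -> is_pol D (fun x => \sum_(i <- s | P i) f i x).
Proof.
move=> fp; elim: s => [|i s ih].
  by apply: is_pol_eq (is_polC D 0) => x _; rewrite big_nil.
case Pi : (P i); last by apply: is_pol_eq ih => x _; rewrite big_cons Pi.
by apply: is_pol_eq (is_polD (fp i Pi) ih) => x _; rewrite big_cons Pi.
Qed.

Lemma poly_on_is_pol r D f : poly_on r D f -> is_pol D f.
Proof. by move=> [p [_ fp]]; exists p. Qed.

Definition mx_pol m n D (F : 'rV[R]_d -> 'M[R]_(m, n)) :=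
  forall i j, is_pol D (fun x => F x i j).

Lemma mxpoly_on_mx_pol m n r D (F : 'rV[R]_d -> 'M[R]_(m, n)) : mxpoly_on r D F -> mx_pol D F.
Proof. by move=> FP i j; exact: poly_on_is_pol (FP i j). Qed.

Lemma mx_polS m n D D' (F : 'rV[R]_d -> 'M[R]_(m, n)) : D' `<=` D -> mx_pol D F -> mx_pol D' F.
Proof. by move=> DD' FP i j; exact: is_polS (FP i j). Qed.

Lemma mx_pol_lin m n D a (F G : 'rV[R]_d -> 'M[R]_(m, n)) :
  mx_pol D F -> mx_pol D G -> mx_pol D (fun x => a *: F x + G x).
Proof.
move=> FP GP i j; apply: is_pol_eq (is_polD (is_polZ a (FP i j)) (GP i j)) => x _.
by rewrite !mxE.
Qed.

Lemma is_pol_mxdot m n D (F G : 'rV[R]_d -> 'M[R]_(m, n)) :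
  mx_pol D F -> mx_pol D G -> is_pol D (fun x => mxdot (F x) (G x)).
Proof.
move=> FP GP; apply: (@is_pol_eq _ (fun x => \sum_i \sum_j F x i j * G x i j)).
  by move=> x _; rewrite mxdotE.
by do 2 (apply: is_pol_sum => ? _); exact: is_polM.
Qed.

Lemma mxdot_ge0 m n (A : 'M[R]_(m, n)) : 0 <= mxdot A A.
Proof. by rewrite mxdotE; do 2 (apply: sumr_ge0 => ? _); rewrite -expr2 sqr_ge0. Qed.

Lemma mxdot_eq0 m n (A : 'M[R]_(m, n)) : mxdot A A = 0 -> A = 0.
Proof.
rewrite mxdotE => /eqP; rewrite psumr_eq0; last first.
  by move=> i _; apply: sumr_ge0 => j _; rewrite -expr2 sqr_ge0.
move=> /allP h; apply/matrixP => i j; have /implyP/(_ isT) := h i (mem_index_enum i).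
rewrite psumr_eq0; last by move=> k _; rewrite -expr2 sqr_ge0.
by move=> /allP/(_ j (mem_index_enum j))/=; rewrite -expr2 sqrf_eq0 mxE => /eqP.
Qed.

(* The integrals over a cell and over a face, as functionals on the functions
   that are polynomial on [D]. *)
Definition poly_integral D (J : ('rV[R]_d -> R) -> R) := [/\
  forall f g, (forall x, D x -> f x = g x) -> J f = J g,
  forall a p q, J (pev (a *: p + q)) = a * J (pev p) + J (pev q) &
  forall p, (forall x, D x -> 0 <= pev p x) -> 0 <= J (pev p) /\
    (J (pev p) = 0 -> forall x, D x -> pev p x = 0)].

Section poly_integral.
Variables (D : set 'rV[R]_d) (J : ('rV[R]_d -> R) -> R).
Hypothesis JP : poly_integral D J.

Lemma poly_integral_eq f g : (forall x, D x -> f x = g x) -> J f = J g.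
Proof. by case: JP => + _ _; apply. Qed.

Lemma poly_integral_lin a f g : is_pol D f -> is_pol D g ->
  J (fun x => a * f x + g x) = a * J f + J g.
Proof.
case: JP => Jeq Jlin _ [p fp] [q gq].
rewrite (Jeq _ _ fp) (Jeq _ _ gq) -Jlin; apply: Jeq => x Dx.
by rewrite pevD pevZ fp ?gq.
Qed.

Lemma poly_integral0 f : (forall x, D x -> f x = 0) -> J f = 0.
Proof.
move=> f0; have := poly_integral_lin 1 (is_polC D 0) (is_polC D 0).
rewrite (@poly_integral_eq _ (fun=> 0)); last by move=> x _; rewrite mulr0 addr0.
rewrite mul1r => /eqP; rewrite -subr_eq0 opprD addrA subrr sub0r oppr_eq0 => /eqP E.
by rewrite -[RHS]E; exact: poly_integral_eq.
Qed.

Lemma poly_integral_sum (I : Type) (s : seq I) (P : pred I) (f : I -> 'rV[R]_d -> R) :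
  (forall i, P i -> is_pol D (f i)) ->
  J (fun x => \sum_(i <- s | P i) f i x) = \sum_(i <- s | P i) J (f i).
Proof.
move=> fp; elim: s => [|i s ih].
  by rewrite big_nil; apply: poly_integral0 => x _; rewrite big_nil.
rewrite big_cons -ih; case Pi : (P i); last first.
  by apply: poly_integral_eq => x _; rewrite big_cons Pi.
rewrite -[J (f i)]mul1r -poly_integral_lin; [|exact: fp|exact: is_pol_sum].
by apply: poly_integral_eq => x _; rewrite big_cons Pi mul1r.
Qed.

Lemma poly_integral_mxdotl m n a (F G H : 'rV[R]_d -> 'M[R]_(m, n)) :
  mx_pol D F -> mx_pol D G -> mx_pol D H ->
  J (fun x => mxdot (a *: F x + G x) (H x)) =
  a * J (fun x => mxdot (F x) (H x)) + J (fun x => mxdot (G x) (H x)).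
Proof.
move=> FP GP HP; rewrite -poly_integral_lin; [|exact: is_pol_mxdot..].
by apply: poly_integral_eq => x _; rewrite mxdotDl mxdotZl.
Qed.

Lemma poly_integral_mxdotr m n a (F G H : 'rV[R]_d -> 'M[R]_(m, n)) :
  mx_pol D F -> mx_pol D G -> mx_pol D H ->
  J (fun x => mxdot (H x) (a *: F x + G x)) =
  a * J (fun x => mxdot (H x) (F x)) + J (fun x => mxdot (H x) (G x)).
Proof.
move=> FP GP HP; rewrite -poly_integral_lin; [|exact: is_pol_mxdot..].
by apply: poly_integral_eq => x _; rewrite mxdotDr mxdotZr.
Qed.

Lemma poly_integral_sqr m n (F : 'rV[R]_d -> 'M[R]_(m, n)) : mx_pol D F ->
  0 <= J (fun x => mxdot (F x) (F x)) /\
  (J (fun x => mxdot (F x) (F x)) = 0 -> forall x, D x -> F x = 0).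
Proof.
case: JP => Jeq _ Jpos FP; have [p Fp] := is_pol_mxdot FP FP.
rewrite (Jeq _ _ Fp); have [|J0 J0'] := Jpos p.
  by move=> x Dx; rewrite -Fp// mxdot_ge0.
by split => // /J0' p0 x Dx; apply: mxdot_eq0; rewrite Fp// p0.
Qed.

End poly_integral.
End polynomials_on_sets.

Section mesh_integrals.
Context {R : realType}.
Local Notation lam := (@lebesgue_rV R).

(** The part of U where f is nonzero is open and null, while a nonempty open set has positive
    measure. This makes the L^2 products definite on polynomials. *)
Lemma Rintegral_eq0 n (U : set 'rV[R]_n) (f : 'rV[R]_n -> R) : open U -> continuous f ->
  (lam n).-integrable U (EFin \o f) -> (forall x, U x -> 0 <= f x) ->
  \int[lam n]_(x in U) f x = 0 -> forall x, U x -> f x = 0.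
Proof.
move=> oU cf fi f0 If0 x Ux; apply/eqP/negPn/negP => fx.
have mU : measurable U by exact: open_measurable_rV.
have : (\int[lam n]_(x in U) `|(EFin \o f) x| = 0)%E.
  rewrite -[RHS]/(0%:E) -If0 EFin_Rintegral//; apply: eq_integral => y.
  by rewrite inE => Uy; rewrite /= ger0_norm// f0.
have mf : measurable_fun U (EFin \o f) by exact: measurable_int fi.
move=> /(ae_eq_integral_abs _ mU mf)[N [mN N0 UN]].
pose V := U `&` [set y | f y != 0].
have oV : open V.
  apply: openI => //; rewrite (_ : [set _ | _] = f @^-1` [set z | z != 0])//.
  by apply: open_comp => [z _|]; [exact: cf|exact: open_neq].
have VN : V `<=` N.
  move=> y [Uy fy]; apply: UN => /= /(_ Uy)/= [] /eqP; exact/negP.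
have : (lam n V <= lam n N)%E.
  by apply: le_measure; rewrite ?inE//; exact: open_measurable_rV.
have V0 : (0 < lam n V)%E by apply: lebesgue_rV_open_gt0 => //; exists x.
by rewrite N0 => /(lt_le_trans V0); rewrite ltxx.
Qed.

Lemma eq_int_flat d (e : flat d) (f g : 'rV[R]_d -> R) :
  (forall x, flat_set e x -> f x = g x) -> int_flat e f = int_flat e g.
Proof.
move=> fg; apply: eq_Rintegral => y; rewrite inE => Dy; apply: fg.
by exists y.
Qed.

Lemma continuous_chart d (e : flat d (R := R)) : continuous (chart e).
Proof. exact: continuous_affine. Qed.

Lemma poly_integral_flat d (e : flat d) : flat_face e ->
  poly_integral (flat_set e) (int_flat (R := R) e).
Proof.
move=> fe; have ip q := integrable_chart q fe.
have oD : open (flat_dom e) by case: fe.2.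
have mD : measurable (flat_dom e) by exact: open_measurable_rV.
split=> [|a p q|p p0]; first exact: eq_int_flat.
  pose a2 (i : 'I_2) := if i == ord0 then a else 1; pose p2 (i : 'I_2) := if i == ord0 then p else q.
  have := int_flat_sum a2 p2 fe; rewrite !big_ord_recl !big_ord0 !addr0/= mul1r => <-.
  by rewrite scale1r.
split=> [|I0 _ [y Dy <-]].
  by apply: Rintegral_ge0 => y Dy; apply: p0; exists y.
apply: (@Rintegral_eq0 _ _ (fun y => pev p (chart e y)) oD _ (ip p)) => //.
  move=> z; apply: continuous_comp; [exact: continuous_chart|exact: continuous_pev].
by move=> z Dz; apply: p0; exists z.
Qed.

Lemma poly_integral_cell d (D : set 'rV[R]_d) : polyhedral D ->
  poly_integral D (fun f => \int[lam d]_(x in D) f x).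
Proof.
move=> pD; have oD : open D by case: pD.
have mD : measurable D by exact: open_measurable_rV.
have bD : coord_bounded D.
  by have [K DK] := polyhedral_bounded pD; exists K => x Dx; apply: DK; exact: subset_closure.
have ip q := integrable_pev q mD bD.
split=> [f g fg|a p q|p p0].
- by apply: eq_Rintegral => y; rewrite inE => Dy; exact: fg.
- pose a2 (i : 'I_2) := if i == ord0 then a else 1; pose p2 (i : 'I_2) := if i == ord0 then p else q.
  have := Rintegral_pev_sum a2 p2 mD bD; rewrite !big_ord_recl !big_ord0 !addr0/= mul1r => <-.
  by rewrite scale1r.
- split=> [|I0 x Dx]; first exact: Rintegral_ge0.
  exact: (Rintegral_eq0 oD (@continuous_pev _ _ p) (ip p) p0 I0 Dx).
Qed.

(** Integrals control a function on the open cell only; being a polynomial on the closure, it is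
    then controlled on the closed cell, where functions are compared. *)
Lemma is_pol_closure0 d (D : set 'rV[R]_d) (f : 'rV[R]_d -> R) : open D -> D !=set0 ->
  is_pol (closure D) f -> (forall x, D x -> f x = 0) -> forall x, closure D x -> f x = 0.
Proof.
move=> oD D0 [p fp] f0 x Dx; rewrite fp//.
have -> : p = 0.
  apply: (pev_eq0 oD D0) => y Dy; rewrite -fp; [exact: f0|exact: subset_closure].
exact: pev0.
Qed.

Lemma mx_pol_closure0 d m n (D : set 'rV[R]_d) (F : 'rV[R]_d -> 'M[R]_(m, n)) :
  open D -> D !=set0 -> mx_pol (closure D) F ->
  (forall x, D x -> F x = 0) -> forall x, closure D x -> F x = 0.
Proof.
move=> oD D0 FP F0 x Dx; apply/matrixP => i j; rewrite mxE.
by apply: (is_pol_closure0 oD D0 (FP i j)) => // y Dy; rewrite F0// mxE.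
Qed.

End mesh_integrals.

(** * Riesz representation in spaces of polynomials *)

Section projections.
Context {R : realType} (d : nat).

Lemma poly_on_lin r (D : set 'rV[R]_d) a f g : poly_on r D f -> poly_on r D g ->
  poly_on r D (fun x => a * f x + g x).
Proof.
move=> [p [pr fp]] [q [qr gq]]; exists (a *: p + q); split.
  exact/deg_leD/qr/deg_leZ/pr.
by move=> x Dx; rewrite fp// gq// -[RHS]/(pev (a *: p + q) x) pevD pevZ.
Qed.

Lemma poly_on0 r (D : set 'rV[R]_d) : poly_on r D (fun=> 0).
Proof.
exists 0; split; first exact: deg_le0.
by move=> x _; rewrite -[RHS]/(pev 0 x) pev0.
Qed.

Lemma mxpoly_on_lin m n r (D : set 'rV[R]_d) a (F G : 'rV[R]_d -> 'M[R]_(m, n)) :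
  mxpoly_on r D F -> mxpoly_on r D G -> mxpoly_on r D (fun x => a *: F x + G x).
Proof.
move=> FP GP i j; have [p [pr Fp]] := poly_on_lin a (FP i j) (GP i j).
by exists p; split => // x Dx; rewrite -Fp// !mxE.
Qed.

Lemma mxpoly_on0 m n r (D : set 'rV[R]_d) : mxpoly_on r D (fun=> 0 : 'M[R]_(m, n)).
Proof.
by move=> i j; have [p [pr p0]] := poly_on0 r D; exists p; split => // x Dx; rewrite -p0// mxE.
Qed.

Lemma mxpoly_span m n r (D : set 'rV[R]_d) (F : 'rV[R]_d -> 'M[R]_(m, n)) :
  mxpoly_on r D F -> exists c : 'I_m * 'I_n * mpoly.bmultinom d r.+1 -> R,
    forall x, D x -> F x = \sum_i c i *:
      (pev (mpoly.mpolyX R (mpoly.bmnm i.2)) x *: delta_mx i.1.1 i.1.2).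
Proof.
move=> FP; have /choice[p pP] (ij : 'I_m * 'I_n) := FP ij.1 ij.2.
exists (fun i => mpoly.mcoeff (mpoly.bmnm i.2) (p i.1)) => x Dx.
rewrite [LHS]matrix_sum_delta pair_big/= -(pair_big xpredT xpredT
  (fun (ij : 'I_m * 'I_n) (b : mpoly.bmultinom d r.+1) =>
     mpoly.mcoeff (mpoly.bmnm b) (p ij) *:
      (pev (mpoly.mpolyX R (mpoly.bmnm b)) x *: delta_mx ij.1 ij.2)))/=.
apply: eq_bigr => -[i j] _ /=; have [pr Fp] := pP (i, j).
rewrite Fp// -[mpoly.meval _ _]/(pev (p (i, j)) x) [in LHS](deg_le_span pr) pev_sum scaler_suml.
by apply: eq_bigr => b _; rewrite pevZ scalerA.
Qed.

(** D is what the integral J sees and E where functions are compared: an open cell and its closure,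
    or twice the same face. P may be a proper subspace of the polynomials of degree at most r, as
    for V_(k-1)(e). *)
Variables (m n r : nat) (D E : set 'rV[R]_d) (J : ('rV[R]_d -> R) -> R).
Local Notation fT := ('rV[R]_d -> 'M[R]_(m, n)).
Variables (P : set fT) (L : fT -> R).
Hypotheses (JP : poly_integral D J) (DE : D `<=` E)
  (PE : forall F, P F -> mxpoly_on r E F) (P0 : P (fun=> 0))
  (PL : forall a F G, P F -> P G -> P (fun x => a *: F x + G x))
  (PD : forall F, P F -> (forall x, D x -> F x = 0) -> forall x, E x -> F x = 0)
  (Ll : forall a F G, P F -> P G -> L (fun x => a *: F x + G x) = a * L F + L G)
  (L0 : forall F, P F -> (forall x, E x -> F x = 0) -> L F = 0).

Let B (F G : fT) := J (fun x => mxdot (F x) (G x)).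

Let PP F : P F -> mx_pol D F.
Proof. by move=> /PE/mxpoly_on_mx_pol; exact: mx_polS. Qed.

Let Bl a F G H : P F -> P G -> P H -> B (fun x => a *: F x + G x) H = a * B F H + B G H.
Proof. by move=> PF PG PH; apply: (poly_integral_mxdotl JP); exact: PP. Qed.

Let Br a F G H : P F -> P G -> P H -> B H (fun x => a *: F x + G x) = a * B H F + B H G.
Proof. by move=> PF PG PH; apply: (poly_integral_mxdotr JP); exact: PP. Qed.

Let Bpos F : P F -> B F F = 0 -> forall x, E x -> F x = 0.
Proof.
by move=> PF /(poly_integral_sqr JP (PP PF)).2; exact: PD.
Qed.

Let B0 F G : P F -> P G -> (forall x, E x -> G x = 0) -> B F G = 0.
Proof.
move=> PF PG G0; apply: (poly_integral0 JP) => x /DE Ex.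
by rewrite G0// mxdot0r.
Qed.

Lemma projection_exists : exists u, P u /\ forall v, P v -> J (fun x => mxdot (u x) (v x)) = L v.
Proof.
exact: (galerkin_exists P0 PL (fun F PF => mxpoly_span (PE PF)) Bl Br Ll Bpos B0 L0).
Qed.

Lemma projection_unique u u' : P u -> P u' ->
  (forall v, P v -> J (fun x => mxdot (u x) (v x)) = L v) ->
  (forall v, P v -> J (fun x => mxdot (u' x) (v x)) = L v) ->
  forall x, E x -> u x = u' x.
Proof. exact: (galerkin_unique PL Bl Bpos). Qed.

End projections.

Section derivatives.
Context {R : realType} (d : nat).
Implicit Types (D : set 'rV[R]_d).

Lemma partial_pol D f p i x : open D -> D x -> (forall y, D y -> f y = pev p y) ->
  partial i f x = pev (mpoly.mderiv i p) x.
Proof.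
move=> oD Dx fp; rewrite -partial_pev /partial; apply: near_eq_derive.
by near=> y; apply: fp; near: y; exact: open_nbhs_nbhs.
Unshelve. all: by end_near. Qed.

Lemma is_pol_partial D f i : open D -> is_pol D f -> is_pol D (partial i f).
Proof.
by move=> oD [p fp]; exists (mpoly.mderiv i p) => x Dx; exact: partial_pol fp.
Qed.

Lemma partial_lin D a f g i x : open D -> is_pol D f -> is_pol D g -> D x ->
  partial i (fun y => a * f y + g y) x = a * partial i f x + partial i g x.
Proof.
move=> oD [p fp] [q gq] Dx.
rewrite (partial_pol i oD Dx fp) (partial_pol i oD Dx gq) -pevZ -pevD -mpoly.mderivZ -mpoly.mderivD.
by apply: (partial_pol i oD Dx) => y Dy; rewrite pevD pevZ fp ?gq.
Qed.

Lemma partial_eq0 D f i x : open D -> D x -> (forall y, D y -> f y = 0) -> partial i f x = 0.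
Proof.
move=> oD Dx f0; rewrite (partial_pol (p := 0) i oD Dx); last first.
  by move=> y Dy; rewrite f0// pev0.
by rewrite mpoly.mderiv0 pev0.
Qed.

Lemma mx_pol_row_div D (F : 'rV[R]_d -> 'M[R]_d) : open D -> mx_pol D F -> mx_pol D (row_div F).
Proof.
move=> oD FP i j; apply: (@is_pol_eq _ _ _ (fun x => \sum_k partial k (fun y => F y j k) x)).
  by move=> x _; rewrite mxE.
by apply: is_pol_sum => k _; exact: is_pol_partial (FP j k).
Qed.

Lemma row_div_lin D a (F G : 'rV[R]_d -> 'M[R]_d) x : open D -> mx_pol D F -> mx_pol D G -> D x ->
  row_div (fun y => a *: F y + G y) x = a *: row_div F x + row_div G x.
Proof.
move=> oD FP GP Dx; apply/rowP => i; rewrite !mxE mulr_sumr -big_split/=.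
apply: eq_bigr => j _; rewrite -(partial_lin a j oD (FP i j) (GP i j) Dx).
by congr (partial _ _ _); apply/funext => y; rewrite !mxE.
Qed.

Lemma row_div_eq0 D (F : 'rV[R]_d -> 'M[R]_d) x : open D -> D x ->
  (forall y, D y -> F y = 0) -> row_div F x = 0.
Proof.
move=> oD Dx F0; apply/rowP => i; rewrite !mxE big1// => j _.
by apply: (partial_eq0 _ oD Dx) => y Dy; rewrite F0// mxE.
Qed.

Lemma mx_pol_grad D f : open D -> is_pol D f -> mx_pol D (grad f).
Proof.
move=> oD fp i j; apply: (@is_pol_eq _ _ _ (partial j f)); last exact: is_pol_partial.
by move=> x _; rewrite mxE.
Qed.

Lemma grad_lin D a f g x : open D -> is_pol D f -> is_pol D g -> D x ->
  grad (fun y => a * f y + g y) x = a *: grad f x + grad g x.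
Proof.
by move=> oD fp gp Dx; apply/rowP => i; rewrite !mxE; exact: partial_lin Dx.
Qed.

Lemma grad_eq0 D f x : open D -> D x -> (forall y, D y -> f y = 0) -> grad f x = 0.
Proof.
by move=> oD Dx f0; apply/rowP => i; rewrite !mxE; exact: partial_eq0 f0.
Qed.

End derivatives.

(** * Weak differential operators *)

Section weak_operators.
Context {R : realType} {n : nat} {M : mesh (R := R) (1 + n)} (k : nat).
Hypotheses (pC : forall T : elem M, polyhedral (cell T))
  (fF : forall e : face M, flat_face (facet e)) (k_gt0 : (0 < k)%N).
Local Notation rV := 'rV[R]_(1 + n).
Implicit Types (T : elem M) (e : face M) (v w : wfun (M := M)).

Lemma face_normal T e : faces T e ->
  outward_normal (cell T) (facet e) (normal (cell T) (facet e)).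
Proof. by move=> /asboolP[nu Hnu]; exact: (xgetPex 0 (ex_intro _ nu Hnu)). Qed.

Lemma open_cell T : open (cell T). Proof. by case: (pC T). Qed.

Lemma cell_neq0 T : cell T !=set0. Proof. by case: (pC T). Qed.

Lemma flat_set_closure T e : faces T e -> flat_set (facet e) `<=` closure (cell T).
Proof. by move=> Te x ex; have [] := face_bd (@open_cell T) (face_normal Te) ex. Qed.

Lemma poly_int_cell T : poly_integral (cell T) (int_cell T).
Proof. exact: poly_integral_cell (pC T). Qed.

Lemma poly_int_flat e : poly_integral (flat_set (facet e)) (int_flat (facet e)).
Proof. exact: poly_integral_flat. Qed.

Lemma int_bd_lin T a (g h : face M -> rV -> R) :
  (forall e, faces T e -> is_pol (flat_set (facet e)) (g e)) ->
  (forall e, faces T e -> is_pol (flat_set (facet e)) (h e)) ->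
  int_bd T (fun e x => a * g e x + h e x) = a * int_bd T g + int_bd T h.
Proof.
move=> gp hp; rewrite /int_bd mulr_sumr -big_split/=; apply: eq_bigr => e Te.
by rewrite (poly_integral_lin (poly_int_flat e) a (gp e Te) (hp e Te)).
Qed.

Lemma eq_int_bd T (g h : face M -> rV -> R) :
  (forall e, faces T e -> forall x, flat_set (facet e) x -> g e x = h e x) ->
  int_bd T g = int_bd T h.
Proof. by move=> gh; apply: eq_bigr => e Te; apply: eq_int_flat; exact: gh. Qed.

Lemma int_bd0 T (g : face M -> rV -> R) :
  (forall e, faces T e -> forall x, flat_set (facet e) x -> g e x = 0) -> int_bd T g = 0.
Proof.
move=> g0; rewrite /int_bd big1// => e Te.
by apply: (poly_integral0 (poly_int_flat e)); exact: g0.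
Qed.

Lemma rigid_motion_lin a (r s : rV -> rV) : rigid_motion r -> rigid_motion s ->
  rigid_motion (fun x => a *: r x + s x).
Proof.
move=> [b [eta [sk rE]]] [c [zeta [sk' sE]]]; exists (a *: b + c), (a *: eta + zeta); split.
  by rewrite linearP/= sk sk' opprD scalerN.
move=> x; rewrite rE sE linearP/= mulmxDr -scalemxAr scalerDr addrACA.
by [].
Qed.

Lemma rigid_motion0 : rigid_motion (fun=> 0 : rV).
Proof. by exists 0, 0; split=> [|x]; rewrite trmx0 ?oppr0// mulmx0 addr0. Qed.

Lemma rigid_motion_poly D (r : rV -> rV) : rigid_motion r -> mxpoly_on 1 D r.
Proof.
move=> [a [eta [_ rE]]] i j; rewrite [i]ord1 {i}.
exists (mpoly.mpolyC (1 + n) (a 0 j) + \sum_l eta^T l j *: mpoly.mpolyX R (mpoly.mnm1 l)).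
split; first by apply: deg_leD; [exact: deg_leC|apply: deg_le_sum => l _; exact/deg_leZ/deg_leX].
move=> x _; rewrite rE -[RHS]/(pev (_ + _) x) pevD pevC pev_sum !mxE; congr (_ + _).
by apply: eq_bigr => l _; rewrite pevZ pevX mxE mulrC.
Qed.

Lemma mxpoly_onW m m' r r' D (F : rV -> 'M[R]_(m, m')) : (r <= r')%N ->
  mxpoly_on r D F -> mxpoly_on r' D F.
Proof. by move=> rr' FP i j; have [p [pr Fp]] := FP i j; exists p; split => //; exact: deg_leW pr. Qed.

(** The two summands have degrees k - 1 and 1, both at most k since 0 < k. So the face space, which
    has no uniform description by degree, sits inside a space with a monomial basis. *)
Lemma face_space_poly e q : face_space k e q -> mxpoly_on k (flat_set (facet e)) q.
Proof.
move=> [p [r [pp rr qE]]] i j.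
have pp' := mxpoly_onW (leq_pred k) pp.
have rp' := mxpoly_onW k_gt0 (rigid_motion_poly (flat_set (facet e)) rr).
have [s [sk sE]] := mxpoly_on_lin 1 pp' rp' i j.
by exists s; split => // x Dx; rewrite -sE// scale1r qE.
Qed.

Lemma face_space_lin e a p q : face_space k e p -> face_space k e q ->
  face_space k e (fun x => a *: p x + q x).
Proof.
move=> [p1 [r1 [pp1 rr1 pE]]] [p2 [r2 [pp2 rr2 qE]]].
exists (fun x => a *: p1 x + p2 x), (fun x => a *: r1 x + r2 x); split.
- exact: mxpoly_on_lin.
- exact: rigid_motion_lin.
- by move=> x Dx; rewrite pE// qE// scalerDr addrACA.
Qed.

Lemma poly_face_space e p : mxpoly_on k.-1 (flat_set (facet e)) p -> face_space k e p.
Proof.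
by exists p, (fun=> 0); split => // [|x _]; [exact: rigid_motion0|rewrite addr0].
Qed.

Lemma rigid_face_space e r : rigid_motion r -> face_space k e r.
Proof.
by exists (fun=> 0), r; split => // [|x _]; [exact: mxpoly_on0|rewrite add0r].
Qed.

Lemma face_space0 e : face_space k e (fun=> 0).
Proof. exact/poly_face_space/mxpoly_on0. Qed.

Lemma face_space_pol e q : face_space k e q -> mx_pol (flat_set (facet e)) q.
Proof. by move/face_space_poly/mxpoly_on_mx_pol. Qed.

Definition vlin a v w : wfun (M := M) :=
  WFun (fun T x => a *: wint v T x + wint w T x) (fun e x => a *: wbd v e x + wbd w e x).

Lemma Vh_lin a v w : Vh k v -> Vh k w -> Vh k (vlin a v w).
Proof.
move=> [v0 vb] [w0 wb]; split=> [T|e]; first exact: mxpoly_on_lin.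
exact: face_space_lin.
Qed.

Definition vanishes v := (forall T x, closure (cell T) x -> wint v T x = 0) /\
  (forall e x, flat_set (facet e) x -> wbd v e x = 0).

Lemma Vh_int v T : Vh k v -> mx_pol (closure (cell T)) (wint v T).
Proof. by case=> v0 _; exact: mxpoly_on_mx_pol (v0 T). Qed.

Lemma Vh_int_cell v T : Vh k v -> mx_pol (cell T) (wint v T).
Proof. by move=> Vv; apply: mx_polS (Vh_int T Vv); exact: subset_closure. Qed.

Lemma Vh_bd v e : Vh k v -> mx_pol (flat_set (facet e)) (wbd v e).
Proof. by case=> _ vb; exact: face_space_pol (vb e). Qed.

Lemma Vh_int_flat v T e : Vh k v -> faces T e -> mx_pol (flat_set (facet e)) (wint v T).
Proof. by move=> Vv Te; apply: mx_polS (Vh_int T Vv); exact: flat_set_closure. Qed.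

Lemma mx_pol_mulT m p q D (c : 'M[R]_(m, p)) (F : rV -> 'M[R]_(q, p)) :
  mx_pol D F -> mx_pol D (fun x => c *m (F x)^T).
Proof.
move=> FP i j; apply: (@is_pol_eq _ _ _ (fun x => \sum_l c i l * F x j l)).
  by move=> x _; rewrite mxE; apply: eq_bigr => l _; rewrite mxE.
by apply: is_pol_sum => l _; exact: is_polZ.
Qed.

(** The linear functional of phi that the weak gradient represents. *)
Definition grad_form v T (phi : rV -> 'M[R]_(1 + n)) : R :=
  - int_cell T (fun x => mxdot (wint v T x) (row_div phi x)) +
  int_bd T (fun e x => mxdot (wbd v e x) (normal (cell T) (facet e) *m (phi x)^T)).

Let gradP T : set (rV -> 'M[R]_(1 + n)) := mxpoly_on k.-1 (closure (cell T)).

Let gradP_cell T phi : gradP T phi -> mx_pol (cell T) phi.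
Proof. by move/mxpoly_on_mx_pol; apply: mx_polS; exact: subset_closure. Qed.

Let gradP_flat T e phi : faces T e -> gradP T phi -> mx_pol (flat_set (facet e)) phi.
Proof. by move=> Te /mxpoly_on_mx_pol; apply: mx_polS; exact: flat_set_closure. Qed.

Lemma grad_form_linr v T a phi psi : Vh k v -> gradP T phi -> gradP T psi ->
  grad_form v T (fun x => a *: phi x + psi x) = a * grad_form v T phi + grad_form v T psi.
Proof.
move=> Vv phiP psiP; rewrite /grad_form.
have cphi := gradP_cell phiP; have cpsi := gradP_cell psiP; have oT := (@open_cell T).
rewrite (poly_integral_eq (poly_int_cell T)
  (g := fun x => mxdot (wint v T x) (a *: row_div phi x + row_div psi x))); last first.
  by move=> x Tx; rewrite (row_div_lin a oT cphi cpsi Tx).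
rewrite (poly_integral_mxdotr (poly_int_cell T)); [|exact: mx_pol_row_div..|exact: Vh_int_cell].
rewrite (@eq_int_bd _ _ (fun e x =>
  a * mxdot (wbd v e x) (normal (cell T) (facet e) *m (phi x)^T) +
  mxdot (wbd v e x) (normal (cell T) (facet e) *m (psi x)^T))); last first.
  by move=> e Te x ex; rewrite linearP/= mulmxDr -scalemxAr mxdotDr mxdotZr.
rewrite int_bd_lin; first by rewrite opprD addrACA mulrDr mulrN.
  by move=> e Te; apply: is_pol_mxdot; [exact: Vh_bd|apply: mx_pol_mulT; exact: gradP_flat phiP].
by move=> e Te; apply: is_pol_mxdot; [exact: Vh_bd|apply: mx_pol_mulT; exact: gradP_flat psiP].
Qed.

Lemma grad_form0r v T phi : gradP T phi ->
  (forall x, closure (cell T) x -> phi x = 0) -> grad_form v T phi = 0.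
Proof.
move=> phiP phi0; rewrite /grad_form (poly_integral0 (poly_int_cell T)); last first.
  move=> x Tx; rewrite (row_div_eq0 (@open_cell T) Tx) ?mxdot0r// => y Ty.
  by apply: phi0; exact: subset_closure.
rewrite int_bd0 ?oppr0 ?addr0// => e Te x ex.
by rewrite phi0 ?trmx0 ?mulmx0 ?mxdot0r//; exact: flat_set_closure ex.
Qed.

Lemma grad_form_linl v w T a phi : Vh k v -> Vh k w -> gradP T phi ->
  grad_form (vlin a v w) T phi = a * grad_form v T phi + grad_form w T phi.
Proof.
move=> Vv Vw phiP; rewrite /grad_form.
rewrite (poly_integral_mxdotl (poly_int_cell T)); [|exact: Vh_int_cell..|]; last first.
  by apply: mx_pol_row_div; [exact: open_cell|exact: gradP_cell].
rewrite (@eq_int_bd _ _ (fun e x =>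
  a * mxdot (wbd v e x) (normal (cell T) (facet e) *m (phi x)^T) +
  mxdot (wbd w e x) (normal (cell T) (facet e) *m (phi x)^T))); last first.
  by move=> e Te x ex; rewrite mxdotDl mxdotZl.
rewrite int_bd_lin; first by rewrite opprD addrACA mulrDr mulrN.
  by move=> e Te; apply: is_pol_mxdot; [exact: Vh_bd|apply: mx_pol_mulT; exact: gradP_flat phiP].
by move=> e Te; apply: is_pol_mxdot; [exact: Vh_bd|apply: mx_pol_mulT; exact: gradP_flat phiP].
Qed.

Lemma grad_form0l v T phi : vanishes v -> grad_form v T phi = 0.
Proof.
move=> [v0 vb]; rewrite /grad_form (poly_integral0 (poly_int_cell T)); last first.
  by move=> x Tx; rewrite v0 ?mxdot0l//; exact: subset_closure.
by rewrite int_bd0 ?oppr0 ?addr0// => e Te x ex; rewrite vb// mxdot0l.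
Qed.

Let gradP0 T F : gradP T F -> (forall x, cell T x -> F x = 0) ->
  forall x, closure (cell T) x -> F x = 0.
Proof.
move=> /mxpoly_on_mx_pol; exact: mx_pol_closure0 (@open_cell T) (cell_neq0 T).
Qed.

Lemma weak_gradP v T : Vh k v -> mxpoly_on k.-1 (closure (cell T)) (weak_grad k v T) /\
  forall phi, mxpoly_on k.-1 (closure (cell T)) phi ->
    int_cell T (fun x => mxdot (weak_grad k v T x) (phi x)) = grad_form v T phi.
Proof.
move=> Vv; have ex := projection_exists (poly_int_cell T) (@subset_closure _ (cell T))
  (fun F => id : gradP T F -> _) (@mxpoly_on0 R _ _ _ _ _) (fun a F G => @mxpoly_on_lin R _ _ _ _ _ a F G)
  (@gradP0 T) (fun a F G => @grad_form_linr v T a F G Vv) (fun F => @grad_form0r v T F).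
exact: (xgetPex (fun=> 0) ex).
Qed.

(** The weak gradient is an arbitrary choice among functions that agree on the closed cell. Its
    linearity in v therefore holds there only, and is proved by showing that the combination
    satisfies the same characterization. *)
Lemma weak_grad_unique v T u : Vh k v -> mxpoly_on k.-1 (closure (cell T)) u ->
  (forall phi, mxpoly_on k.-1 (closure (cell T)) phi ->
    int_cell T (fun x => mxdot (u x) (phi x)) = grad_form v T phi) ->
  forall x, closure (cell T) x -> weak_grad k v T x = u x.
Proof.
move=> Vv uP uL; have [wP wL] := weak_gradP T Vv.
exact: (projection_unique (poly_int_cell T) (@subset_closure _ (cell T))
  (fun F => id : gradP T F -> _) (fun a F G => @mxpoly_on_lin R _ _ _ _ _ a F G)
  (@gradP0 T) wP uP wL uL).
Qed.

Lemma weak_grad_lin a v w T x : Vh k v -> Vh k w -> closure (cell T) x ->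
  weak_grad k (vlin a v w) T x = a *: weak_grad k v T x + weak_grad k w T x.
Proof.
move=> Vv Vw; have [vP vL] := weak_gradP T Vv; have [wP wL] := weak_gradP T Vw.
apply: (weak_grad_unique (Vh_lin a Vv Vw) (mxpoly_on_lin a vP wP)) => phi phiP.
apply: etrans (poly_integral_mxdotl (poly_int_cell T) a (gradP_cell vP) (gradP_cell wP)
  (gradP_cell phiP)) _.
apply: etrans (congr2 (fun y z => a * y + z) (vL phi phiP) (wL phi phiP)) _.
exact: esym (grad_form_linl a Vv Vw phiP).
Qed.

Lemma weak_grad_vanishes v T x : Vh k v -> vanishes v -> closure (cell T) x ->
  weak_grad k v T x = 0.
Proof.
move=> Vv v0 Tx; rewrite (weak_grad_unique (u := fun=> 0) Vv _ _ Tx)//.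
  exact: mxpoly_on0.
move=> phi phiP; rewrite grad_form0l//; apply: (poly_integral0 (poly_int_cell T)) => y _.
exact: mxdot0l.
Qed.

End weak_operators.

Section weak_divergence.
Context {R : realType} {n : nat} {M : mesh (R := R) (1 + n)} (k : nat).
Hypotheses (pC : forall T : elem M, polyhedral (cell T))
  (fF : forall e : face M, flat_face (facet e)) (k_gt0 : (0 < k)%N).
Local Notation rV := 'rV[R]_(1 + n).
Implicit Types (T : elem M) (e : face M) (v w : wfun (M := M)).

Definition div_form v T (phi : rV -> R) : R :=
  - int_cell T (fun x => mxdot (wint v T x) (grad phi x)) +
  int_bd T (fun e x => mxdot (wbd v e x) (normal (cell T) (facet e)) * phi x).

Let divP T : set (rV -> R) := poly_on k.-1 (closure (cell T)).

Let divP_cell T phi : divP T phi -> is_pol (cell T) phi.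
Proof. by move/poly_on_is_pol; apply: is_polS; exact: subset_closure. Qed.

Let divP_flat T e phi : faces T e -> divP T phi -> is_pol (flat_set (facet e)) phi.
Proof. by move=> Te /poly_on_is_pol; apply: is_polS; exact: flat_set_closure. Qed.

Let bd_pol v T e phi : Vh k v -> faces T e -> divP T phi -> is_pol (flat_set (facet e))
  (fun x => mxdot (wbd v e x) (normal (cell T) (facet e)) * phi x).
Proof.
move=> Vv Te phiP; apply: is_polM; last exact: divP_flat phiP.
apply: is_pol_mxdot; first exact: (Vh_bd k_gt0).
by move=> i j; exact: is_polC.
Qed.

Lemma div_form_linr v T a phi psi : Vh k v -> divP T phi -> divP T psi ->
  div_form v T (fun x => a * phi x + psi x) = a * div_form v T phi + div_form v T psi.
Proof.
move=> Vv phiP psiP; rewrite /div_form.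
have cphi := divP_cell phiP; have cpsi := divP_cell psiP; have oT := open_cell pC (T := T).
rewrite (poly_integral_eq (poly_int_cell pC T)
  (g := fun x => mxdot (wint v T x) (a *: grad phi x + grad psi x))); last first.
  by move=> x Tx; rewrite (grad_lin a oT cphi cpsi Tx).
rewrite (poly_integral_mxdotr (poly_int_cell pC T)); [|exact: mx_pol_grad..|exact: (Vh_int_cell _ Vv)].
rewrite (@eq_int_bd _ _ _ _ _ (fun e x =>
  a * (mxdot (wbd v e x) (normal (cell T) (facet e)) * phi x) +
  mxdot (wbd v e x) (normal (cell T) (facet e)) * psi x)); last first.
  by move=> e Te x ex; rewrite mulrDr mulrCA.
rewrite int_bd_lin//; first by rewrite opprD addrACA mulrDr mulrN.
  by move=> e Te; exact: bd_pol.
by move=> e Te; exact: bd_pol.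
Qed.

Lemma div_form0r v T phi : divP T phi ->
  (forall x, closure (cell T) x -> phi x = 0) -> div_form v T phi = 0.
Proof.
move=> phiP phi0; rewrite /div_form (poly_integral0 (poly_int_cell pC T)); last first.
  move=> x Tx; rewrite (grad_eq0 (open_cell pC (T := T)) Tx) ?mxdot0r// => y Ty.
  by apply: phi0; exact: subset_closure.
rewrite int_bd0 ?oppr0 ?addr0// => e Te x ex.
by rewrite phi0 ?mulr0//; exact: (flat_set_closure pC Te).
Qed.

Lemma div_form_linl v w T a phi : Vh k v -> Vh k w -> divP T phi ->
  div_form (vlin a v w) T phi = a * div_form v T phi + div_form w T phi.
Proof.
move=> Vv Vw phiP; rewrite /div_form.
rewrite (poly_integral_mxdotl (poly_int_cell pC T)); [|exact: (Vh_int_cell _ Vv)|exact: (Vh_int_cell _ Vw)|]; last first.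
  by apply: mx_pol_grad; [exact: open_cell|exact: divP_cell].
rewrite (@eq_int_bd _ _ _ _ _ (fun e x =>
  a * (mxdot (wbd v e x) (normal (cell T) (facet e)) * phi x) +
  mxdot (wbd w e x) (normal (cell T) (facet e)) * phi x)); last first.
  by move=> e Te x ex; rewrite mxdotDl mxdotZl mulrDl mulrA.
rewrite int_bd_lin//; first by rewrite opprD addrACA mulrDr mulrN.
  by move=> e Te; exact: bd_pol.
by move=> e Te; exact: bd_pol.
Qed.

Lemma div_form0l v T phi : vanishes v -> div_form v T phi = 0.
Proof.
move=> [v0 vb]; rewrite /div_form (poly_integral0 (poly_int_cell pC T)); last first.
  by move=> x Tx; rewrite v0 ?mxdot0l//; exact: subset_closure.
by rewrite int_bd0 ?oppr0 ?addr0// => e Te x ex; rewrite vb// mxdot0l mul0r.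
Qed.

(* A scalar function is handled as a matrix-valued one of size 1. *)
Let P1 T : set (rV -> 'M[R]_1) := mxpoly_on k.-1 (closure (cell T)).

Let P1E T (F : rV -> 'M[R]_1) : P1 T F -> divP T (fun x => F x 0 0).
Proof. exact. Qed.

Let P1M T phi : divP T phi -> P1 T (fun x => (phi x)%:M).
Proof.
by move=> [p [pk phiE]] i j; exists p; split => // x Tx; rewrite !ord1 mxE eqxx mulr1n phiE.
Qed.

Let mxdot1 (a b : R) : mxdot (a%:M : 'M[R]_1) b%:M = a * b.
Proof. by rewrite mxdotE !big_ord1 !mxE eqxx !mulr1n. Qed.

Let P10 T F : P1 T F -> (forall x, cell T x -> F x = 0) ->
  forall x, closure (cell T) x -> F x = 0.
Proof.
by move=> /mxpoly_on_mx_pol; apply: mx_pol_closure0; [exact: open_cell|exact: cell_neq0].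
Qed.

Let L1 v T (F : rV -> 'M[R]_1) := div_form v T (fun x => F x 0 0).

Let L1lin v T a F G : Vh k v -> P1 T F -> P1 T G ->
  L1 v T (fun x => a *: F x + G x) = a * L1 v T F + L1 v T G.
Proof.
move=> Vv FP GP; rewrite /L1 -div_form_linr//; [|exact: P1E..].
by congr div_form; apply/funext => x; rewrite !mxE.
Qed.

Let L10 v T F : P1 T F -> (forall x, closure (cell T) x -> F x = 0) -> L1 v T F = 0.
Proof. by move=> FP F0; apply: div_form0r => [|x Tx]; [exact: P1E|rewrite F0// mxE]. Qed.

Lemma weak_divP v T : Vh k v -> poly_on k.-1 (closure (cell T)) (weak_div k v T) /\
  forall phi, poly_on k.-1 (closure (cell T)) phi ->
    int_cell T (fun x => weak_div k v T x * phi x) = div_form v T phi.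
Proof.
move=> Vv; have [u [Pu uL]] := projection_exists (poly_int_cell pC T) (@subset_closure _ (cell T))
  (fun F => id : P1 T F -> _) (@mxpoly_on0 R _ _ _ _ _) (fun a F G => @mxpoly_on_lin R _ _ _ _ _ a F G)
  (@P10 T) (fun a F G => @L1lin v T a F G Vv) (fun F => @L10 v T F).
suff ex : exists w : rV -> R, poly_on k.-1 (closure (cell T)) w /\
    forall phi, poly_on k.-1 (closure (cell T)) phi ->
      int_cell T (fun x => w x * phi x) = div_form v T phi.
  exact: (xgetPex (fun=> 0) ex).
exists (fun x => u x 0 0); split=> [|phi phiP]; first exact: P1E.
have := uL _ (P1M phiP); rewrite /L1 (_ : (fun x => (phi x)%:M 0 0) = phi); last first.
  by apply/funext => x; rewrite mxE eqxx mulr1n.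
move=> <-; apply: (poly_integral_eq (poly_int_cell pC T)) => x _.
by rewrite [u x in RHS]mx11_scalar mxdot1.
Qed.

Lemma weak_div_unique v T (w : rV -> R) : Vh k v -> poly_on k.-1 (closure (cell T)) w ->
  (forall phi, poly_on k.-1 (closure (cell T)) phi ->
    int_cell T (fun x => w x * phi x) = div_form v T phi) ->
  forall x, closure (cell T) x -> weak_div k v T x = w x.
Proof.
move=> Vv wP wL; have [dP dL] := weak_divP T Vv.
have H u : poly_on k.-1 (closure (cell T)) u ->
    (forall phi, poly_on k.-1 (closure (cell T)) phi ->
      int_cell T (fun x => u x * phi x) = div_form v T phi) ->
    forall F, P1 T F -> int_cell T (fun x => mxdot (u x)%:M (F x)) = L1 v T F.
  move=> uP uL F FP; rewrite /L1 -uL; last exact: P1E.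
  apply: (poly_integral_eq (poly_int_cell pC T)) => x _.
  by rewrite {1}[F x]mx11_scalar mxdot1.
move=> x Tx; have := projection_unique (poly_int_cell pC T) (@subset_closure _ (cell T))
  (fun F => id : P1 T F -> _) (fun a F G => @mxpoly_on_lin R _ _ _ _ _ a F G)
  (@P10 T) (P1M dP) (P1M wP) (H _ dP dL) (H _ wP wL) Tx.
by move/matrixP/(_ 0 0); rewrite !mxE eqxx !mulr1n.
Qed.

Lemma weak_div_lin a v w T x : Vh k v -> Vh k w -> closure (cell T) x ->
  weak_div k (vlin a v w) T x = a * weak_div k v T x + weak_div k w T x.
Proof.
move=> Vv Vw; have [vP vL] := weak_divP T Vv; have [wP wL] := weak_divP T Vw.
apply: (weak_div_unique (Vh_lin a Vv Vw) (poly_on_lin a vP wP)) => phi phiP.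
rewrite div_form_linl// -vL// -wL//.
have cP u : poly_on k.-1 (closure (cell T)) u -> is_pol (cell T) (fun x => u x * phi x).
  by move=> uP; apply: is_polM; exact: divP_cell.
rewrite -(poly_integral_lin (poly_int_cell pC T)); [|exact: cP..].
by apply: (poly_integral_eq (poly_int_cell pC T)) => y _; rewrite mulrDl mulrA.
Qed.

Lemma weak_div_vanishes v T x : Vh k v -> vanishes v -> closure (cell T) x ->
  weak_div k v T x = 0.
Proof.
move=> Vv v0 Tx; rewrite (weak_div_unique (w := fun=> 0) Vv _ _ Tx)//.
  exact: poly_on0.
move=> phi phiP; rewrite div_form0l//; apply: (poly_integral0 (poly_int_cell pC T)) => y _.
exact: mul0r.
Qed.

End weak_divergence.

(** * The projection Q_b on a face *)

Section face_projection.
Context {R : realType} {n : nat} {M : mesh (R := R) (1 + n)} (k : nat).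
Hypotheses (fF : forall e : face M, flat_face (facet e)) (k_gt0 : (0 < k)%N).
Local Notation rV := 'rV[R]_(1 + n).
Implicit Types (e : face M).

(** What Q_b asks of its argument: a common condition for the traces of polynomials and for the
    boundary data, which are only in L^2. *)
Definition flat_integrable e (u : rV -> rV) := forall i p,
  (lebesgue_rV (1 + n).-1).-integrable (flat_dom (facet e))
    (fun y => (u (chart (facet e) y) 0 i * pev p (chart (facet e) y))%:E).

Lemma pol_flat_integrable e (u : rV -> rV) : mx_pol (flat_set (facet e)) u -> flat_integrable e u.
Proof.
move=> uP i p; have [q uq] := uP 0 i.
have mD : measurable (flat_dom (facet e)) by apply: open_measurable_rV; case: (fF e).2.
apply: eq_integrable (integrable_chart (q * p) (fF e)) => //.
by move=> y; rewrite inE => Dy; rewrite /= pevM uq//; exact: imageP.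
Qed.

Lemma flat_integrable_mxdot e u phi : flat_integrable e u -> mx_pol (flat_set (facet e)) phi ->
  (lebesgue_rV (1 + n).-1).-integrable (flat_dom (facet e))
    (EFin \o (fun y => mxdot (u (chart (facet e) y)) (phi (chart (facet e) y)))).
Proof.
move=> ui phiP; have /choice[p pP] i := phiP 0 i.
have mD : measurable (flat_dom (facet e)) by apply: open_measurable_rV; case: (fF e).2.
apply: eq_integrable (integrable_sum mD (index_enum 'I_(1 + n)) (P := xpredT)
  (fun i _ => ui i (p i))) => //.
move=> y; rewrite inE => Dy; rewrite /= mxdot_rVE -sumEFin; apply: eq_bigr => i _.
by rewrite pP//; exact: imageP.
Qed.

Lemma int_flat_mxdotr e u a phi psi : flat_integrable e u ->
  mx_pol (flat_set (facet e)) phi -> mx_pol (flat_set (facet e)) psi ->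
  int_flat (facet e) (fun x => mxdot (u x) (a *: phi x + psi x)) =
  a * int_flat (facet e) (fun x => mxdot (u x) (phi x)) +
  int_flat (facet e) (fun x => mxdot (u x) (psi x)).
Proof.
move=> ui phiP psiP; have mD : measurable (flat_dom (facet e)).
  by apply: open_measurable_rV; case: (fF e).2.
have i1 := flat_integrable_mxdot ui phiP; have i2 := flat_integrable_mxdot ui psiP.
rewrite /int_flat -RintegralZl// -RintegralD//; last first.
  by apply: eq_integrable (integrableZl mD a i1) => // y _; rewrite /= EFinM.
by apply: eq_Rintegral => y _; rewrite mxdotDr mxdotZr.
Qed.

Let P e : set (rV -> rV) := face_space k e.

Let PD e F : P e F -> (forall x, flat_set (facet e) x -> F x = 0) ->
  forall x, flat_set (facet e) x -> F x = 0.
Proof. by []. Qed.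

Let L e u (phi : rV -> rV) := int_flat (facet e) (fun x => mxdot (u x) (phi x)).

Let Llin e u a F G : flat_integrable e u -> P e F -> P e G ->
  L e u (fun x => a *: F x + G x) = a * L e u F + L e u G.
Proof. by move=> ui FP GP; apply: int_flat_mxdotr ui _ _; [exact: face_space_pol FP|exact: face_space_pol GP]. Qed.

Let L0 e u F : P e F -> (forall x, flat_set (facet e) x -> F x = 0) -> L e u F = 0.
Proof.
move=> _ F0; apply: (poly_integral0 (poly_int_flat fF e)) => x ex.
by rewrite F0// mxdot0r.
Qed.

Lemma QbP e u : flat_integrable e u -> face_space k e (Qb k e u) /\
  forall phi, face_space k e phi ->
    int_flat (facet e) (fun x => mxdot (Qb k e u x) (phi x)) =
    int_flat (facet e) (fun x => mxdot (u x) (phi x)).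
Proof.
move=> ui; have ex := projection_exists (poly_int_flat fF e) (@subset_refl _ (flat_set (facet e)))
  (@face_space_poly _ _ _ _ k_gt0 e) (@face_space0 R n M k e)
  (fun a F G => @face_space_lin R n M k e a F G) (@PD e)
  (fun a F G => @Llin e u a F G ui) (fun F => @L0 e u F).
exact: (xgetPex (fun=> 0) ex).
Qed.

Lemma Qb_unique e u q : flat_integrable e u -> face_space k e q ->
  (forall phi, face_space k e phi ->
    int_flat (facet e) (fun x => mxdot (q x) (phi x)) =
    int_flat (facet e) (fun x => mxdot (u x) (phi x))) ->
  forall x, flat_set (facet e) x -> Qb k e u x = q x.
Proof.
move=> ui qP qL; have [QP QL] := QbP ui.
exact: (projection_unique (poly_int_flat fF e) (@subset_refl _ (flat_set (facet e)))
  (@face_space_poly _ _ _ _ k_gt0 e) (fun a F G => @face_space_lin R n M k e a F G) (@PD e)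
  QP qP QL qL).
Qed.

Lemma Qb_lin e a u w x : mx_pol (flat_set (facet e)) u -> mx_pol (flat_set (facet e)) w ->
  flat_set (facet e) x ->
  Qb k e (fun x => a *: u x + w x) x = a *: Qb k e u x + Qb k e w x.
Proof.
move=> uP wP; have [QuP QuL] := QbP (pol_flat_integrable uP).
have [QwP QwL] := QbP (pol_flat_integrable wP).
apply: (@Qb_unique _ _ (fun x => a *: Qb k e u x + Qb k e w x)).
- by apply: pol_flat_integrable; exact: mx_pol_lin.
- exact: face_space_lin.
- move=> phi phiP; have pP := face_space_pol k_gt0 phiP.
  rewrite !(poly_integral_mxdotl (poly_int_flat fF e))//; [|exact: face_space_pol QuP|exact: face_space_pol QwP].
  by rewrite QuL ?QwL.
Qed.

Lemma Qb_eq0 e u x : (forall x, flat_set (facet e) x -> u x = 0) ->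
  flat_set (facet e) x -> Qb k e u x = 0.
Proof.
move=> u0 ex; rewrite (@Qb_unique _ _ (fun=> 0) _ _ _ _ ex)//.
- apply: pol_flat_integrable => i j; apply: is_pol_eq (is_polC _ 0) => y ey.
  by rewrite u0// mxE.
- exact: face_space0.
- move=> phi phiP; apply: eq_int_flat => y ey; by rewrite u0.
Qed.

End face_projection.

(** * The bilinear form *)

(** Boundedness makes [sup] an upper bound of the distances, and an open set contains two points
    differing along the first axis. The weight h_T^-1 of the stabilizer is thus positive, so that a
    vanishing stabilizer forces the jumps to vanish. *)
Lemma diam_gt0 {R : realType} n (D : set 'rV[R]_(1 + n)) : open D -> D !=set0 ->
  coord_bounded D -> 0 < diam D.
Proof.
move=> oD [x Dx] [K DK].
have DK' p : (D `*` D) p -> enorm (p.1 - p.2) <= Num.sqrt (\sum_(i < 1 + n) (K + K) ^+ 2).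
  move=> [Dp Dq]; rewrite ler_wsqrtr// mxdot_rVE; apply: ler_sum => i _.
  rewrite -expr2 -[leLHS]real_normK ?num_real// ler_sqr ?nnegrE//; last first.
    by apply: addr_ge0; exact: le_trans (normr_ge0 _) (DK x Dx ord0).
  by rewrite !mxE (le_trans (ler_normB _ _))// lerD// DK.
have cl := @continuous_line R _ x (delta_mx 0 0) 0.
rewrite /continuous_at scale0r addr0 in cl.
have : \forall t \near (0 : R)^'+, D (x + t *: delta_mx 0 0).
  by apply: (cvg_at_right_filter cl); exact: open_nbhs_nbhs.
have : \forall t \near (0 : R)^'+, 0 < t by exact: nbhs_right_gt.
move=> h1 h2; near (0 : R)^'+ => t.
have t0 : 0 < t by near: t.
have Dt : D (x + t *: delta_mx 0 0) by near: t.
apply: (@lt_le_trans _ _ (enorm (x + t *: delta_mx 0 0 - x))).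
  rewrite addrC addKr /enorm sqrtr_gt0 mxdotZl mxdotZr mulrA mulr_gt0 ?mulr_gt0//.
  rewrite mxdot_rVE (bigD1 0)//= !mxE !eqxx mulr1 ltr_wpDr// sumr_ge0// => i _.
  by rewrite -expr2 sqr_ge0.
apply: ub_le_sup; last by exists (x + t *: delta_mx 0 0, x).
by exists (Num.sqrt (\sum_(i < 1 + n) (K + K) ^+ 2)) => _ [p Dp <-]; exact: DK'.
Unshelve. all: by end_near. Qed.

Lemma symmetrization_lin (R : realType) m a (A B : 'M[R]_m) :
  2^-1 *: (a *: A + B + (a *: A + B)^T) = a *: (2^-1 *: (A + A^T)) + 2^-1 *: (B + B^T).
Proof. by apply/matrixP => i j; rewrite !mxE; ring. Qed.

Lemma mulr_linl (R : pzRingType) (a x y z : R) : (a * x + y) * z = a * (x * z) + y * z.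
Proof. by rewrite mulrDl mulrA. Qed.

Lemma sum3_lin (R : comPzRingType) (I : finType) (a : R) (c1 c2 : R) (c3 A A' A'' B B' B'' C C' C'' : I -> R) :
  (forall i, A i = a * A' i + A'' i) -> (forall i, B i = a * B' i + B'' i) ->
  (forall i, C i = a * C' i + C'' i) ->
  \sum_i c1 * A i + \sum_i c2 * B i + \sum_i c3 i * C i =
  a * (\sum_i c1 * A' i + \sum_i c2 * B' i + \sum_i c3 i * C' i) +
  (\sum_i c1 * A'' i + \sum_i c2 * B'' i + \sum_i c3 i * C'' i).
Proof.
move=> hA hB hC; rewrite -!big_split/= mulr_sumr -big_split/=.
by apply: eq_bigr => i _; rewrite hA hB hC; ring.
Qed.

Lemma sum3_eq0 (R : realDomainType) (I : finType) (A B C : I -> R) :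
  (forall i, 0 <= A i) -> (forall i, 0 <= B i) -> (forall i, 0 <= C i) ->
  \sum_i A i + \sum_i B i + \sum_i C i = 0 -> forall i, A i = 0 /\ C i = 0.
Proof.
move=> hA hB hC /eqP; rewrite -!big_split/= psumr_eq0; last first.
  by move=> i _; rewrite !addr_ge0.
move=> /allP h i; have := h i (mem_index_enum i).
by rewrite implyTb !paddr_eq0 ?addr_ge0// -andbA => /and3P[/eqP-> _ /eqP->].
Qed.

Section bilinear_form.
Context {R : realType} {n : nat} {M : mesh (R := R) (1 + n)} (k : nat).
Hypotheses (pC : forall T : elem M, polyhedral (cell T))
  (fF : forall e : face M, flat_face (facet e)) (k_gt0 : (0 < k)%N).
Variables (mu lambda : R).
Local Notation rV := 'rV[R]_(1 + n).
Implicit Types (T : elem M) (e : face M) (u v w : wfun (M := M)).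

Local Opaque weak_grad weak_div Qb.

Lemma weak_grad_pol v T : Vh k v -> mx_pol (cell T) (weak_grad k v T).
Proof.
move=> Vv; have [/mxpoly_on_mx_pol + _] := weak_gradP pC fF k_gt0 T Vv.
by apply: mx_polS; exact: subset_closure.
Qed.

Lemma weak_strain_pol v T : Vh k v -> mx_pol (cell T) (weak_strain k v T).
Proof.
move=> Vv i j; have gP := weak_grad_pol T Vv.
apply: (@is_pol_eq _ _ _ (fun x => 2^-1 * (weak_grad k v T x i j + weak_grad k v T x j i))).
  by move=> x _; rewrite !mxE.
by apply: is_polZ; exact: is_polD (gP i j) (gP j i).
Qed.

Lemma weak_div_pol v T : Vh k v -> is_pol (cell T) (weak_div k v T).
Proof.
move=> Vv; have [/poly_on_is_pol + _] := weak_divP pC fF k_gt0 T Vv.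
by apply: is_polS; exact: subset_closure.
Qed.

Lemma weak_strain_lin a v w T x : Vh k v -> Vh k w -> cell T x ->
  weak_strain k (vlin a v w) T x = a *: weak_strain k v T x + weak_strain k w T x.
Proof.
move=> Vv Vw /subset_closure Tx; rewrite /weak_strain (weak_grad_lin pC fF k_gt0 a Vv Vw Tx).
exact: symmetrization_lin.
Qed.

Definition jump v T e x : rV := Qb k e (wint v T) x - wbd v e x.

Lemma jump_pol v T e : Vh k v -> faces T e -> mx_pol (flat_set (facet e)) (jump v T e).
Proof.
move=> Vv Te; have vi := Vh_int_flat pC Vv Te.
have [QP _] := QbP fF k_gt0 (pol_flat_integrable fF vi).
have := mx_pol_lin (-1) (Vh_bd k_gt0 e Vv) (face_space_pol k_gt0 QP).
move=> H i j; apply: is_pol_eq (H i j) => x _.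
by rewrite scaleN1r addrC.
Qed.

Lemma jump_lin a v w T e x : Vh k v -> Vh k w -> faces T e -> flat_set (facet e) x ->
  jump (vlin a v w) T e x = a *: jump v T e x + jump w T e x.
Proof.
move=> Vv Vw Te ex; rewrite /jump (Qb_lin fF k_gt0 a _ _ ex); first last.
- exact: (Vh_int_flat pC Vw Te).
- exact: (Vh_int_flat pC Vv Te).
by rewrite /= scalerBr opprD addrACA.
Qed.

Lemma jump_vanishes v T e x : vanishes v -> faces T e -> flat_set (facet e) x -> jump v T e x = 0.
Proof.
move=> [v0 vb] Te ex; rewrite /jump vb// subr0 (Qb_eq0 fF k_gt0 _ ex)// => y ey.
by apply: v0; exact: (flat_set_closure pC Te).
Qed.

Lemma a_s_sym v w : a_s k mu lambda v w = a_s k mu lambda w v.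
Proof.
have E1 T : (fun x => mxdot (weak_strain k v T x) (weak_strain k w T x)) =
    (fun x => mxdot (weak_strain k w T x) (weak_strain k v T x)).
  by apply/funext => x; exact: mxdotC.
have E2 T : (fun x => weak_div k v T x * weak_div k w T x) =
    (fun x => weak_div k w T x * weak_div k v T x).
  by apply/funext => x; exact: mulrC.
have E3 T : (fun e x => mxdot (jump v T e x) (jump w T e x)) =
    (fun e x => mxdot (jump w T e x) (jump v T e x)).
  by apply/funext => e; apply/funext => x; exact: mxdotC.
have F1 T := congr1 (fun g => 2 * mu * int_cell T g) (E1 T).
have F2 T := congr1 (fun g => lambda * int_cell T g) (E2 T).
have F3 T := congr1 (fun g => (diam (cell T))^-1 * int_bd T g) (E3 T).
exact: (congr2 +%R (congr2 +%R (eq_bigr _ (fun T _ => F1 T)) (eq_bigr _ (fun T _ => F2 T)))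
  (eq_bigr _ (fun T _ => F3 T))).
Qed.

Lemma a_s_linl a u v w : Vh k u -> Vh k v -> Vh k w ->
  a_s k mu lambda (vlin a u v) w = a * a_s k mu lambda u w + a_s k mu lambda v w.
Proof.
move=> Vu Vv Vw.
have E1 T : int_cell T (fun x => mxdot (weak_strain k (vlin a u v) T x) (weak_strain k w T x)) =
    a * int_cell T (fun x => mxdot (weak_strain k u T x) (weak_strain k w T x)) +
    int_cell T (fun x => mxdot (weak_strain k v T x) (weak_strain k w T x)).
  apply: etrans (poly_integral_mxdotl (poly_int_cell pC T) a (weak_strain_pol T Vu)
    (weak_strain_pol T Vv) (weak_strain_pol T Vw)).
  apply: (poly_integral_eq (poly_int_cell pC T)) => x Tx.
  exact: (congr1 (fun S => mxdot S (weak_strain k w T x)) (weak_strain_lin a Vu Vv Tx)).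
have E2 T : int_cell T (fun x => weak_div k (vlin a u v) T x * weak_div k w T x) =
    a * int_cell T (fun x => weak_div k u T x * weak_div k w T x) +
    int_cell T (fun x => weak_div k v T x * weak_div k w T x).
  apply: etrans (poly_integral_lin (poly_int_cell pC T) a
    (is_polM (weak_div_pol T Vu) (weak_div_pol T Vw))
    (is_polM (weak_div_pol T Vv) (weak_div_pol T Vw))).
  apply: (poly_integral_eq (poly_int_cell pC T)) => x /subset_closure Tx.
  apply: etrans (congr1 (fun d => d * weak_div k w T x) (weak_div_lin pC fF k_gt0 a Vu Vv Tx)) _.
  exact: mulr_linl.
have E3 T : int_bd T (fun e x => mxdot (jump (vlin a u v) T e x) (jump w T e x)) =
    a * int_bd T (fun e x => mxdot (jump u T e x) (jump w T e x)) +
    int_bd T (fun e x => mxdot (jump v T e x) (jump w T e x)).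
  apply: etrans (int_bd_lin fF a
    (fun e Te => is_pol_mxdot (jump_pol Vu Te) (jump_pol Vw Te))
    (fun e Te => is_pol_mxdot (jump_pol Vv Te) (jump_pol Vw Te))).
  apply: eq_int_bd => e Te x ex.
  apply: etrans (congr1 (fun j => mxdot j (jump w T e x)) (jump_lin a Vu Vv Te ex)) _.
  by rewrite mxdotDl mxdotZl.
exact: sum3_lin E1 E2 E3.
Qed.

Lemma a_s_vanishes v w : Vh k v -> vanishes v -> a_s k mu lambda v w = 0.
Proof.
move=> Vv v0; rewrite /a_s /stab !big1 ?addr0// => T _.
- rewrite (int_bd0 fF) ?mulr0// => e Te x ex.
  by rewrite -[Qb _ _ _ _ - _]/(jump v T e x) jump_vanishes// mxdot0l.
- rewrite (poly_integral0 (poly_int_cell pC T)) ?mulr0// => x /subset_closure Tx.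
  by rewrite (weak_div_vanishes pC fF k_gt0 Vv v0 Tx) mul0r.
- rewrite (poly_integral0 (poly_int_cell pC T)) ?mulr0// => x /subset_closure Tx.
  by rewrite /weak_strain (weak_grad_vanishes pC fF k_gt0 Vv v0 Tx) trmx0 addr0 scaler0 mxdot0l.
Qed.

Hypotheses (mu_gt0 : 0 < mu) (lambda_ge0 : 0 <= lambda).

Lemma a_s_eq0 v : Vh k v -> a_s k mu lambda v v = 0 ->
  (forall T x, cell T x -> weak_strain k v T x = 0) /\
  (forall T e x, faces T e -> flat_set (facet e) x -> Qb k e (wint v T) x = wbd v e x).
Proof.
move=> Vv.
have S T := poly_integral_sqr (poly_int_cell pC T) (weak_strain_pol T Vv).
have J T e (Te : faces T e) := poly_integral_sqr (poly_int_flat fF e) (jump_pol Vv Te).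
have hT T : 0 < (diam (cell T))^-1.
  rewrite invr_gt0; apply: diam_gt0; [exact: open_cell|exact: cell_neq0|].
  have [K HK] := polyhedral_bounded (pC T).
  by exists K => x /subset_closure; exact: HK.
have p1 T : 0 <= 2 * mu * int_cell T (fun x => mxdot (weak_strain k v T x) (weak_strain k v T x)).
  by apply: mulr_ge0; [rewrite mulr_ge0// ltW|exact: (S T).1].
have p2 T : 0 <= lambda * int_cell T (fun x => weak_div k v T x * weak_div k v T x).
  apply: mulr_ge0 => //; have [p pE] := weak_div_pol T Vv.
  by case: (poly_integral_cell (pC T)) => _ _ _; apply: Rintegral_ge0 => x _; rewrite -expr2 sqr_ge0.
have p3 T : 0 <= (diam (cell T))^-1 * int_bd T (fun e x => mxdot (jump v T e x) (jump v T e x)).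
  by apply: mulr_ge0; [exact: ltW|apply: sumr_ge0 => e Te; exact: (J T e Te).1].
move=> /(sum3_eq0 p1 p2 p3) h; split=> [T|T e x Te ex].
  by apply: (S T).2; have /eqP := (h T).1; rewrite !mulf_eq0 pnatr_eq0 (gt_eqF mu_gt0)/= => /eqP.
have /eqP := (h T).2; rewrite mulf_eq0 (gt_eqF (hT T))/= => /eqP bd0.
have := @psumr_eq0P R (face M) (faces T) _ (fun e' Te' => (J T e' Te').1) bd0 e Te.
move=> /(J T e Te).2/(_ x ex)/eqP; rewrite subr_eq0 => /eqP.
exact.
Qed.

End bilinear_form.

(** * Integration by parts, and cancellation of normals across faces *)

Section green_formula.
Context {R : realType} {n : nat} {M : mesh (R := R) (1 + n)}.
Hypotheses (pC : forall T : elem M, polyhedral (cell T))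
  (fF : forall e : face M, flat_face (facet e))
  (disjF : forall e1 e2 : face M, e1 != e2 ->
    flat_set (facet e1) `&` flat_set (facet e2) = set0)
  (bdT : forall T : elem M, bd (cell T) =
    \bigcup_(e in [set e | faces T e]) closure (flat_set (facet e))).
Local Notation rV := 'rV[R]_(1 + n).
Local Notation poly := (mpoly.mpoly (1 + n) R).
Implicit Types (T : elem M) (e : face M).

Lemma poly_integralZ d (D : set 'rV[R]_d) J a f : poly_integral D J -> is_pol D f ->
  J (fun x => a * f x) = a * J f.
Proof.
move=> JP fP; have := poly_integral_lin JP a fP (is_polC D 0).
rewrite (poly_integral0 JP (f := fun=> 0))// addr0 => <-.
by apply: (poly_integral_eq JP) => x _; rewrite addr0.
Qed.

Lemma divergence_cell T (p : poly) i : int_cell T (pev (mpoly.mderiv i p)) =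
  \sum_(e | faces T e) normal (cell T) (facet e) 0 i * int_flat (facet e) (pev p).
Proof.
exact: (divergence_polyhedral (pC T) (fun e _ => fF e) (fun e e' _ _ => @disjF e e') (bdT T)
  (fun e Te => face_normal Te)).
Qed.

(** The right side is [grad_form] for a pair whose boundary part is the trace of its interior part
    p: in that case the weak gradient tests like the gradient. *)
Lemma green_formula T (p : 'I_(1 + n) -> poly) (s : 'I_(1 + n) -> 'I_(1 + n) -> poly) :
  int_cell T (pev (\sum_i \sum_j mpoly.mderiv j (p i) * s i j)) =
  - int_cell T (fun x => mxdot (\row_i pev (p i) x)
      (row_div (fun y => \matrix_(i, j) pev (s i j) y) x)) +
  int_bd T (fun e x => mxdot (\row_i pev (p i) x)
      (normal (cell T) (facet e) *m (\matrix_(i, j) pev (s i j) x)^T)).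
Proof.
(* The field to which the divergence theorem is applied; q is the part of its divergence in which s
   is differentiated. *)
pose P j := \sum_i p i * s i j.
pose q := \sum_i p i * \sum_j mpoly.mderiv j (s i j).
have sumE : \sum_i \sum_j mpoly.mderiv j (p i) * s i j + q = \sum_j mpoly.mderiv j (P j).
  have PE j : mpoly.mderiv j (P j) =
      \sum_i (mpoly.mderiv j (p i) * s i j + p i * mpoly.mderiv j (s i j)).
    rewrite raddf_sum; apply: eq_bigr => i _; exact: mpoly.mderivM.
  rewrite -big_split/= (eq_bigr _ (fun j _ => PE j)) [RHS]exchange_big/=.
  by apply: eq_bigr => i _; rewrite mulr_sumr -big_split.
have JT := poly_int_cell pC T.
have -> : int_cell T (fun x => mxdot (\row_i pev (p i) x)
    (row_div (fun y => \matrix_(i, j) pev (s i j) y) x)) = int_cell T (pev q).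
  apply: (poly_integral_eq JT) => x _; rewrite mxdot_rVE pev_sum.
  apply: eq_bigr => i _; rewrite !mxE pevM pev_sum; congr (_ * _).
  apply: eq_bigr => j _; rewrite -partial_pev; congr (partial _ _ _).
  by apply/funext => y; rewrite mxE.
apply/eqP; rewrite addrC -subr_eq opprK; apply/eqP.
transitivity (int_cell T (pev (\sum_j mpoly.mderiv j (P j)))).
  rewrite -sumE -[X in X + _]mul1r -(poly_integral_lin JT); [|exact: is_pol_pev..].
  by apply: (poly_integral_eq JT) => x _; rewrite pevD mul1r.
transitivity (int_cell T (fun x => \sum_j pev (mpoly.mderiv j (P j)) x)).
  by apply: (poly_integral_eq JT) => x _; rewrite pev_sum.
rewrite (poly_integral_sum JT); last by move=> i _; exact: is_pol_pev.
under eq_bigr do rewrite divergence_cell.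
rewrite exchange_big/=; apply: eq_bigr => e Te; have Je := poly_int_flat fF e.
under eq_bigr => j _ do rewrite -(poly_integralZ _ Je (is_pol_pev _ (P j))).
rewrite -(poly_integral_sum Je); last by move=> j _; exact/is_polZ/is_pol_pev.
apply: (poly_integral_eq Je) => x _; rewrite mxdot_rVE.
under eq_bigr do rewrite pev_sum mulr_sumr.
rewrite exchange_big/=; apply: eq_bigr => i _; rewrite !mxE mulr_sumr.
by apply: eq_bigr => j _; rewrite !mxE pevM mulrCA.
Qed.

(** Both are unit normals of the same plane. If they were equal, both cells would contain the points
    slightly behind the face. *)
Lemma normal_opp T1 T2 e : cell T1 `&` cell T2 = set0 -> faces T1 e -> faces T2 e ->
  normal (cell T2) (facet e) = - normal (cell T1) (facet e).
Proof.
move=> T12 /face_normal[n1 Fn1 s1] /face_normal[n2 Fn2 s2].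
have [FF [[y Dy] _ _ _ _]] := fF e.
have [n12|//] := unit_normal_pm FF Fn1 (enorm1 n1) Fn2 (enorm1 n2).
have ex : flat_set (facet e) (chart (facet e) y) by exists y.
have := s1 _ ex; have := s2 _ ex; rewrite n12 => h2 h1.
have [t [[t1 _] [t2 _]]] := filter_ex (filterI h1 h2).
by have : set0 (chart (facet e) y - t *: normal (cell T1) (facet e)) by rewrite -T12.
Qed.

Hypotheses (disjC : forall T1 T2 : elem M, T1 != T2 -> cell T1 `&` cell T2 = set0).

(** Three cells on a face would have three unit normals that are pairwise opposite. *)
Lemma face_cells_le2 T T1 T2 e : T1 != T2 -> faces T1 e -> faces T2 e -> faces T e ->
  T = T1 \/ T = T2.
Proof.
move=> T12 T1e T2e Te; have [->|TT1] := eqVneq T T1; first by left.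
have [->|TT2] := eqVneq T T2; first by right.
have h1 := normal_opp (disjC TT1) Te T1e; have h2 := normal_opp (disjC TT2) Te T2e.
have := normal_opp (disjC T12) T1e T2e; rewrite h2 h1 opprK => h.
have [/enorm1 + _ _] := face_normal Te.
have -> : normal (cell T) (facet e) = 0.
  apply/rowP => i; move/rowP : h => /(_ i); rewrite !mxE => /eqP.
  by rewrite eq_sym -subr_eq0 opprK -mulr2n mulrn_eq0/= => /eqP.
by rewrite mxdot0l => /eqP; rewrite eq_sym oner_eq0.
Qed.

(* Adding up the divergence theorem for [x_0] over the cells of [Z], the
   contributions of each face cancel. *)
Lemma no_closed_family (Z : pred (elem M)) :
  (forall T e, Z T -> faces T e -> exists T', [/\ T' != T, faces T' e & Z T']) ->
  forall T, ~~ Z T.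
Proof.
move=> Zshared.
pose X0 : poly := mpoly.mpolyX R (mpoly.mnm1 ord0).
have pevd x : pev (mpoly.mderiv ord0 X0) x = 1.
  rewrite mpoly.mderivX mpoly.mnm1E eqxx scale1r.
  have -> : mpoly.mnm_sub (mpoly.mnm1 (ord0 : 'I_(1 + n))) (mpoly.mnm1 ord0) = mpoly.mnm0.
    by apply/mpoly.mnmP => i; rewrite mpoly.mnmBE mpoly.mnm0E subnn.
  by rewrite mpoly.mpolyX0 /pev rmorph1.
have S0 : \sum_(T | Z T) int_cell T (pev (mpoly.mderiv ord0 X0)) = 0.
  under eq_bigr do rewrite divergence_cell.
  rewrite (exchange_big_dep xpredT)//= big1// => e _; rewrite -mulr_suml.
  have [/existsP[T1 /andP[ZT1 T1e]]|/existsPn nZ] := boolP [exists T, Z T && faces T e]; last first.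
    by rewrite big_pred0 ?mul0r// => T; exact/negbTE/nZ.
  have [T2 [T21 T2e ZT2]] := Zshared _ _ ZT1 T1e.
  rewrite (bigD1 T1) ?ZT1//= (bigD1 T2) ?ZT2 ?T2e//= big_pred0 => [|T].
    by rewrite addr0 (normal_opp (disjC T21) T2e T1e) mxE addNr mul0r.
  apply/negbTE; apply/negP => /andP[/andP[/andP[ZT Te] TT1] TT2].
  by have [E|E] := face_cells_le2 T21 T2e T1e Te; rewrite E eqxx in TT1 TT2.
(* The measure of a cell, written as the integral of the square of the constant 1 to apply the
   definiteness of the integral. *)
have pos T : int_cell T (pev (mpoly.mderiv ord0 X0)) =
    int_cell T (fun x => mxdot (1%:M : 'M[R]_1) 1%:M).
  apply: (poly_integral_eq (poly_int_cell pC T)) => x _.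
  by rewrite pevd mxdotE !big_ord1 mxE mulr1.
have cP T : mx_pol (cell T) (fun=> 1%:M : 'M[R]_1) by move=> i j; exact: is_polC.
have J T := poly_integral_sqr (poly_int_cell pC T) (cP T).
move=> T; apply/negP => ZT.
have pos0 T' : Z T' -> 0 <= int_cell T' (pev (mpoly.mderiv ord0 X0)).
  by move=> _; rewrite pos; exact: (J T').1.
have := psumr_eq0P pos0 S0 ZT; rewrite pos => J0.
have [x Tx] := cell_neq0 pC T.
have /matrixP/(_ 0 0)/eqP := (J T).2 J0 x Tx.
by rewrite !mxE oner_eq0.
Qed.

End green_formula.

Lemma mxdot_skew_sym (R : realType) m (A S : 'M[R]_m) :
  2^-1 *: (A + A^T) = 0 -> S^T = S -> mxdot A S = 0.
Proof.
move=> /eqP; rewrite scaler_eq0 invr_eq0 pnatr_eq0/= => /eqP A0 SS.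
have : mxdot (A + A^T) S = 0 by rewrite A0 mxdot0l.
have -> : mxdot (A + A^T) S = mxdot A S *+ 2.
  rewrite mxdotDl mulr2n; congr (_ + _); rewrite !mxdotE exchange_big/=.
  by do 2 (apply: eq_bigr => ? _); rewrite mxE -{1}SS mxE.
by move=> /eqP; rewrite mulrn_eq0/= => /eqP.
Qed.

(** * Definiteness of the bilinear form *)

Section kernel.
Context {R : realType} {n : nat} {M : mesh (R := R) (1 + n)} (k : nat).
Hypotheses (pC : forall T : elem M, polyhedral (cell T))
  (fF : forall e : face M, flat_face (facet e)) (k_gt0 : (0 < k)%N)
  (disjF : forall e1 e2 : face M, e1 != e2 ->
    flat_set (facet e1) `&` flat_set (facet e2) = set0)
  (bdT : forall T : elem M, bd (cell T) =
    \bigcup_(e in [set e | faces T e]) closure (flat_set (facet e))).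
Local Notation rV := 'rV[R]_(1 + n).
Implicit Types (T : elem M) (e : face M) (v : wfun (M := M)).
Local Opaque weak_grad weak_div Qb.

Lemma strain0_rigid v T : Vh k v -> (forall x, cell T x -> weak_strain k v T x = 0) ->
  (forall e x, faces T e -> flat_set (facet e) x -> Qb k e (wint v T) x = wbd v e x) ->
  exists r, [/\ rigid_motion r, forall x, closure (cell T) x -> wint v T x = r x &
    forall e x, faces T e -> flat_set (facet e) x -> wbd v e x = r x].
Proof.
move=> Vv st0 Qv; have JT := poly_int_cell pC T.
have /choice[p pP] j : exists p, deg_le k p /\
    forall x, closure (cell T) x -> wint v T x 0 j = pev p x by exact: Vv.1 T 0 j.
pose r (x : rV) : rV := \row_j pev (p j) x.
have rE x : closure (cell T) x -> wint v T x = r x.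
  by move=> Tx; apply/rowP => j; rewrite (pP j).2// mxE.
pose s i j := mpoly.mderiv i (p j) + mpoly.mderiv j (p i).
pose phi (x : rV) : 'M[R]_(1 + n) := \matrix_(i, j) pev (s i j) x.
have sk i j : deg_le k.-1 (s i j).
  by apply: deg_leD; apply: deg_le_mderiv; exact: (pP _).1.
have phiP D : mxpoly_on k.-1 D phi.
  by move=> i j; exists (s i j); split => // [|x _]; [exact: sk|rewrite mxE].
have phisym x : (phi x)^T = phi x by apply/matrixP => i j; rewrite !mxE /s addrC.
have G0 : grad_form v T phi = 0.
  rewrite -((weak_gradP pC fF k_gt0 T Vv).2 phi (phiP _)).
  apply: (poly_integral0 JT) => x Tx.
  exact: mxdot_skew_sym (st0 x Tx) (phisym x).
pose q := \sum_i \sum_j mpoly.mderiv j (p i) * s i j.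
have Iq : int_cell T (pev q) = 0.
  rewrite -G0 (green_formula pC fF disjF bdT T p s); congr (- _ + _).
    by apply: (poly_integral_eq JT) => x /subset_closure Tx; rewrite rE.
  apply: eq_bigr => e Te.
  have fe x : flat_set (facet e) x -> wint v T x = r x.
    by move=> ex; apply: rE; exact: (flat_set_closure pC Te).
  (* The normal is constant on the flat face, so phi n has degree at most k - 1 there and belongs to
     V_(k-1)(e). Against it Q_b v_0 and v_0 have the same integral. *)
  have nP : face_space k e (fun x => normal (cell T) (facet e) *m (phi x)^T).
    apply: poly_face_space => i j.
    exists (\sum_l normal (cell T) (facet e) i l *: s j l); split.
      by apply: deg_le_sum => l _; apply: deg_leZ; exact: sk.
    move=> x _; rewrite -[RHS]/(pev _ x) pev_sum mxE; apply: eq_bigr => l _.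
    by rewrite pevZ !mxE.
  have ui := pol_flat_integrable fF (Vh_int_flat pC Vv Te).
  apply: etrans (eq_int_flat (g := fun x => mxdot (wint v T x)
    (normal (cell T) (facet e) *m (phi x)^T)) _) _.
    by move=> x ex; rewrite fe.
  apply: etrans (esym ((QbP fF k_gt0 ui).2 _ nP)) _.
  apply: eq_int_flat => x ex.
  exact: (congr1 (fun y => mxdot y (normal (cell T) (facet e) *m (phi x)^T)) (Qv e x Te ex)).
(* Since phi is symmetric, the product of the gradient of v_0 with phi is half of |phi|^2. *)
have qq : \sum_i \sum_j s i j * s i j = q + q.
  have qT : q = \sum_i \sum_j mpoly.mderiv i (p j) * s i j.
    rewrite /q exchange_big; do 2 (apply: eq_bigr => ? _).
    by rewrite /s addrC.
  rewrite {1}qT /q -big_split/=; apply: eq_bigr => i _.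
  by rewrite -big_split/=; apply: eq_bigr => j _; rewrite -mulrDl.
have phi0 : forall x, cell T x -> phi x = 0.
  apply: (poly_integral_sqr JT (mxpoly_on_mx_pol (phiP _))).2.
  rewrite (poly_integral_eq JT (g := fun x => 1 * pev q x + pev q x)).
    by rewrite (poly_integral_lin JT) ?Iq ?mulr0 ?addr0//; exact: is_pol_pev.
  move=> x _; rewrite mul1r -pevD -qq pev_sum mxdotE; apply: eq_bigr => i _.
  by rewrite pev_sum; apply: eq_bigr => j _; rewrite pevM !mxE.
have s0 i j : s i j = 0.
  apply: (pev_eq0 (open_cell pC (T := T)) (cell_neq0 pC T)) => x /phi0/matrixP/(_ i j).
  by rewrite !mxE.
have rr : rigid_motion r by exact: rigid_motion_strain0.
exists r; split => // e x Te ex.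
(* On e, v_0 is now a rigid motion, hence an element of V_(k-1)(e), so that Q_b v_0 = v_0. *)
apply: etrans (esym (Qv e x Te ex)) _.
apply: (Qb_unique fF k_gt0 (pol_flat_integrable fF (Vh_int_flat pC Vv Te))
  (rigid_face_space k e rr) _ ex) => psi _.
by apply: eq_int_flat => y ey; rewrite rE//; exact: (flat_set_closure pC Te).
Qed.

Hypotheses (disjC : forall T1 T2 : elem M, T1 != T2 -> cell T1 `&` cell T2 = set0)
  (faceT : forall e : face M, exists T, faces T e).
Variable Omega : set rV.
Hypothesis sharedF : forall e : face M, flat_set (facet e) `<=` bd Omega \/
  exists T1 T2, [/\ T1 != T2, faces T1 e & faces T2 e].
Variables (mu lambda : R).
Hypotheses (mu_gt0 : 0 < mu) (lambda_ge0 : 0 <= lambda).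

Lemma a_s_definite v : Vh0 k Omega v -> a_s k mu lambda v v = 0 -> vanishes v.
Proof.
move=> [Vv vbd] /(a_s_eq0 pC fF k_gt0 mu_gt0 lambda_ge0 Vv)[st0 Qv].
have /choice[r rP] T := strain0_rigid Vv (st0 T) (Qv T).
have req0 T e : faces T e -> (forall x, flat_set (facet e) x -> r T x = 0) ->
    forall x, r T x = 0.
  move=> Te re0; have [n1 Fn _] := face_normal Te; have [rr _ _] := rP T.
  exact: rigid_motion_eq0 (fF e) Fn (enorm1 n1) rr re0.
have shared T T' e : faces T e -> faces T' e -> (forall x, r T x = 0) -> forall x, r T' x = 0.
  move=> Te T'e rT; apply: (req0 T' e) => // x ex.
  have [_ _ b] := rP T; have [_ _ b'] := rP T'.
  by rewrite -(b' e x T'e ex) (b e x Te ex).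
have r0 T : forall x, r T x = 0.
  apply: contrapT => rT.
  suff Zshared : forall T1 e, `[< ~ (forall x, r T1 x = 0) >] -> faces T1 e ->
      exists T', [/\ T' != T1, faces T' e & `[< ~ (forall x, r T' x = 0) >]].
    by have /negP := no_closed_family pC fF disjF bdT disjC Zshared T; apply; exact/asboolP.
  move=> T1 e /asboolP rT1 T1e; have [ebd|[T2 [T3 [T23 T2e T3e]]]] := sharedF e.
    exfalso; apply: rT1; apply: (req0 T1 e) => // x ex; have [_ _ b] := rP T1.
    by rewrite -(b e x T1e ex); exact: vbd.
  have Z' T' : faces T' e -> `[< ~ (forall x, r T' x = 0) >].
    by move=> T'e; apply/asboolP => rT'; apply: rT1; exact: (shared T' T1 e T'e T1e rT').
  have [E|E] := eqVneq T2 T1; last by exists T2; split => //; exact: Z'.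
  by exists T3; split => //; [rewrite -E eq_sym|exact: Z'].
split=> [T x Tx|e x ex]; first by have [_ a _] := rP T; rewrite a.
by have [T Te] := faceT e; have [_ _ b] := rP T; rewrite (b e x Te ex).
Qed.

End kernel.

(** * Well-posedness *)

Section data.
Context {R : realType}.
Local Notation lam := (@lebesgue_rV R).
Local Notation mR := (measurableTypeR R).

(** From |f| <= f^2 + 1, the product is dominated by C (f^2 + 1), integrable because D has finite
    measure. *)
Lemma integrable_L2M n (D : set 'rV[R]_n) (f g : 'rV[R]_n -> R) (C : R) :
  measurable D -> coord_bounded D -> L2 D f -> measurable_fun setT (g : _ -> mR) ->
  (forall x, D x -> `|g x| <= C) -> (lam n).-integrable D (fun x => (f x * g x)%:E).
Proof.
move=> mD bD fL2 mg gC.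
have mF : measurable_fun setT (f \_ D : _ -> mR).
  by move: fL2; rewrite /L2 inE => /andP[+ _]; rewrite inE.
have iF2 := integrableS measurableT mD (@subsetT _ D) (Lfun2_integrable_sqr fL2).
have i1 : (lam n).-integrable D (EFin \o cst 1).
  by apply: (@integrable_bounded _ _ _ _ 1) => // x _; rewrite normr1.
have iC := integrableZl mD C (integrableD mD iF2 i1).
apply: (le_integrable mD _ _ iC).
  apply/measurable_EFinP; apply: (eq_measurable_fun ((f \_ D) \* g)).
    by move=> x Dx; rewrite /= patchE Dx.
  by apply: measurable_funTS; exact: measurable_funM.
move=> x Dx; rewrite /= patchE mem_set// lee_fin.
have C0 : 0 <= C := le_trans (normr_ge0 _) (gC x Dx).
have h : `|f x| <= f x ^+ 2 + 1.
  have := sqr_ge0 (`|f x| - 1); rewrite -[f x ^+ 2]real_normK ?num_real//.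
  by move: (normr_ge0 (f x)); set a := `|f x| => a0 sq; nra.
rewrite [leLHS]normrM [leRHS]ger0_norm ?mulr_ge0 ?addr_ge0 ?sqr_ge0// mulrC.
by rewrite ler_pM// gC.
Qed.

Context {n : nat} {M : mesh (R := R) (1 + n)} (k : nat).
Hypotheses (pC : forall T : elem M, polyhedral (cell T)).
Implicit Types (T : elem M) (e : face M) (v w : wfun (M := M)).

Lemma flat_integrable_L2 e (u : 'rV[R]_(1 + n) -> 'rV[R]_(1 + n)) : flat_face (facet e) ->
  (forall i, L2_flat (facet e) (fun x => u x 0 i)) -> flat_integrable e u.
Proof.
move=> [_ pe] uL i p.
have bD := polyhedral_coord_bounded pe.
have [C pC'] := bounded_pev_chart p bD.
apply: (integrable_L2M (g := pev p \o chart (facet e)) (C := C) _ bD (uL i)) => //.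
- by apply: open_measurable_rV; case: pe.
- exact: (measurableT_comp (measurable_pev p) (measurable_chart _)).
Qed.

Lemma broken_lin a v w x : broken (vlin a v w) x = a *: broken v x + broken w x.
Proof.
rewrite /broken scaler_sumr -big_split/=; apply: eq_bigr => T _.
by rewrite scalerDr !scalerA mulrC.
Qed.

Lemma broken_vanishes v x : vanishes v -> broken v x = 0.
Proof.
move=> [v0 _]; rewrite /broken big1// => T _; rewrite indicE.
case: (boolP (x \in cell T)) => [|_]; last by rewrite scale0r.
by rewrite inE => /subset_closure Tx; rewrite v0// scaler0.
Qed.

Variables (Omega : set 'rV[R]_(1 + n)) (f : 'rV[R]_(1 + n) -> 'rV[R]_(1 + n)).
Hypotheses (pO : polyhedral Omega) (fL2 : forall i, L2 Omega (fun x => f x 0 i)).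

Lemma integrable_broken v : Vh k v ->
  (lam (1 + n)).-integrable Omega (EFin \o (fun x => mxdot (f x) (broken v x))).
Proof.
move=> Vv; have [K OK] := polyhedral_coord_bounded pO.
have mO : measurable Omega by apply: open_measurable_rV; case: pO.
have /choice[p pP] (Ti : elem M * 'I_(1 + n)) := Vh_int Ti.1 Vv 0 Ti.2.
have /choice[C CP] (Ti : elem M * 'I_(1 + n)) := bounded_pev (p Ti) K.
have brE i x : broken v x 0 i = \sum_T \1_(cell T) x * pev (p (T, i)) x.
  rewrite /broken summxE; apply: eq_bigr => T _; rewrite mxE indicE.
  case: (boolP (x \in cell T)) => [|_]; last by rewrite !mul0r.
  by rewrite inE => /subset_closure Tx; rewrite (pP (T, i)).
have ii i : (lam (1 + n)).-integrable Omega (fun x => (f x 0 i * broken v x 0 i)%:E).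
  apply: (integrable_L2M (C := \sum_T C (T, i)) mO _ (fL2 i)); first by exists K.
    rewrite (_ : (fun x => _) = fun x => \sum_T \1_(cell T) x * pev (p (T, i)) x); last first.
      by apply/funext => x; exact: brE.
    apply: measurable_sum => T; apply: measurable_funM; last exact: measurable_pev.
    by apply: measurable_indic; apply: open_measurable_rV; exact: (open_cell pC).
  move=> x /OK xK; rewrite brE (le_trans (ler_norm_sum _ _ _))//; apply: ler_sum => T _.
  rewrite normrM -[leRHS]mul1r ler_pM//; last exact: CP.
  by rewrite indicE; case: (_ \in _); rewrite ?normr1 ?normr0.
apply: eq_integrable (integrable_sum mO (index_enum 'I_(1 + n)) (P := xpredT)
  (fun i _ => ii i)) => // x _.
by rewrite /= mxdot_rVE -sumEFin.
Qed.

Lemma Rintegral_broken_lin a v w : Vh k v -> Vh k w ->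
  \int[lam (1 + n)]_(x in Omega) mxdot (f x) (broken (vlin a v w) x) =
  a * (\int[lam (1 + n)]_(x in Omega) mxdot (f x) (broken v x)) +
  \int[lam (1 + n)]_(x in Omega) mxdot (f x) (broken w x).
Proof.
move=> /integrable_broken iv /integrable_broken iw.
have mO : measurable Omega by apply: open_measurable_rV; case: pO.
rewrite -RintegralZl// -RintegralD//; last first.
  by apply: eq_integrable (integrableZl mO a iv) => // y _; rewrite /= EFinM.
by apply: eq_Rintegral => x _; rewrite broken_lin mxdotDr mxdotZr.
Qed.

Lemma Rintegral_broken_vanishes v : vanishes v ->
  \int[lam (1 + n)]_(x in Omega) mxdot (f x) (broken v x) = 0.
Proof.
move=> v0; rewrite /Rintegral (eq_integral (cst 0%E)) ?integral0// => x _.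
by rewrite broken_vanishes// mxdot0r.
Qed.

End data.

Section well_posedness.
Context {R : realType} {n : nat} {M : mesh (R := R) (1 + n)} (k : nat).
Hypotheses (pC : forall T : elem M, polyhedral (cell T))
  (fF : forall e : face M, flat_face (facet e)) (k_gt0 : (0 < k)%N)
  (disjF : forall e1 e2 : face M, e1 != e2 ->
    flat_set (facet e1) `&` flat_set (facet e2) = set0)
  (bdT : forall T : elem M, bd (cell T) =
    \bigcup_(e in [set e | faces T e]) closure (flat_set (facet e)))
  (disjC : forall T1 T2 : elem M, T1 != T2 -> cell T1 `&` cell T2 = set0)
  (faceT : forall e : face M, exists T, faces T e).
Local Notation rV := 'rV[R]_(1 + n).
Variable Omega : set rV.
Hypotheses (pO : polyhedral Omega)
  (sharedF : forall e : face M, flat_set (facet e) `<=` bd Omega \/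
    exists T1 T2, [/\ T1 != T2, faces T1 e & faces T2 e]).
Variables (mu lambda : R).
Hypotheses (mu_gt0 : 0 < mu) (lambda_ge0 : 0 <= lambda).
Variables (f uhat : rV -> rV).
Hypotheses (fL2 : forall i, L2 Omega (fun x => f x 0 i))
  (uhatL2 : forall e : face M, on_boundary Omega e ->
    forall i, L2_flat (facet e) (fun x => uhat x 0 i)).
Implicit Types (T : elem M) (e : face M) (u v w : wfun (M := M)).
Local Opaque weak_grad weak_div Qb a_s.

Let B := a_s k mu lambda (M := M).

Lemma a_s_linr a u v w : Vh k u -> Vh k v -> Vh k w ->
  B w (vlin a u v) = a * B w u + B w v.
Proof.
move=> Vu Vv Vw.
apply: etrans (a_s_sym k mu lambda w (vlin a u v)) _.
apply: etrans (a_s_linl pC fF k_gt0 mu lambda a Vu Vv Vw) _.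
exact: (congr2 (fun x y => a * x + y) (a_s_sym k mu lambda u w) (a_s_sym k mu lambda v w)).
Qed.

Lemma Vh0_lin a v w : Vh0 k Omega v -> Vh0 k Omega w -> Vh0 k Omega (vlin a v w).
Proof.
move=> [Vv v0] [Vw w0]; split; first exact: Vh_lin.
by move=> e eO x ex; rewrite /= v0// w0// scaler0 addr0.
Qed.

Lemma wg_solution_unique u u' : wg_solution k Omega mu lambda f uhat u ->
  wg_solution k Omega mu lambda f uhat u' -> weq u u'.
Proof.
move=> [Vu ub uL] [Vu' ub' uL']; pose d := vlin (-1) u' u.
have Vd : Vh k d by exact: Vh_lin.
have V0d : Vh0 k Omega d.
  split => // e eO x ex; apply: etrans (congr2 (fun y z => -1 *: y + z) (ub' e eO x ex) (ub e eO x ex)) _.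
  by rewrite scaleN1r addNr.
have d0 : B d d = 0.
  apply: etrans (a_s_linl pC fF k_gt0 mu lambda (-1) Vu' Vu Vd) _.
  apply: etrans (congr2 (fun x y => -1 * x + y) (uL' d V0d) (uL d V0d)) _.
  by rewrite mulN1r addNr.
have [di db] := a_s_definite pC fF k_gt0 disjF bdT disjC faceT sharedF mu_gt0 lambda_ge0 V0d d0.
have sub0 (x y : rV) : -1 *: x + y = 0 -> y = x.
  by move=> /eqP; rewrite scaleN1r addrC subr_eq0 => /eqP.
split=> [T x Tx|e x ex]; apply: sub0; first exact: di Tx.
exact: db ex.
Qed.

(* Pairs in [wfun] are encoded as functions on the disjoint union of the points
   of the cells and of the faces. *)
Let A : Type := (elem M * rV) + (face M * rV).

Let toW (g : A -> rV) : wfun (M := M) :=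
  WFun (fun T x => g (inl (T, x))) (fun e x => g (inr (e, x))).

Let ofW v : A -> rV := fun a =>
  match a with inl Tx => wint v Tx.1 Tx.2 | inr ex => wbd v ex.1 ex.2 end.

Let ofWK v : toW (ofW v) = v. Proof. by case: v. Qed.

Let E : set A := fun a => match a with
  inl Tx => closure (cell Tx.1) Tx.2 | inr ex => flat_set (facet ex.1) ex.2 end.

Let P : set (A -> rV) := fun g => Vh0 k Omega (toW g).

Let vanishesE g : (forall a, E a -> g a = 0) -> vanishes (toW g).
Proof. by move=> g0; split=> [T x Tx|e x ex]; exact: g0. Qed.

(** An index is a cell or a face together with a vector monomial of degree at most k; the function
    [basis] attached to it is supported on that cell or face. On faces these functions span more
    than V_(k-1)(e), which is harmless for a family that only has to span. *)
Let J := ((elem M + face M)%type * ('I_1 * 'I_(1 + n) * mpoly.bmultinom (1 + n) k.+1))%type.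

Let tag (a : A) : elem M + face M := match a with inl Tx => inl Tx.1 | inr ex => inr ex.1 end.

Let point (a : A) : rV := match a with inl Tx => Tx.2 | inr ex => ex.2 end.

Let mono (j : 'I_1 * 'I_(1 + n) * mpoly.bmultinom (1 + n) k.+1) (x : rV) : rV :=
  pev (mpoly.mpolyX R (mpoly.bmnm j.2)) x *: delta_mx j.1.1 j.1.2.

Let basis (i : J) (a : A) : rV := (i.1 == tag a)%:R *: mono i.2 (point a).

Let P_span g : P g -> exists c : J -> R, forall a, E a -> g a = \sum_i c i *: basis i a.
Proof.
move=> [[gi gb] _].
have [c cE] : exists c : elem M + face M -> _ -> R, forall a, E a ->
    g a = \sum_j c (tag a) j *: mono j (point a).
  have /choice[c1 c1E] T := mxpoly_span (gi T).
  have /choice[c2 c2E] e := mxpoly_span (face_space_poly k_gt0 (gb e)).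
  exists (fun t => match t with inl T => c1 T | inr e => c2 e end).
  by move=> [[T x]|[e x]] /= Ex; [exact: c1E|exact: c2E].
exists (fun i => c i.1 i.2) => a Ea; rewrite (cE a Ea).
rewrite -(pair_bigA _ (fun t j => c t j *: ((t == tag a)%:R *: mono j (point a))))/=.
rewrite (bigD1 (tag a))//= [X in _ + X]big1 ?addr0; last first.
  by move=> t /negbTE ta; rewrite big1// => j _; rewrite ta scale0r scaler0.
by apply: eq_bigr => j _; rewrite eqxx scale1r.
Qed.

Lemma wg_solution_exists : exists u : wfun (M := M), wg_solution k Omega mu lambda f uhat u.
Proof.
(* A lifting of the boundary data: Q_b uhat on boundary faces and 0 elsewhere. The solution is
   sought as [ug] plus an element g of V_h^0, which must solve the Galerkin problem with right side
   (f, .) - a_s(ug, .). *)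
pose ug : wfun (M := M) := WFun (fun _ _ => 0)
  (fun e => if `[< on_boundary Omega e >] then Qb k e uhat else fun=> 0).
have Vug : Vh k ug.
  split=> [T|e]; first exact: mxpoly_on0.
  rewrite /=; case: ifPn => [/asboolP eO|_]; last exact: face_space0.
  exact: (QbP fF k_gt0 (flat_integrable_L2 (fF e) (uhatL2 eO))).1.
pose If v := \int[lebesgue_rV (1 + n)]_(x in Omega) mxdot (f x) (broken v x).
pose L (g : A -> rV) := If (toW g) - B ug (toW g).
have PV g : P g -> Vh k (toW g) by case.
have P0 : P (fun=> 0).
  by split => //; split=> [T|e]; [exact: mxpoly_on0|exact: face_space0].
have PL a g h : P g -> P h -> P (fun x => a *: g x + h x) by move=> Pg Ph; exact: (Vh0_lin a Pg Ph).
have Bl a g h l : P g -> P h -> P l ->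
    B (toW (fun x => a *: g x + h x)) (toW l) = a * B (toW g) (toW l) + B (toW h) (toW l).
  by move=> Pg Ph Pl; exact: (a_s_linl pC fF k_gt0 mu lambda a (PV g Pg) (PV h Ph) (PV l Pl)).
have Br a g h l : P g -> P h -> P l ->
    B (toW l) (toW (fun x => a *: g x + h x)) = a * B (toW l) (toW g) + B (toW l) (toW h).
  by move=> Pg Ph Pl; exact: (a_s_linr a (PV g Pg) (PV h Ph) (PV l Pl)).
have Ll a g h : P g -> P h -> L (fun x => a *: g x + h x) = a * L g + L h.
  move=> Pg Ph.
  have := a_s_linr a (PV g Pg) (PV h Ph) Vug.
  have := Rintegral_broken_lin pC pO fL2 a (PV g Pg) (PV h Ph).
  rewrite -/(If _) -/(If (toW g)) -/(If (toW h)) /L => + H2.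
  move=> H1; apply: etrans (congr2 (fun x y => x - y) H1 H2) _.
  by rewrite mulrBr opprD addrACA.
have Bpos g : P g -> B (toW g) (toW g) = 0 -> forall a, E a -> g a = 0.
  move=> Pg Bg; have [gi gb] := a_s_definite pC fF k_gt0 disjF bdT disjC faceT sharedF
    mu_gt0 lambda_ge0 Pg Bg.
  by move=> [[T x]|[e x]]; [exact: gi|exact: gb].
have B0 g h : P g -> P h -> (forall a, E a -> h a = 0) -> B (toW g) (toW h) = 0.
  move=> Pg Ph /vanishesE h0; apply: etrans (a_s_sym k mu lambda (toW g) (toW h)) _.
  exact: (a_s_vanishes pC fF k_gt0 mu lambda _ (PV h Ph) h0).
have L0 g : P g -> (forall a, E a -> g a = 0) -> L g = 0.
  move=> Pg /vanishesE g0; rewrite /L /If Rintegral_broken_vanishes//.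
  have -> : B ug (toW g) = 0.
    apply: etrans (a_s_sym k mu lambda ug (toW g)) _.
    exact: (a_s_vanishes pC fF k_gt0 mu lambda _ (PV g Pg) g0).
  by rewrite subr0.
have [g [Pg gL]] := galerkin_exists P0 PL P_span Bl Br Ll Bpos B0 L0.
exists (vlin 1 ug (toW g)); split.
- exact: Vh_lin (PV g Pg).
- move=> e eO x ex; have [_ /(_ e eO x ex) g0] := Pg.
  by rewrite /= in g0; rewrite /= g0 addr0 scale1r asboolT.
- move=> v V0v; have Pv : P (ofW v) by rewrite /P ofWK.
  have := gL _ Pv; rewrite /L ofWK => H.
  apply: etrans (a_s_linl pC fF k_gt0 mu lambda 1 Vug (PV g Pg) V0v.1) _.
  apply: etrans (congr1 (fun y => 1 * B ug v + y) H) _.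
  by rewrite mul1r addrC subrK.
Qed.

End well_posedness.

Unset Implicit Arguments.

Theorem theorem3p1 (R : realType) (d : nat) (hd : d = 2%N \/ d = 3%N)
    (Omega : set 'rV[R]_d) (hOmega : polyhedral Omega)
    (hLip : lipschitz_boundary Omega)
    (M : mesh (R := R) d) (hM : polyhedral_partition Omega M)
    (hreg : shape_regular M)
    (mu lambda : R) (hmu : 0 < mu) (hlambda : 0 <= lambda)
    (k : nat) (hk : (1 <= k)%N)
    (f uhat : 'rV[R]_d -> 'rV[R]_d)
    (hf : forall i, L2 Omega (fun x => f x 0 i))
    (huhat : forall e : face M, on_boundary Omega e ->
       forall i, L2_flat (facet e) (fun x => uhat x 0 i)) :
  (exists u : wfun (M := M), wg_solution k Omega mu lambda f uhat u) /\
  (forall u u' : wfun (M := M),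
     wg_solution k Omega mu lambda f uhat u ->
     wg_solution k Omega mu lambda f uhat u' -> weq u u').
Proof.
(* The dimension is put in the form 1 + n, in which block matrices split off the first coordinate; d
   = 2 and d = 3 are n = 1 and n = 2. *)
have main n (O : set 'rV[R]_(1 + n)) (N : mesh (R := R) (1 + n)) (g uh : 'rV[R]_(1 + n) -> 'rV[R]_(1 + n)) :
    polyhedral O -> polyhedral_partition O N -> (forall i, L2 O (fun x => g x 0 i)) ->
    (forall e : face N, on_boundary O e -> forall i, L2_flat (facet e) (fun x => uh x 0 i)) ->
    (exists u : wfun (M := N), wg_solution k O mu lambda g uh u) /\
    (forall u u' : wfun (M := N), wg_solution k O mu lambda g uh u ->
      wg_solution k O mu lambda g uh u' -> weq u u').
  move=> pO [[pC disjC _] [fF disjF bdT faceT sharedF]] gL2 uhL2; split.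
    exact: (wg_solution_exists pC fF hk disjF bdT disjC faceT pO sharedF hmu hlambda gL2 uhL2).
  move=> u u'.
  exact: (wg_solution_unique pC fF hk disjF bdT disjC faceT sharedF hmu hlambda).
by case: hd => dE; subst d; [exact: (main 1%N)|exact: (main 2%N)].
Qed.
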